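(* Let $p\in(1/2,1]$, $q=1-p$, $\chi\in(0,1/2)$ and $\chi'\in(\chi,1/2)$. For $M\in\mathbb{Z}_{\geq1}$ set $C=C(M)=2\sqrt{M/(p-q)}$, let $X(t)$ be the position at time $t$ of the second class particle in the ASEP $(\eta_\ell)_{\ell\ge0}=(\eta^{t,C}_\ell)_{\ell\geq 0}$ described in the context, and let $$\mathcal{P}=\sup\{i\in\mathbb{Z}\mid x_i(t-t^{\chi})>-t^{\chi'}\},\qquad \mathcal{H}=\sup\{i\in\mathbb{Z}\mid H_i(t-t^{\chi})<t^{\chi'}\}.$$ Then for every $\varepsilon>0$ $$\lim_{M\to\infty}\lim_{t\to\infty}\mathbb{P}\left(|X(t)-\mathcal{H}+\mathcal{P}|>M^{\varepsilon}\right)=0.$$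
   Context: ASEP with a second class particle: a continuous-time Markov process on $\{0,1,2\}^{\mathbb{Z}}$ ($1$ = first class particle, $0$ = hole, $2$ = second class particle; only one second class particle is present). First class particles attempt jumps one step to the right at rate $p$ and one step to the left at rate $q=1-p$; a jump is executed only if the target site is not occupied by a first class particle. The second class particle interacts with holes like a particle and with first class particles like a hole. Equivalently, with priority order first class particle $>$ second class particle $>$ hole, for each $z\in\mathbb Z$ the contents of sites $z,z+1$ are exchanged at rate $p$ if the content of $z$ has strictly higher priority than that of $z+1$, and at rate $q$ if the content of $z+1$ has strictly higher priority than that of $z$. Initial configuration: for $t>0$ and $C\in\mathbb{R}$ let $\kappa_t=\lfloor (p-q)(t-Ct^{1/2})\rfloor$ (nonnegative for $t$ large). $\eta_0=\eta_0^{t,C}$ has the second class particle at the origin, $\eta_0(0)=2$, first class particles exactly at the sites $x_n(0)$, $n\ge -\kappa_t+1$, where $$x_n(0)=-n-\kappa_t\ \text{ if } n\geq 1,\qquad x_n(0)=-n+1\ \text{ if } -\kappa_t+1\leq n\leq 0,$$ and holes at all other sites, which are labeled $$H_n(0)=n+\kappa_t\ \text{ if } n\geq 1,\qquad H_n(0)=n-1\ \text{ if } -\kappa_t+1\leq n\leq 0.$$ $x_n(\ell)$ and $H_n(\ell)$ denote the positions at time $\ell$ of the first class particle, respectively hole, that started from $x_n(0)$, respectively $H_n(0)$ (a hole moves whenever it exchanges places with a first or second class particle); $\mathcal P,\mathcal H$ are defined using the labels $i$ that exist. The process is run on the time interval $[0,t]$ with the same $t$. *)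

(* Defs.v *)
From HB Require Import structures.
From mathcomp Require Export all_boot all_order all_algebra.
From mathcomp Require Export all_classical all_reals all_analysis.
Export Order.TTheory GRing.Theory Num.Theory.
Export numFieldNormedType.Exports.

Set Implicit Arguments.
Unset Strict Implicit.
Unset Printing Implicit Defensive.

Local Open Scope classical_set_scope.
Local Open Scope ring_scope.

(** Hole = 0, First = 1, Second = 2 in the state space {0,1,2}^Z. *)
Inductive site := Hole | First | Second.

Definition priority (a : site) : nat :=
  match a with Hole => 0 | Second => 1 | First => 2 end.

Section Trajectories.
Variable R : realType.

(** The piecewise constant function f has left limit a at s. *)
Definition just_before (A : Type) (f : R -> A) (s : R) (a : A) : Prop :=
  \forall u \near s^'-, f u = a.

Definition right_cont (A : Type) (f : R -> A) : Prop :=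
  forall s, 0 <= s -> \forall u \near s^'+, f u = f s.

Definition arrival (N : R -> nat) (s : R) : Prop :=
  0 < s /\ ~ just_before N s (N s).

(** Harris graphical construction: every bond {z, z+1} carries two clocks,
    [N (z, true)] of intensity p and [N (z, false)] of intensity q.  At an
    arrival of the first one the contents of z and z+1 are exchanged iff z has
    strictly higher priority just before; at an arrival of the second one, iff
    z+1 has strictly higher priority. *)
Definition exchange (N : int * bool -> R -> nat) (eta : R -> int -> site)
    (s : R) (z : int) : Prop :=
  exists a b : site,
    [/\ just_before (eta ^~ z) s a, just_before (eta ^~ (z + 1)) s b &
        (arrival (N (z, true)) s /\ (priority b < priority a)%N) \/
        (arrival (N (z, false)) s /\ (priority a < priority b)%N)].

(** Two exchanges at the same time at adjacent bonds are not catered for: almost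
    surely no two clocks have a common arrival. *)
Definition asep_path (N : int * bool -> R -> nat) (eta : R -> int -> site)
    : Prop :=
  [/\ forall z, right_cont (eta ^~ z),
      forall s z, 0 < s -> exchange N eta s z ->
        just_before (eta ^~ (z + 1)) s (eta s z) /\
        just_before (eta ^~ z) s (eta s (z + 1)) &
      forall s z, 0 < s -> ~ exchange N eta s z -> ~ exchange N eta s (z - 1) ->
        just_before (eta ^~ z) s (eta s z)].

(** [x] is the trajectory of the object (particle or hole) located at [x 0] at
    time 0: it moves exactly when the content of its site is exchanged with
    that of a neighbour. *)
Definition tagged_path (N : int * bool -> R -> nat) (eta : R -> int -> site)
    (x : R -> int) : Prop :=
  right_cont x /\
  forall s, 0 < s -> exists y : int,
    [/\ just_before x s y,
        exchange N eta s y -> x s = y + 1,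
        exchange N eta s (y - 1) -> x s = y - 1 &
        ~ exchange N eta s y -> ~ exchange N eta s (y - 1) -> x s = y].

End Trajectories.

Section InitialConfiguration.
Variable kappa : int.

Definition x_init (n : int) : int :=
  if 1 <= n then - n - kappa else - n + 1.

Definition h_init (n : int) : int :=
  if 1 <= n then n + kappa else n - 1.

Definition eta_init (z : int) : site :=
  if z == 0 then Second
  else if `[< exists2 n : int, - kappa + 1 <= n & z = x_init n >] then First
  else Hole.

End InitialConfiguration.

Section Process.
Context {R : realType}.

(** Independent Poisson processes [N c] of intensities [lam c] on [0, +oo[.
    The last clause is the joint independence of all the increments of all the
    processes over a common grid [tau 0 <= ... <= tau m].  The second argument
    of [poisson_prob] is unused by the library; [poisson_prob 0] is the Dirac
    mass at 0, so a clock of intensity 0 never rings. *)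
Definition independent_poisson_processes d (Omega : measurableType d)
    (P : probability Omega R) (I : eqType) (lam : I -> R)
    (N : I -> R -> Omega -> nat) : Prop :=
  [/\ forall c s k, 0 <= s -> measurable [set w | N c s w = k],
      {ae P, forall w, forall c,
        [/\ N c 0 w = 0%N, right_cont (N c ^~ w) &
            forall r s, 0 <= r -> r <= s -> (N c r w <= N c s w)%N]},
      forall c r s k, 0 <= r -> r <= s ->
        P [set w | N c s w = (N c r w + k)%N] =
        poisson_prob (lam c * (s - r)) 0 [set k] &
      forall (J : seq I) (m : nat) (tau : nat -> R) (k : I -> nat -> nat),
        uniq J -> 0 <= tau 0%N ->
        (forall j, (j < m)%N -> tau j <= tau j.+1) ->
        P [set w | forall c j, c \in J -> (j < m)%N ->
                     N c (tau j.+1) w = (N c (tau j) w + k c j)%N] =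
        (\prod_(c <- J) \prod_(j < m)
           P [set w | N c (tau j.+1) w = (N c (tau j) w + k c j)%N])%E].

(** [eta] is an ASEP with jump rates [p], [q] started from [eta_init kappa];
    [X] is the position of its second class particle and [x n], [h n], for
    [n >= - kappa + 1], are the positions of the labelled first class particles
    and holes.  Nothing is required of [x n], [h n] for the other [n]. *)
Definition second_class_asep (p q : R) (kappa : int)
    d (Omega : measurableType d) (P : probability Omega R)
    (eta : R -> Omega -> int -> site) (x h : int -> R -> Omega -> int)
    (X : R -> Omega -> int) : Prop :=
  [/\ forall s z a, 0 <= s -> measurable [set w | eta s w z = a],
      forall n s y, - kappa + 1 <= n -> 0 <= s ->
        measurable [set w | x n s w = y] /\ measurable [set w | h n s w = y],
      forall s y, 0 <= s -> measurable [set w | X s w = y] &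
      exists N : int * bool -> R -> Omega -> nat,
        independent_poisson_processes P
          (fun c : int * bool => if c.2 then p else q) N /\
        {ae P, forall w,
          let Nw := fun c s => N c s w in
          let etaw := fun s => eta s w in
          [/\ etaw 0 = eta_init kappa,
              asep_path Nw etaw,
              forall s, 0 <= s -> etaw s (X s w) = Second &
              forall n, - kappa + 1 <= n ->
                [/\ x n 0 w = x_init kappa n, tagged_path Nw etaw (x n ^~ w),
                    h n 0 w = h_init kappa n & tagged_path Nw etaw (h n ^~ w)]]}].

Definition kappa_of (p q C t : R) : int :=
  Num.floor ((p - q) * (t - C * t `^ 2^-1)).

Definition C_of (p q : R) (M : nat) : R := 2 * Num.sqrt (M%:R / (p - q)).

(** Suprema over the existing labels, taken in the extended reals: for fixed t
    the first class particle (hole) with the smallest label may, with positive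
    probability, violate the condition, in which case the set is empty. *)
Definition calP (kappa : int) (chi chi' t : R) (x : int -> R -> int) : \bar R :=
  ereal_sup [set (n%:~R : R)%:E | n in
    [set n : int | - kappa + 1 <= n /\ - t `^ chi' < (x n (t - t `^ chi))%:~R]].

Definition calH (kappa : int) (chi chi' t : R) (h : int -> R -> int) : \bar R :=
  ereal_sup [set (n%:~R : R)%:E | n in
    [set n : int | - kappa + 1 <= n /\ (h n (t - t `^ chi))%:~R < t `^ chi']].

End Process.

(* Main.v *)
Require Import Defs.
From mathcomp Require Import zify ring lra measurable_realfun.

Set Implicit Arguments.
Unset Strict Implicit.
Unset Printing Implicit Defensive.

Local Open Scope classical_set_scope.
Local Open Scope ring_scope.

(** Give class 4 to the first class particles starting on the left of [- kappa],
    class 3 to those of [1, kappa], class 2 to the second class particle, class 1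
    to the holes of [- kappa, - 1] and class 0 to the holes on the right of
    [kappa].  The classes 1, 2, 3 form a word of [2 kappa + 1] letters, of which
    adjacent letters are sorted with probability [p] and antisorted with
    probability [q] whenever the environment (classes 4 and 0) lets them be
    neighbours.  For every environment this preserves the measure proportional to
    [(q / p) ^ inversions], under which the place of the letter 2 is tight around
    [kappa], uniformly in [kappa].  By the choice of [C], at times of order [t] at
    most [t ^ delta] particles of class 4 have reached the window of radius
    [t ^ chi'], and their density there is of order [t ^ (delta - 1 / 2)]: an
    exponential moment of the height is iterated over [t ^ delta] blocks of time,
    each of which gains a constant factor because, by the Cole-Hopf transform, the
    height is small at the edge with positive probability.  By reflection the same
    holds for class 0.  Hence during the last [t ^ chi] time units the window is
    free from the environment, the word relaxes to its stationary law, and there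
    [X - calH + calP] is the place of the letter 2 minus [kappa].

    The estimates are made for discrete-time chains on a finite box; the process
    is compared with them on the event that each cell of a fine grid contains at
    most one arrival, between two bonds whose clocks never ring. *)


(** * Discrete-time chains *)

(** The inner limit has to exist, so an upper bound on the probability is not enough: it is compared
    from both sides with the stationary probability that the letter 2 is far from the middle, and
    this one converges because the unnormalized sums are monotone and bounded in [kappa]. The
    obstacle in the environment is that [C] stays fixed while [t] grows: the leading particles of
    class 4 may pass the window by a distance of order [sqrt t], and a single exponential moment
    sees no smaller scale. Hence [D] blocks of length about [t / D], after each of which [D] leading
    particles are given up. The gain is [ga ^ D] with [ga < 1]; an overshoot of order [sqrt t] costs
    only [exp (K * sqrt D)], because the scale of a block is [sqrt (t / D)]. The relaxation of the
    word uses no spectral gap: the total dissipation is bounded uniformly in the length of the word,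
    hence small at some moment of a long time interval, and the sorted word, from which the process
    starts, has weight one in a sum of weights that is bounded in [kappa]. *)

Section Chain.
Context {R : realType} (p q h : R) (bs : seq int).

Definition gen (T : Type) (act : int * bool -> T -> T) (f : T -> R) (x : T) : R :=
  \sum_(b <- bs) (p * (f (act (b, true) x) - f x)
                + q * (f (act (b, false) x) - f x)).

(** An explicit Euler step of the generator. Under [h * size bs <= 1] it is a transition kernel in
    which at most one clock rings. *)
Definition stp (T : Type) (act : int * bool -> T -> T) (f : T -> R) (x : T) : R :=
  f x + h * gen act f x.

(** Expectations are iterates of the transition operator on functions of the state, so that chains
    of height profiles and words need neither a path space nor measurability. *)
Definition Ex (T : Type) (act : int * bool -> T -> T) (j : nat) (f : T -> R) : T -> R :=
  iter j (stp act) f.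

Lemma Ex_add (T : Type) (act : int * bool -> T -> T) i j f :
  Ex act (i + j) f = Ex act i (Ex act j f).
Proof. by rewrite /Ex iterD. Qed.

Lemma ExSr (T : Type) (act : int * bool -> T -> T) j f :
  Ex act j.+1 f = Ex act j (stp act f).
Proof. by rewrite /Ex iterSr. Qed.

Lemma ExS (T : Type) (act : int * bool -> T -> T) j f :
  Ex act j.+1 f = stp act (Ex act j f).
Proof. by []. Qed.

Lemma stp_lin (T : Type) (act : int * bool -> T -> T) a b f g :
  stp act (fun x => a * f x + b * g x) = (fun x => a * stp act f x + b * stp act g x).
Proof.
apply/funext => x; rewrite /stp /gen !mulrDr !addrA.
have -> : \sum_(b0 <- bs)
   (p * (a * f (act (b0, true) x) + b * g (act (b0, true) x) - (a * f x + b * g x)) +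
    q * (a * f (act (b0, false) x) + b * g (act (b0, false) x) - (a * f x + b * g x)))
  = a * \sum_(b0 <- bs) (p * (f (act (b0, true) x) - f x) + q * (f (act (b0, false) x) - f x))
  + b * \sum_(b0 <- bs) (p * (g (act (b0, true) x) - g x) + q * (g (act (b0, false) x) - g x)).
  rewrite !big_distrr -big_split /=; apply: eq_bigr => i _; ring.
ring.
Qed.

Lemma Ex_lin (T : Type) (act : int * bool -> T -> T) j a b f g :
  Ex act j (fun x => a * f x + b * g x) = (fun x => a * Ex act j f x + b * Ex act j g x).
Proof. by elim: j => // j IH; rewrite !ExS IH stp_lin. Qed.

Lemma Ex_cst (T : Type) (act : int * bool -> T -> T) j c :
  Ex act j (fun _ => c) = (fun _ => c).
Proof.
elim: j => // j IH; rewrite ExS IH; apply/funext => x.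
rewrite /stp /gen big1 ?mulr0 ?addr0// => i _; ring.
Qed.

Lemma Ex_scale (T : Type) (act : int * bool -> T -> T) j a f :
  Ex act j (fun x => a * f x) = (fun x => a * Ex act j f x).
Proof.
have -> : (fun x => a * f x) = (fun x => a * f x + 0 * f x).
  by apply/funext => x; ring.
rewrite Ex_lin; apply/funext => x; ring.
Qed.

Lemma Ex_addf (T : Type) (act : int * bool -> T -> T) j f g :
  Ex act j (fun x => f x + g x) = (fun x => Ex act j f x + Ex act j g x).
Proof.
have -> : (fun x => f x + g x) = (fun x => 1 * f x + 1 * g x).
  by apply/funext => x; ring.
rewrite Ex_lin; apply/funext => x; ring.
Qed.

Lemma Ex_sum (T : Type) (act : int * bool -> T -> T) j (I : Type) (r : seq I) (F : I -> T -> R) :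
  Ex act j (fun x => \sum_(i <- r) F i x) = (fun x => \sum_(i <- r) Ex act j (F i) x).
Proof.
elim: r => [|i r IH].
  rewrite (_ : (fun x => _) = (fun=> 0)); last by apply/funext => x; rewrite big_nil.
  by rewrite Ex_cst; apply/funext => x; rewrite big_nil.
rewrite (_ : (fun x => _) = (fun x => F i x + \sum_(i0 <- r) F i0 x)); last first.
  by apply/funext => x; rewrite big_cons.
by rewrite Ex_addf IH; apply/funext => x; rewrite big_cons.
Qed.

Hypotheses (p0 : 0 <= p) (q0 : 0 <= q) (pq : p + q = 1) (h0 : 0 <= h)
  (hL : h * (size bs)%:R <= 1).

(** For [p + q = 1] a step is an average of values of [f]; all monotonicity comes from this form. *)
Lemma stpE (T : Type) (act : int * bool -> T -> T) f x :
  stp act f x = (1 - h * (size bs)%:R) * f x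
     + h * \sum_(b <- bs) (p * f (act (b, true) x) + q * f (act (b, false) x)).
Proof.
rewrite /stp /gen.
rewrite (eq_bigr (fun b => (p * f (act (b, true) x) + q * f (act (b, false) x)) - f x)); last first.
  by move=> b _; rewrite -[X in _ = _ - X]mul1r -pq; ring.
rewrite big_split /= sumrN.
have -> : \sum_(b <- bs) f x = (size bs)%:R * f x.
  by rewrite big_const_seq count_predT iter_addr_0 mulr_natl.
ring.
Qed.

(** Monotonicity and coupling in one statement: two chains driven by the same
    clocks, with a relation preserved by simultaneous moves. *)
Lemma Ex_couple (T T' : Type) (act : int * bool -> T -> T) (act' : int * bool -> T' -> T')
    (rel : T -> T' -> Prop) :
  (forall c x x', c.1 \in bs -> rel x x' -> rel (act c x) (act' c x')) ->
  forall j f f', (forall x x', rel x x' -> f x <= f' x') ->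
  forall x x', rel x x' -> Ex act j f x <= Ex act' j f' x'.
Proof.
move=> relP; elim=> [|j IH] f f' ff' x x' xx'; first exact: ff'.
rewrite !ExS !stpE; apply: lerD.
  by apply: ler_wpM2l; [rewrite subr_ge0 | exact: IH].
apply: ler_wpM2l => //; rewrite !big_seq; apply: ler_sum => b bbs.
by apply: lerD; apply: ler_wpM2l => //; apply: IH => //; apply: relP.
Qed.

Lemma Ex_le_in (T : Type) (act : int * bool -> T -> T) (inv : T -> Prop) :
  (forall c x, c.1 \in bs -> inv x -> inv (act c x)) ->
  forall j f g, (forall x, inv x -> f x <= g x) ->
  forall x, inv x -> Ex act j f x <= Ex act j g x.
Proof.
move=> invP j f g fg x ix.
apply: (@Ex_couple _ _ act act (fun x y => x = y /\ inv x)) => //.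
- by move=> c y y' cb [<- iy]; split => //; exact: invP.
- by move=> y y' [<- iy]; exact: fg.
Qed.

Lemma Ex_eq_in (T : Type) (act : int * bool -> T -> T) (inv : T -> Prop) :
  (forall c x, c.1 \in bs -> inv x -> inv (act c x)) ->
  forall j f g, (forall x, inv x -> f x = g x) ->
  forall x, inv x -> Ex act j f x = Ex act j g x.
Proof.
move=> invP j f g fg x ix; apply/le_anti/andP; split;
  by apply: (Ex_le_in invP) => // y iy; rewrite fg.
Qed.

Lemma Ex_le (T : Type) (act : int * bool -> T -> T) j f g :
  (forall x, f x <= g x) -> forall x, Ex act j f x <= Ex act j g x.
Proof. by move=> fg x; apply: (@Ex_le_in _ act (fun=> True)). Qed.

Lemma Ex_ge0 (T : Type) (act : int * bool -> T -> T) j f :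
  (forall x, 0 <= f x) -> forall x, 0 <= Ex act j f x.
Proof.
by move=> f0 x; rewrite -[X in X <= _](congr1 (@^~ x) (Ex_cst act j 0)); exact: Ex_le.
Qed.

(** Lumping of states: each of the two inequalities is [Ex_couple] along the graph of [pr]. *)
Lemma Ex_proj (T T' : Type) (act : int * bool -> T -> T) (act' : int * bool -> T' -> T')
    (inv : T -> Prop) (pr : T -> T') :
  (forall c x, c.1 \in bs -> inv x -> inv (act c x)) ->
  (forall c x, c.1 \in bs -> inv x -> pr (act c x) = act' c (pr x)) ->
  forall j f x, inv x -> Ex act j (fun x => f (pr x)) x = Ex act' j f (pr x).
Proof.
move=> invP prP j f x ix; apply/le_anti/andP; split.
- apply: (@Ex_couple _ _ act act' (fun x y => inv x /\ y = pr x)) => //.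
  + by move=> c y y' cb [iy ->]; split; [exact: invP|rewrite prP].
  + by move=> y y' [_ ->].
- apply: (@Ex_couple _ _ act' act (fun y x => inv x /\ y = pr x)) => //.
  + by move=> c y y' cb [iy ->]; split; [exact: invP|rewrite prP].
  + by move=> y y' [_ ->].
Qed.

Lemma Ex_growth (T : Type) (act : int * bool -> T -> T) (inv : T -> Prop) f a j x :
  (forall c x, c.1 \in bs -> inv x -> inv (act c x)) ->
  0 <= a -> (forall x, inv x -> stp act f x <= a * f x) ->
  inv x -> Ex act j f x <= a ^+ j * f x.
Proof.
move=> invP a0 fa; elim: j x => [|j IH] x ix; first by rewrite mul1r.
rewrite ExSr; apply: (@le_trans _ _ (Ex act j (fun x => a * f x) x)).
  exact: (Ex_le_in invP).
by rewrite Ex_scale exprS -mulrA ler_wpM2l// IH.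
Qed.

(** A step sums over the bonds, so renaming them changes nothing. This yields the invariance under
    translations and reflections of the box. *)
Lemma Ex_reindex (T : Type) (act : int * bool -> T -> T) (s : int -> int) :
  perm_eq [seq s b | b <- bs] bs ->
  forall j f, Ex (fun c => act (s c.1, c.2)) j f = Ex act j f.
Proof.
move=> sp; elim=> // j IH f; rewrite !ExS IH; apply/funext => x.
by rewrite /stp /gen; congr (_ + _ * _); rewrite -[RHS](perm_big _ sp) big_map.
Qed.

End Chain.

(** * Height functions *)

(** [H z] counts the particles strictly to the right of [z]; a sorting (resp.
    antisorting) attempt at the bond {b, b+1} only affects [H b]. *)
Definition hmove (c : int * bool) (H : int -> int) : int -> int :=
  fun z => if z == c.1 then
             if c.2 then Num.min (H (c.1 - 1)) (H (c.1 + 1) + 1)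
             else Num.max (H (c.1 + 1)) (H (c.1 - 1) - 1)
           else H z.

(** Exclusion: a site [z] is occupied exactly when [H] drops by one between [z - 1] and [z]. *)
Definition adm (H : int -> int) := forall z, H z <= H (z - 1) <= H z + 1.

(** Height of the configuration whose occupied sites are exactly those up to [y]. *)
Definition stepf (y z : int) : int := Num.max (y - z) 0.

Definition box (B : nat) : seq int := [seq i%:Z - B%:Z | i <- iota 0 (B + B)].

Definition boxed (B : nat) (y : int) (H : int -> int) :=
  adm H /\ forall z, z < - B%:Z \/ B%:Z <= z -> H z = stepf y z.

Lemma size_box B : size (box B) = (B + B)%N.
Proof. by rewrite size_map size_iota. Qed.

Lemma mem_box B b : (b \in box B) = (- B%:Z <= b < B%:Z).
Proof.
apply/mapP/idP => [[i]|bB]; first by rewrite mem_iota => iB ->; lia.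
by exists (absz (b + B%:Z)); [rewrite mem_iota; lia | lia].
Qed.

Lemma uniq_box B : uniq (box B).
Proof. by rewrite map_inj_uniq ?iota_uniq// => i j; lia. Qed.

Lemma sum_box_tele (R : zmodType) B (F : int -> R) :
  \sum_(b <- box B) (F (b - 1) - F b) = F (- B%:Z - 1) - F (B%:Z - 1).
Proof.
rewrite big_map.
have E n : \sum_(i <- iota 0 n) (F (i%:Z - B%:Z - 1) - F (i%:Z - B%:Z))
   = F (- B%:Z - 1) - F (n%:Z - B%:Z - 1).
  elim: n => [|n IH]; first by rewrite big_nil sub0r subrr.
  rewrite -addn1 iotaD big_cat /= big_seq1 IH add0n addrA subrK.
  by congr (F _ - F _); lia.
by rewrite E; congr (_ - F _); lia.
Qed.

Lemma adm_stepf y : adm (stepf y).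
Proof. by move=> z; rewrite /stepf; lia. Qed.

Lemma boxed_stepf B y : boxed B y (stepf y).
Proof. by split => //; exact: adm_stepf. Qed.

Lemma hmove_adm c H : adm H -> adm (hmove c H).
Proof.
case: c => b d aH z; rewrite /hmove /=.
have := aH (b + 1); rewrite addrK => h1; have h2 := aH b.
have h3 := aH (b - 1); have := aH (b + 1 + 1); rewrite addrK => h4.
case: (eqVneq z b) => [->|zb].
  have -> : (b - 1 == b) = false by lia.
  case: d; lia.
case: (eqVneq (z - 1) b) => [zb'|zb']; last exact: aH.
have -> : z = b + 1 by lia.
case: d; lia.
Qed.

Lemma hmove_boxed B y c H : c.1 \in box B -> boxed B y H -> boxed B y (hmove c H).
Proof.
case: c => b d /=; rewrite mem_box => bB [aH HB]; split; first exact: hmove_adm.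
by move=> z zB; rewrite /hmove /=; case: eqP => [zc|_]; [lia | exact: HB].
Qed.

Lemma adm_le H : adm H -> forall z z', z <= z' -> H z' <= H z.
Proof.
move=> aH z z' zz'; have -> : z' = z + (absz (z' - z))%:Z by lia.
elim: (absz (z' - z)) => [|n IH]; first by rewrite addr0.
by apply: le_trans IH; have := aH (z + n.+1%:Z); 
  rewrite (_ : z + n.+1%:Z - 1 = z + n%:Z); lia.
Qed.

Lemma adm_lip H : adm H -> forall z z', z <= z' -> H z <= H z' + (z' - z).
Proof.
move=> aH z z' zz'; have -> : z' = z + (absz (z' - z))%:Z by lia.
elim: (absz (z' - z)) => [|n IH]; first by rewrite addr0; lia.
by have := aH (z + n.+1%:Z); rewrite (_ : z + n.+1%:Z - 1 = z + n%:Z); lia.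
Qed.

Lemma boxed_ge0 B y H : y <= B%:Z -> boxed B y H -> forall z, 0 <= H z.
Proof.
move=> yB [aH HB] z; have [zB|zB] := lerP z B%:Z.
  by apply: le_trans (adm_le aH zB); rewrite HB; [rewrite /stepf; lia | right].
by rewrite HB; [rewrite /stepf; lia | right; lia].
Qed.

(** * The generator on exponential functionals of the height *)

Section Expo.
Context {R : realType}.
Variables (B : nat) (p q h : R).

(** When [A] is a sequence of partial sums of weights [al i], this is a weighted sum of particle
    positions, measured from the left end of the box: the particle number [i + 1] from the right has
    weight [al i]. *)
Definition LA (A : nat -> R) (H : int -> int) : R := \sum_(b <- box B) A (absz (H b)).

Lemma LA_hmove A c H : c.1 \in box B ->
  LA A (hmove c H) = LA A H + (A (absz (hmove c H c.1)) - A (absz (H c.1))).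
Proof.
move=> cB; rewrite /LA (bigD1_seq c.1) ?uniq_box//= [in RHS](bigD1_seq c.1) ?uniq_box//=.
rewrite (eq_bigr (fun b => A (absz (H b)))); last by move=> b bc; rewrite {1}/hmove (negbTE bc).
ring.
Qed.

Variable al : nat -> R.
Let A k := \sum_(i < k) al i.
Let Ep k := \sum_(i < k) (expR (al i) - 1).
Let Em k := \sum_(i < k) (1 - expR (- al i)).
Variable J : nat -> R.
Hypothesis (p0 : 0 <= p) (q0 : 0 <= q).
Hypothesis J0 : forall k, J k <= J k.+1.
Hypothesis JP : forall k, q * (1 - expR (- al k)) - p * (expR (al k.+1) - 1) <= J k.+1 - J k.

Let f H := expR (LA A H).

(** Jumps are replaced by unconstrained ones, for which the terms in [Ep] and [Em] telescope in [b].
    The replacement is exact unless both sites are occupied; then it adds a right jump and a left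
    jump that do not happen, and the potential [J] compensates when the left one weighs more. *)
Lemma gen_expo_bond H b : adm H -> (forall z, 0 <= H z) -> b \in box B ->
  p * (f (hmove (b, true) H) - f H) + q * (f (hmove (b, false) H) - f H) <=
  f H * (p * (Ep (absz (H (b - 1))) - Ep (absz (H b)))
        - q * (Em (absz (H b)) - Em (absz (H (b + 1))))
        + (J (absz (H b)) - J (absz (H (b + 1))))).
Proof.
move=> aH H0 bB; rewrite /f !LA_hmove //= !(expRD (LA A H)).
have f0 : 0 <= expR (LA A H) by exact: expR_ge0.
set F := expR (LA A H) in f0 *.
rewrite /hmove /= eqxx.
have := aH (b + 1); rewrite addrK => h1; have h2 := aH b.
have [k Hk] : exists k : nat, H (b + 1) = k%:Z by exists (absz (H (b + 1))); have := H0 (b + 1); lia.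
have AS j : A j.+1 = A j + al j by rewrite /A big_ord_recr.
have EpS j : Ep j.+1 = Ep j + (expR (al j) - 1) by rewrite /Ep big_ord_recr.
have EmS j : Em j.+1 = Em j + (1 - expR (- al j)) by rewrite /Em big_ord_recr.
have [h3|h3] : H b = k%:Z \/ H b = k.+1%:Z by lia.
  have [h4|h4] : H (b - 1) = k%:Z \/ H (b - 1) = k.+1%:Z by lia.
    rewrite Hk h3 h4.
    have -> : Num.min k%:Z (k%:Z + 1) = k%:Z :> int by lia.
    have -> : Num.max k%:Z (k%:Z - 1) = k%:Z :> int by lia.
    rewrite !absz_nat !subrr expR0.
    by rewrite le_eqVlt; apply/orP; left; apply/eqP; ring.
  rewrite Hk h3 h4.
  have -> : Num.min k.+1%:Z (k%:Z + 1) = k.+1%:Z :> int by lia.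
  have -> : Num.max k%:Z (k.+1%:Z - 1) = k%:Z :> int by lia.
  rewrite !absz_nat AS EpS (_ : A k + al k - A k = al k); last by ring.
  rewrite !subrr expR0.
  by rewrite le_eqVlt; apply/orP; left; apply/eqP; ring.
have [h4|h4] : H (b - 1) = k.+1%:Z \/ H (b - 1) = k.+2%:Z by lia.
  rewrite Hk h3 h4.
  have -> : Num.min k.+1%:Z (k%:Z + 1) = k.+1%:Z :> int by lia.
  have -> : Num.max k%:Z (k.+1%:Z - 1) = k%:Z :> int by lia.
  rewrite !absz_nat AS EmS (_ : A k - (A k + al k) = - al k); last by ring.
  rewrite !subrr expR0.
  rewrite -subr_ge0 [leRHS](_ : _ = F * (J k.+1 - J k)); last by ring.
  by rewrite mulr_ge0// subr_ge0.
rewrite Hk h3 h4.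
have -> : Num.min k.+2%:Z (k%:Z + 1) = k.+1%:Z :> int by lia.
have -> : Num.max k%:Z (k.+2%:Z - 1) = k.+1%:Z :> int by lia.
rewrite !absz_nat EmS EpS !subrr expR0.
rewrite -subr_ge0 [leRHS](_ : _ = F * ((J k.+1 - J k)
   - (q * (1 - expR (- al k)) - p * (expR (al k.+1) - 1)))); last by ring.
by rewrite mulr_ge0// subr_ge0.
Qed.

Lemma gen_expo H : adm H -> (forall z, 0 <= H z) ->
  gen p q (box B) hmove f H <=
  f H * (p * (Ep (absz (H (- B%:Z - 1))) - Ep (absz (H (B%:Z - 1))))
        - q * (Em (absz (H (- B%:Z))) - Em (absz (H B%:Z)))
        + (J (absz (H (- B%:Z))) - J (absz (H B%:Z)))).
Proof.
move=> aH H0.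
apply: (@le_trans _ _ (\sum_(b <- box B) f H * (p * (Ep (absz (H (b - 1))) - Ep (absz (H b)))
        - q * (Em (absz (H b)) - Em (absz (H (b + 1))))
        + (J (absz (H b)) - J (absz (H (b + 1))))))).
  by rewrite /gen !big_seq; apply: ler_sum => b bB; exact: gen_expo_bond.
rewrite -big_distrr /= ler_wpM2l ?expR_ge0// !big_split /= sumrN -!big_distrr /=.
rewrite (sum_box_tele B (fun z => Ep (absz (H z)))).
have tele (F : nat -> R) : \sum_(b <- box B) (F (absz (H b)) - F (absz (H (b + 1)))) =
    F (absz (H (- B%:Z))) - F (absz (H B%:Z)).
  have := sum_box_tele B (fun z => F (absz (H (z + 1)))).
  by rewrite !subrK => <-; apply: eq_bigr => b _; rewrite subrK.
by rewrite tele -big_split /= tele.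
Qed.

End Expo.

(** * Exponential moments of the heights *)

Lemma expR_le_quad (R : realType) (x : R) : 0 <= x <= 2^-1 -> expR x <= 1 + x + 2 * x ^+ 2.
Proof.
move=> /andP[x0 x1]; have h := expR_ge1Dx (- x).
rewrite -[x in expR x]opprK expRN.
have h1 : 0 < 1 - x by lra.
apply: (@le_trans _ _ (1 - x)^-1); first by rewrite lef_pV2 ?posrE ?expR_gt0.
rewrite -[leLHS]mul1r ler_pdivrMr//; nra.
Qed.

Lemma expRN_le_quad (R : realType) (x : R) : 0 <= x -> x - x ^+ 2 <= 1 - expR (- x).
Proof.
move=> x0; have h := expR_ge1Dx x.
have h1 : 0 < 1 + x by lra.
suff : expR (- x) <= (1 + x)^-1.
  move=> h2; apply: (@le_trans _ _ (1 - (1 + x)^-1)); last lra.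
  have -> : 1 - (1 + x)^-1 = x / (1 + x) by field; lra.
  rewrite ler_pdivlMr//; nra.
by rewrite expRN lef_pV2 ?posrE ?expR_gt0.
Qed.

(** For [n > 0], [- B + xi B n H] is the position of the [n]-th particle from the right, clipped to
    the box. *)
Definition xi (B n : nat) (H : int -> int) : nat := count (fun b => n%:Z <= H b) (box B).

Lemma count_box_lt B (y : int) : - B%:Z <= y -> y <= B%:Z ->
  (count (fun b => b < y)%R (box B))%:Z = y + B%:Z.
Proof.
move=> y1 y2; rewrite /box count_map.
have E n k : (count (fun i => (i < k)%N) (iota 0 n)) = minn n k.
  elim: n => [|n IH]; first by rewrite min0n.
  by rewrite -addn1 iotaD count_cat IH /= addn0 add0n; lia.
rewrite (@eq_count _ _ (fun i => (leq i.+1 (absz (y + B%:Z))))); last by move=> i /=; lia.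
rewrite E; lia.
Qed.

Section ExpoBound.
Context {R : realType}.
Variables (B : nat) (p q h : R).
Hypotheses (p0 : 0 <= p) (q0 : 0 <= q) (pq : p + q = 1) (h0 : 0 <= h)
  (hL : h * (B + B)%:R <= 1).
Variables (n : nat) (a s : R).
Hypotheses (n0 : (0 < n)%N) (a0 : 0 <= a <= 2^-1) (s0 : 0 <= s <= 1) (ps : q <= p * s).

(** Geometric weights on the [n] rightmost particles: [q <= p * s] gives [q * al k <= p * al k.+1],
    so blocked pairs have the right sign. The cut at [n] destroys this at one index only, which is
    repaired by the jump [dl] of [J]. *)
Let al k : R := if (k < n)%N then a * s ^+ k else 0.
Let lam : R := \sum_(i < n) al i.
Let A k := \sum_(i < k) al i.
Let Ep k := \sum_(i < k) (expR (al i) - 1).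
Let Em k := \sum_(i < k) (1 - expR (- al i)).
Let dl : R := q * (1 - expR (- al n.-1)).
Let J k : R := if (n <= k)%N then dl else 0.

Lemma lamE : lam = a * \sum_(i < n) s ^+ i.
Proof.
by rewrite /lam big_distrr; apply: eq_bigr => i _; rewrite /al ltn_ord.
Qed.

Let al_ge0 k : 0 <= al k.
Proof.
rewrite /al; case: ifP => // _; apply: mulr_ge0; first by case/andP: a0.
by apply: exprn_ge0; case/andP: s0.
Qed.

Let al_le k : al k <= a.
Proof.
rewrite /al; case: ifP => _; last by case/andP: a0.
rewrite ler_piMr//; first by case/andP: a0.
by apply: exprn_ile1; case/andP: s0.
Qed.

Let dl_ge0 : 0 <= dl.
Proof.
by rewrite /dl mulr_ge0// subr_ge0 -[leRHS]expR0 ler_expR oppr_le0.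
Qed.

Let stab (F : nat -> R) k : (forall i, (n <= i)%N -> F i = 0) ->
  (n <= k)%N -> \sum_(i < k) F i = \sum_(i < n) F i.
Proof.
move=> F0 nk; rewrite -(subnKC nk); elim: (k - n)%N => [|m IH]; first by rewrite addn0.
by rewrite addnS big_ord_recr /= IH F0 ?addr0// leq_addr.
Qed.

Let monF (F : nat -> R) k : (forall i, (n <= i)%N -> F i = 0) -> (forall i, 0 <= F i) ->
  \sum_(i < k) F i <= \sum_(i < n) F i.
Proof.
move=> F0 Fp; have [nk|kn] := leqP n k; first by rewrite stab.
rewrite -(subnKC (ltnW kn)); elim: (n - k)%N => [|m IH]; first by rewrite addn0.
by rewrite addnS big_ord_recr /= (le_trans IH)// lerDl.
Qed.

Let c : R := p * Ep n - q * Em n + dl.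

Let JP k : q * (1 - expR (- al k)) - p * (expR (al k.+1) - 1) <= J k.+1 - J k.
Proof.
have e0 x : 0 <= x -> 0 <= expR x - 1 :> R by move=> x0; rewrite subr_ge0 -[leLHS]expR0 ler_expR.
rewrite /J; have [kn|kn|kn] := ltngtP k.+1 n.
- rewrite leqNgt ltnW//= subr0.
  have E : al k.+1 = s * al k by rewrite /al kn ltnW// exprS; ring.
  have h1 : 1 - expR (- al k) <= al k by rewrite lerBlDr addrC -lerBlDr expR_ge1Dx.
  have h2 : al k.+1 <= expR (al k.+1) - 1 by rewrite lerBrDl expR_ge1Dx.
  have := al_ge0 k => h3.
  apply: (@le_trans _ _ (q * al k - p * al k.+1)); first by rewrite lerB// ler_wpM2l.
  by rewrite E mulrA -mulrBl mulr_le0_ge0// subr_le0.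
- rewrite -ltnS kn subrr {1}/al ltnNge -ltnS kn /= oppr0 expR0 subrr mulr0 sub0r.
  by rewrite oppr_le0 mulr_ge0// e0.
- rewrite leqNgt -kn ltnSn subr0 /dl -kn /= lerBlDr lerDl mulr_ge0//; exact: e0.
Qed.

Lemma gen_expo_le y H : y <= B%:Z -> n%:Z <= y + B%:Z -> boxed B y H ->
  gen p q (box B) hmove (fun H => expR (LA B A H)) H <= c * expR (LA B A H).
Proof.
move=> yB ny bH; have H0 := boxed_ge0 yB bH; have [aH HB] := bH.
have J0 k : J k <= J k.+1.
  rewrite /J; case: (leqP n k) => nk; first by rewrite (leqW nk).
  by case: ifP.
apply: le_trans (@gen_expo _ _ _ _ al J p0 q0 J0 JP H aH H0) _.
rewrite [leRHS]mulrC ler_wpM2l ?expR_ge0//.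
have HBB : H B%:Z = 0 by rewrite HB; [clear -yB; rewrite /stepf; lia | right].
have HmB : (n <= absz (H (- B%:Z)))%N.
  have := aH (- B%:Z); rewrite (HB (- B%:Z - 1)); last by left; clear; lia.
  by have := H0 (- B%:Z); clear -ny; rewrite /stepf; lia.
rewrite HBB absz0 /c; apply: lerD; first apply: lerB.
- apply: ler_wpM2l => //; rewrite -/(Ep _); apply: (@le_trans _ _ (Ep (absz (H (- B%:Z - 1))))).
    rewrite lerBlDr lerDl; apply: sumr_ge0 => i _.
    by rewrite subr_ge0 -[leLHS]expR0 ler_expR.
  apply: (@monF (fun i => expR (al i) - 1)) => i.
    by move=> ni; rewrite /al ltnNge ni expR0 subrr.
  by rewrite subr_ge0 -[leLHS]expR0 ler_expR.
- rewrite big_ord0 subr0 (@stab (fun i => 1 - expR (- al i)))//.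
  by move=> i ni; rewrite /al ltnNge ni oppr0 expR0 subrr.
- by rewrite /J HmB leqNgt n0 subr0.
Qed.

Lemma LA_ge H : (forall z, 0 <= H z) -> lam * (xi B n H)%:R <= LA B A H.
Proof.
move=> H0; rewrite /xi /LA -sum1_count natr_sum big_distrr /= big_mkcond /=.
apply: ler_sum => b _; case: ifP => nb; last by apply: sumr_ge0.
rewrite mulr1 /A (@stab al)//; first by move=> i ni; rewrite /al ltnNge ni.
by have := H0 b; clear -nb; lia.
Qed.

Lemma LA_stepf y : - B%:Z <= y -> y <= B%:Z -> LA B A (stepf y) <= lam * (y + B%:Z)%:~R.
Proof.
move=> y1 y2; rewrite -(count_box_lt y1 y2) -sum1_count /LA.
rewrite -pmulrn natr_sum big_distrr /= [leRHS]big_mkcond /=.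
apply: ler_sum => b _; case: ifP => yb.
  by rewrite mulr1; apply: monF => // i ni; rewrite /al ltnNge ni.
rewrite (_ : stepf y b = 0) /A ?big_ord0//.
by clear -yb; rewrite /stepf; lia.
Qed.

(** Second order expansion: [(p - q) * lam] is the drift of free particles, [2 * a * lam] the
    quadratic error, and [a * s ^+ n.-1] the price of the cut at [n]. *)
Lemma c_le : c <= (p - q) * lam + 2 * a * lam + a * s ^+ n.-1.
Proof.
have q1 : q <= 1 by rewrite -pq lerDr.
rewrite /c; apply: lerD; last first.
  have -> : a * s ^+ n.-1 = al n.-1 by rewrite /al prednK// leqnn.
  have h1 : 1 - expR (- al n.-1) <= al n.-1 by rewrite lerBlDr addrC -lerBlDr expR_ge1Dx.
  apply: le_trans (ler_wpM2l q0 h1) _.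
  by rewrite ler_piMl.
rewrite /Ep /Em /lam !big_distrr /= -sumrN -!big_split /=; apply: ler_sum => i _.
have h1 := @expR_le_quad R (al i); have h2 := expRN_le_quad (al_ge0 i).
have h3 : expR (al i) <= 1 + al i + 2 * al i ^+ 2.
  by apply: h1; rewrite al_ge0 (le_trans (al_le i))//; case/andP: a0.
apply: (@le_trans _ _ (p * (al i + 2 * al i ^+ 2) - q * (al i - al i ^+ 2))).
  by clear -h1 h2 h3 p0 q0; apply: lerB; apply: ler_wpM2l => //; rewrite lerBlDr addrC addrA.
have h4 : al i ^+ 2 <= a * al i by rewrite expr2 ler_wpM2r// al_le.
have h5 : 0 <= al i ^+ 2 by rewrite exprn_ge0.
have -> : p = 1 - q by rewrite -pq addrK.
rewrite -subr_ge0 (_ : _ - _ = 2 * (a * al i - al i ^+ 2) + q * al i ^+ 2); last by ring.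
by rewrite addr_ge0 ?mulr_ge0// subr_ge0.
Qed.

(** The weighted cluster of the [n] rightmost particles drifts at most like a free particle. The
    [n]-th one is the leftmost of the cluster, so its position times the total weight [lam] is below
    the weighted sum. *)
Lemma Ex_expo y j : y <= B%:Z -> n%:Z <= y + B%:Z ->
  Ex p q h (box B) hmove j (fun H => expR (lam * (xi B n H)%:R)) (stepf y) <=
  expR (lam * (y + B%:Z)%:~R + j%:R * h * ((p - q) * lam + 2 * a * lam + a * s ^+ n.-1)).
Proof.
move=> yB ny; have hL' : h * (size (box B))%:R <= 1 by rewrite size_box.
have invP : forall c H, c.1 \in box B -> boxed B y H -> boxed B y (hmove c H).
  by move=> c' H; exact: hmove_boxed.
apply: (@le_trans _ _ (Ex p q h (box B) hmove j (fun H => expR (LA B A H)) (stepf y))).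
  apply: (Ex_le_in p0 q0 pq h0 hL' invP); last exact: boxed_stepf.
  by move=> H bH; rewrite ler_expR LA_ge//; exact: (boxed_ge0 yB bH).
set C := (p - q) * lam + _ + _.
have C0 : 0 <= 1 + h * C.
  have lam0 : 0 <= lam by apply: sumr_ge0.
  rewrite /C addr_ge0// mulr_ge0// !addr_ge0// ?mulr_ge0//.
  - rewrite subr_ge0 (le_trans ps)// ler_piMr//; by case/andP: s0.
  - by case/andP: a0.
  - by case/andP: a0.
  - by apply: exprn_ge0; case/andP: s0.
apply: le_trans (Ex_growth p0 q0 pq h0 hL' j invP C0 _ (boxed_stepf B y)) _.
  move=> H bH; rewrite /stp mulrDl mul1r lerD2l -mulrA ler_wpM2l//.
  apply: le_trans (gen_expo_le yB ny bH) _.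
  by rewrite ler_wpM2r ?expR_ge0// c_le.
rewrite expRD [leRHS]mulrC; apply: ler_pM; rewrite ?exprn_ge0 ?expR_ge0//.
  rewrite -mulrA expRM_natl; apply: lerXn2r; rewrite ?nnegrE ?expR_ge0//.
  exact: expR_ge1Dx.
by rewrite ler_expR LA_stepf//; clear -ny; lia.
Qed.

End ExpoBound.

(** * Lower tail at the edge of the profile *)

Lemma gen_local (R : realType) (p q : R) B (F : int -> R) z H :
  gen p q (box B) hmove (fun H => F (H z)) H =
  if z \in box B then
    p * (F (Num.min (H (z - 1)) (H (z + 1) + 1)) - F (H z))
    + q * (F (Num.max (H (z + 1)) (H (z - 1) - 1)) - F (H z))
  else 0.
Proof.
have E b d : b != z -> hmove (b, d) H z = H z by rewrite /hmove /= eq_sym => /negbTE->.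
case: ifP => zB; last first.
  rewrite /gen big_seq big1// => b bB.
  have bz : b != z by apply: contraFN zB => /eqP <-.
  by rewrite !E// !subrr !mulr0 addr0.
rewrite /gen (bigD1_seq z) ?uniq_box//= big1 ?addr0; last first.
  by move=> b bz; rewrite !E// !subrr !mulr0 addr0.
by rewrite /hmove /= eqxx.
Qed.

Section Gaertner.
Context {R : realType}.
Variables (B : nat) (p q h tau : R).
Hypotheses (p0 : 0 <= p) (q0 : 0 <= q) (pq : p + q = 1) (h0 : 0 <= h) (h1 : h <= 1)
  (hL : h * (B + B)%:R <= 1) (tau0 : 0 <= tau <= 1) (qE : q = tau * p).

Let F (k : int) : R := tau ^+ (absz k).

(** Microscopic Cole-Hopf transform: [tau ^ H z] evolves linearly. *)
Lemma gaertner H z : adm H -> (forall z, 0 <= H z) -> z \in box B ->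
  gen p q (box B) hmove (fun H => F (H z)) H =
  p * F (H (z - 1)) + q * F (H (z + 1)) - F (H z).
Proof.
move=> aH H0 zB; rewrite gen_local zB.
have := aH (z + 1); rewrite addrK => h2; have h3 := aH z.
have [k Hk] : exists k : nat, H (z + 1) = k%:Z.
  by exists (absz (H (z + 1))); have := H0 (z + 1); lia.
rewrite /F; have p1 : p = 1 - q by rewrite -pq addrK.
have [h4|h4] : H z = k%:Z \/ H z = k.+1%:Z by lia.
  have [h5|h5] : H (z - 1) = k%:Z \/ H (z - 1) = k.+1%:Z by lia.
    rewrite Hk h4 h5.
    have -> : Num.min k%:Z (k%:Z + 1) = k%:Z :> int by lia.
    have -> : Num.max k%:Z (k%:Z - 1) = k%:Z :> int by lia.
    rewrite !absz_nat p1; ring.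
  rewrite Hk h4 h5.
  have -> : Num.min k.+1%:Z (k%:Z + 1) = k.+1%:Z :> int by lia.
  have -> : Num.max k%:Z (k.+1%:Z - 1) = k%:Z :> int by lia.
  rewrite !absz_nat exprS p1; ring.
have [h5|h5] : H (z - 1) = k.+1%:Z \/ H (z - 1) = k.+2%:Z by lia.
  rewrite Hk h4 h5.
  have -> : Num.min k.+1%:Z (k%:Z + 1) = k.+1%:Z :> int by lia.
  have -> : Num.max k%:Z (k.+1%:Z - 1) = k%:Z :> int by lia.
  rewrite !absz_nat exprS p1; ring.
rewrite Hk h4 h5.
have -> : Num.min k.+2%:Z (k%:Z + 1) = k.+1%:Z :> int by lia.
have -> : Num.max k%:Z (k.+2%:Z - 1) = k.+1%:Z :> int by lia.
rewrite !absz_nat !exprS; set t := tau ^+ k.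
have -> : p * (tau * (tau * t)) + q * t - tau * t = tau * t * (tau * p + p - 1) + (q - tau * p) * t by ring.
rewrite -qE addrC; have -> : q + p = 1 by rewrite addrC.
by ring.
Qed.

Variables (y : int) (be x2 k0 : R).
Hypotheses (y1 : - B%:Z - 1 <= y) (y2 : y <= B%:Z) (be0 : 0 <= be)
  (mle : p * expR (- be) + q * expR be <= 1)
  (x21 : 1 <= x2) (k00 : 0 <= k0) (k0E : k0 * (x2 - 1) ^+ 2 <= 4).

Let X (z : int) : R := expR (be * (z - y)%:~R).
Let a := 1 + h * (p * expR (- be) + q * expR be - 1).
Let b := 1 + h * (p * expR (- be) ^+ 2 + q * expR be ^+ 2 - 1).
(** [a ^+ j * X z] and [b ^+ j * X z ^+ 2] both solve the linear recursion of the expectation of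
    [tau ^ H z]. Their combination lies below the parabola [k0 * (w - 1) * (x2 - w)] in
    [w = a ^+ j * X z], which is nonpositive for [w <= 1] and at most one by the choice of [k0]. *)
Definition gsub j z := k0 * ((1 + x2) * (a ^+ j * X z) - x2 - b ^+ j * X z ^+ 2).

Let XB z : X (z - 1) = X z * expR (- be).
Proof. by rewrite /X -expRD; congr expR; rewrite !rmorphB /=; ring. Qed.

Let XD z : X (z + 1) = X z * expR be.
Proof. by rewrite /X -expRD; congr expR; rewrite rmorphB rmorphD rmorphB /=; ring. Qed.

Let a_ge0 : 0 <= a.
Proof.
have e1 := expR_ge0 be; have e2 := expR_ge0 (- be).
rewrite /a; have -> : 1 + h * (p * expR (- be) + q * expR be - 1) =
  (1 - h) + h * (p * expR (- be) + q * expR be) by ring.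
by rewrite addr_ge0 ?subr_ge0// mulr_ge0// addr_ge0// mulr_ge0.
Qed.

(** Jensen for one step of a lazy random walk, whose exponential moments are [a] and [b], made
    explicit as a sum of squares. *)
Let ab : a ^+ 2 <= b.
Proof.
rewrite -subr_ge0 /a /b; set x := expR (- be); set z := expR be.
have -> : 1 + h * (p * x ^+ 2 + q * z ^+ 2 - 1) - (1 + h * (p * x + q * z - 1)) ^+ 2
  = h * (p * (x - 1) ^+ 2 + q * (z - 1) ^+ 2) - h ^+ 2 * (p * (x - 1) + q * (z - 1)) ^+ 2.
  by have -> : p = 1 - q; [rewrite -pq addrK | ring].
have -> : h * (p * (x - 1) ^+ 2 + q * (z - 1) ^+ 2) - h ^+ 2 * (p * (x - 1) + q * (z - 1)) ^+ 2
  = h * (1 - h) * (p * (x - 1) + q * (z - 1)) ^+ 2 + h * (p * q) * (x - z) ^+ 2.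
  by have -> : p = 1 - q; [rewrite -pq addrK | ring].
have h1' : 0 <= 1 - h by rewrite subr_ge0.
by apply: addr_ge0; (apply: mulr_ge0; last exact: sqr_ge0); rewrite !mulr_ge0.
Qed.

Let gsub_le1 j z : gsub j z <= 1.
Proof.
have h2 : (a ^+ j * X z) ^+ 2 <= b ^+ j * X z ^+ 2.
  rewrite exprMn ler_wpM2r ?sqr_ge0// exprAC; apply: lerXn2r => //; rewrite nnegrE.
    exact: exprn_ge0.
  by apply: le_trans ab; exact: exprn_ge0.
rewrite /gsub; set w := a ^+ j * X z in h2 *; set w2 := b ^+ j * _ in h2 *.
apply: (@le_trans _ _ (k0 * ((1 + x2) * w - x2 - w ^+ 2))).
  by rewrite ler_wpM2l// lerB.
have -> : k0 * ((1 + x2) * w - x2 - w ^+ 2) = k0 * (x2 - 1) ^+ 2 / 4 - k0 * (w - (1 + x2) / 2) ^+ 2.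
  by field.
apply: (@le_trans _ _ (k0 * (x2 - 1) ^+ 2 / 4)); last by rewrite ler_pdivrMr// mul1r.
by rewrite gerBl; apply: mulr_ge0 => //; exact: sqr_ge0.
Qed.

Let gsub_le0 j z : z <= y -> gsub j z <= 0.
Proof.
move=> zy; have Xz : 0 <= X z <= 1.
  rewrite expR_ge0 -[leRHS]expR0 ler_expR mulr_ge0_le0//.
  by rewrite -[leRHS]/(0%:~R) ler_int; clear -zy; lia.
have aj1 : 0 <= a ^+ j <= 1.
  rewrite exprn_ge0// exprn_ile1// /a gerDl mulr_ge0_le0// subr_le0//.
have h2 : (a ^+ j * X z) ^+ 2 <= b ^+ j * X z ^+ 2.
  rewrite exprMn ler_wpM2r ?sqr_ge0// exprAC; apply: lerXn2r => //; rewrite nnegrE.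
    exact: exprn_ge0.
  by apply: le_trans ab; exact: exprn_ge0.
have h3 : 0 <= a ^+ j * X z <= 1.
  case/andP: Xz => *; case/andP: aj1 => *.
  by rewrite mulr_ge0// mulr_ile1.
rewrite /gsub; set w := a ^+ j * X z in h2 h3 *; set w2 := b ^+ j * _ in h2 *.
apply: (@le_trans _ _ (k0 * ((1 + x2) * w - x2 - w ^+ 2))).
  by rewrite ler_wpM2l// lerB.
rewrite mulr_ge0_le0//; have -> : (1 + x2) * w - x2 - w ^+ 2 = (w - 1) * (x2 - w) by ring.
by case/andP: h3 => w0 w1; rewrite mulr_le0_ge0// ?subr_le0// subr_ge0 (le_trans w1).
Qed.

Lemma gsub_rec j z : gsub j.+1 z =
  (1 - h) * gsub j z + h * (p * gsub j (z - 1) + q * gsub j (z + 1)).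
Proof.
rewrite /gsub XB XD !exprS.
set aj := a ^+ j; set bj := b ^+ j; rewrite /a /b.
have -> : p = 1 - q by rewrite -pq addrK.
ring.
Qed.

(** Comparison principle: both sides follow the same linear recursion inside the box, and [gsub] is
    below at time zero and at both ends, being nonpositive on the left and at most one on the right,
    where the height vanishes. *)
Lemma phi_ge j z : - B%:Z - 1 <= z -> z <= B%:Z ->
  gsub j z <= Ex p q h (box B) hmove j (fun H => F (H z)) (stepf y).
Proof.
have hL' : h * (size (box B))%:R <= 1 by rewrite size_box.
have invP : forall c H, c.1 \in box B -> boxed B y H -> boxed B y (hmove c H).
  by move=> c' H; exact: hmove_boxed.
have F0 k : 0 <= F k by rewrite exprn_ge0//; case/andP: tau0.
elim: j z => [|j IH] z z1 z2.
  rewrite /Ex /=; have [zy|zy] := lerP z y; first exact: le_trans (gsub_le0 0 zy) (F0 _).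
  by rewrite (_ : stepf y z = 0) ?expr0 //; clear -zy; rewrite /stepf; lia.
have [zB|zB] := boolP (z \in box B); last first.
  have [->|->] : z = - B%:Z - 1 \/ z = B%:Z.
  - by move: zB; rewrite mem_box; clear -z1 z2; lia.
  - apply: le_trans (gsub_le0 j.+1 y1) _.
    by apply: (Ex_ge0 p0 q0 pq h0 hL') => H; exact: F0.
  - apply: le_trans (gsub_le1 _ _) _.
    rewrite -[leLHS](congr1 (@^~ (stepf y)) (@Ex_cst R p q h (box B) _ hmove j.+1 1)).
    apply: (Ex_le_in p0 q0 pq h0 hL' invP); last exact: boxed_stepf.
    move=> H [_ HB]; rewrite HB; last by right.
    by rewrite (_ : stepf y B%:Z = 0)// ; clear -y2; rewrite /stepf; lia.
rewrite ExSr.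
rewrite (@Ex_eq_in R p q h (box B) p0 q0 pq h0 hL' _ hmove (boxed B y) invP j _
   (fun H => (1 - h) * F (H z) + h * (p * F (H (z - 1)) + q * F (H (z + 1))))); last first.
- exact: boxed_stepf.
- move=> H bH; rewrite /stp gaertner//; [ring|by case: bH|exact: boxed_ge0 bH].
rewrite Ex_lin Ex_lin gsub_rec.
have zB' : - B%:Z <= z < B%:Z by rewrite -mem_box.
by rewrite lerD ?ler_wpM2l ?subr_ge0// ?lerD ?ler_wpM2l// IH//; clear -zB'; lia.
Qed.

(** [tau ^ H] is at most the indicator of [H <= n] plus [tau ^+ n.+1]. *)
Lemma prob_ge j z n : - B%:Z - 1 <= z -> z <= B%:Z ->
  gsub j z - tau ^+ n.+1 <=
  Ex p q h (box B) hmove j (fun H => (H z <= n%:Z)%R%:R) (stepf y).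
Proof.
have hL' : h * (size (box B))%:R <= 1 by rewrite size_box.
have invP : forall c H, c.1 \in box B -> boxed B y H -> boxed B y (hmove c H).
  by move=> c' H; exact: hmove_boxed.
move=> z1 z2; rewrite lerBlDr; apply: le_trans (phi_ge j z1 z2) _.
rewrite -[X in _ + X](congr1 (@^~ (stepf y)) (@Ex_cst R p q h (box B) _ hmove j (tau ^+ n.+1))).
have := @Ex_addf R p q h (box B) _ hmove j (fun H => (H z <= n%:Z)%R%:R) (fun=> tau ^+ n.+1).
move=> /(congr1 (@^~ (stepf y))) /= <-.
apply: (Ex_le_in p0 q0 pq h0 hL' invP); last exact: boxed_stepf.
move=> H bH; have H0 := boxed_ge0 y2 bH z.
case/andP: tau0 => t0 t1.
case: (lerP (H z) n%:Z) => Hn /=.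
  by rewrite ler_wpDr ?exprn_ge0// /F exprn_ile1.
by rewrite add0r /F ler_wiXn2l//; clear -Hn H0; lia.
Qed.

End Gaertner.

Lemma small_pow (R : realType) (x e : R) : 0 <= x < 1 -> 0 < e ->
  exists N : nat, forall n, (N <= n)%N -> x ^+ n <= e.
Proof.
move=> /andP[x0 x1] e0.
have : (fun n => x ^+ n) @ \oo --> (0 : R) by apply: cvg_expr; rewrite ger0_norm.
move=> /cvgrPdist_le /(_ e e0) [N _ HN]; exists N => n nN.
have := HN n nN; rewrite /= sub0r normrN ger0_norm// exprn_ge0//.
Qed.

Lemma expR_le_inv (R : realType) (x : R) : x < 1 -> expR x <= (1 - x)^-1.
Proof.
move=> x1; have h := expR_ge1Dx (- x).
have h1 : 0 < 1 - x by lra.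
by rewrite -[x in expR x]opprK expRN lef_pV2 ?posrE ?expR_gt0.
Qed.

Lemma expR_ge_quarter (R : realType) (x : R) : -2 <= x -> 1 + x + x ^+ 2 / 4 <= expR x.
Proof.
move=> x2; have h := expR_ge1Dx (x / 2).
have -> : expR x = expR (x / 2) ^+ 2 by rewrite -expRM_natl; congr expR; field.
have -> : 1 + x + x ^+ 2 / 4 = (1 + x / 2) ^+ 2 by field.
by apply: lerXn2r => //; rewrite nnegrE ?expR_ge0//; lra.
Qed.

Lemma expR_le_1Dx (R : realType) (x : R) : - 2^-1 <= x -> expR (x - 2 * x ^+ 2) <= 1 + x.
Proof.
move=> x2; have x1 : x - 2 * x ^+ 2 < 1 by nra.
apply: le_trans (expR_le_inv x1) _.
have h1 : 0 < 1 - (x - 2 * x ^+ 2) by lra.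
rewrite -[leLHS]mul1r ler_pdivrMr//.
have : 0 <= x ^+ 2 * (1 + 2 * x) by rewrite mulr_ge0 ?sqr_ge0//; lra.
by rewrite !expr2; nra.
Qed.

Lemma xi_le_H B n z H : adm H -> - B%:Z <= z -> z <= B%:Z -> (H z < n%:Z)%R ->
  (xi B n H)%:Z <= z + B%:Z.
Proof.
move=> aH z1 z2 Hz; rewrite -(count_box_lt z1 z2) lez_nat.
apply: sub_count => b /= nb; rewrite ltNge; apply/negP => zb.
by have := adm_le aH zb; lia.
Qed.

(** The largest [k0] with [k0 * (401 - 1) ^ 2 <= 4], for the second root [x2 = 401]. The subsolution
    will reach [kmin / 50]; [pmin] is half of it, the other half pays for [(q / p) ^+ n]. *)
Definition kmin (R : realType) : R := 200^-1 * 200^-1.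
Definition pmin (R : realType) : R := kmin R / 100.

(** Over a time of order [r ^ 2] the subsolution is positive already at a point lying more than
    [r / 640] behind the mean displacement [(p - q) * T]. With probability at least [pmin] fewer
    than [n] particles are to the right of that point, so the [n]-th one is behind it. *)
Lemma lower_tail (R : realType) (p q : R) (q0 : 0 <= q) (qp : q < p) (pq : p + q = 1)
  (B : nat) (h r T : R) (j : nat) (y : int)
  (h0 : 0 <= h) (h16 : h <= 16^-1) (hL : h * (B + B)%:R <= 1)
  (r640 : (8 * 80) <= r) (rv : 10^-1 <= r * (p - q)) (TE : T = j%:R * h)
  (T1 : r ^+ 2 <= T) (T2 : T <= 2 * r ^+ 2)
  (y1 : - B%:Z <= y) (y2 : y <= B%:Z) n : (0 < n)%N -> (q / p) ^+ n <= pmin R ->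
  pmin R <= Ex p q h (box B) hmove j
     (fun H => ((xi B n H)%:R <= (y + B%:Z)%:~R + (p - q) * T - r / (8 * 80))%R%:R) (stepf y).
Proof.
have lt_p0 : 0 < p by exact: le_lt_trans qp.
(* With this slope [T * be ^ 2 <= 1 / 200], so second order expansions are accurate over the whole
   time, and [2 * be <= v] makes [m] nonpositive. *)
pose be := (20 * r)^-1; have beE : be = (20 * r)^-1 by [].
pose v := p - q; have vE : v = p - q by [].
(* [be * w] cancels the lower bound for the logarithm of [a ^+ j] up to [80^-1 * 80^-1], so that
   [a ^+ j * X] passes the root 1 of the parabola by this margin. *)
pose w := v * T - T * be / 8 + (20 * r) / 80 / 80.
have wE : w = v * T - T * be / 8 + (20 * r) / 80 / 80 by [].
pose m := p * expR (- be) + q * expR be - 1.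
have mE : m = p * expR (- be) + q * expR be - 1 by [].
pose a := 1 + h * m; have aE : a = 1 + h * m by [].
pose b := 1 + h * (p * expR (- be) ^+ 2 + q * expR be ^+ 2 - 1).
have bE : b = 1 + h * (p * expR (- be) ^+ 2 + q * expR be ^+ 2 - 1) by [].
rewrite -vE; rewrite -vE in rv; clearbody be v w m a b.
have lt_r_gt0  : 0 < r. by apply: (lt_le_trans _ r640); rewrite mulr_gt0 ?ltr0n.
have lt_be0 : 0 < be. by rewrite beE invr_gt0 mulr_gt0.
have lt_be_ge0 := ltW lt_be0.
have lt_p_ge0 := ltW lt_p0.
have lt_be2_ge0 : 0 <= be ^+ 2 by exact: sqr_ge0.
have lt_ber : be * r = 20^-1. by rewrite beE; field; rewrite gt_eqF.
have lt_be_le  : be <= 20^-1.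
rewrite -lt_ber ler_peMr ?(ltW lt_be0)// (le_trans _ r640)//.
by clear; lra.
have lt_be2r  : be ^+ 2 * r ^+ 2 = 400^-1. by rewrite -exprMn lt_ber; field.
have lt_v_le1  : v <= 1. by rewrite vE -pq lerD2l (le_trans _ q0)// oppr_le0.
have lt_v0  : 0 < v. by rewrite vE subr_gt0.

have lt_ebe : expR be - 1 <= be + 2 * be ^+ 2.
have : 0 <= be <= 2^-1 by rewrite (ltW lt_be0) (le_trans lt_be_le)//= lef_pV2 ?posrE// ler_nat.
by move=> /expR_le_quad; clear; lra.
have lt_enbe  : expR (- be) - 1 <= - be + be ^+ 2. by have := expRN_le_quad (ltW lt_be0); clear; lra.

have lt_be2v  : 2 * be <= v.
have : be * 10^-1 <= be * (r * v) by rewrite ler_wpM2l ?(ltW lt_be0)//.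
rewrite mulrA lt_ber; clear -lt_be0; clear; lra.

have lt_m_le  : m <= - v * be + 2 * be ^+ 2.
have -> : m = p * (expR (- be) - 1) + q * (expR be - 1).
  by rewrite mE -[X in _ - X]pq; ring.
apply: (@le_trans _ _ (p * (- be + be ^+ 2) + q * (be + 2 * be ^+ 2))).
  by apply: lerD; apply: ler_wpM2l => //; exact: ltW.
rewrite -subr_ge0; have -> : - v * be + 2 * be ^+ 2 - (p * (- be + be ^+ 2) + q * (be + 2 * be ^+ 2))
  = be ^+ 2 * (2 - p - 2 * q) by rewrite vE; ring.
rewrite mulr_ge0 ?sqr_ge0//; move: pq lt_p0; clear; lra.

have lt_m_le0  : m <= 0.
apply: le_trans lt_m_le _.
have -> : - v * be + 2 * be ^+ 2 = be * (2 * be - v) by ring.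
by rewrite mulr_ge0_le0 ?(ltW lt_be0)// subr_le0.

have lt_m_ge  : - v * be + be ^+ 2 / 4 <= m.
have -> : m = p * (expR (- be) - 1) + q * (expR be - 1).
  by rewrite mE -[X in _ - X]pq; ring.
have e1 : - be + be ^+ 2 / 4 <= expR (- be) - 1.
  have : -2 <= - be by move: lt_be_le lt_be0; clear; lra.
  by move=> /expR_ge_quarter; rewrite sqrrN; clear; lra.
have e2 : be + be ^+ 2 / 4 <= expR be - 1.
  have : -2 <= be by move: lt_be_le lt_be0; clear; lra.
  by move=> /expR_ge_quarter; clear; lra.
apply: (@le_trans _ _ (p * (- be + be ^+ 2 / 4) + q * (be + be ^+ 2 / 4))).
  have -> : p * (- be + be ^+ 2 / 4) + q * (be + be ^+ 2 / 4) = - v * be + (p + q) * be ^+ 2 / 4.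
    by rewrite vE; ring.
  by rewrite pq mul1r.
by apply: lerD; apply: ler_wpM2l => //; exact: ltW.

have lt_m_ge' : - be <= m.
apply: le_trans lt_m_ge.
have h1 : v * be <= be by rewrite ler_piMl ?(ltW lt_be0).
have := sqr_ge0 be; move: h1; clear; lra.

have lt_m2_le  : m ^+ 2 <= be ^+ 2.
rewrite -[m ^+ 2]sqrrN; apply: lerXn2r; rewrite ?nnegrE ?oppr_ge0 ?(ltW lt_be0)//.
by rewrite lerNl.

have lt_T0  : 0 <= T. by apply: le_trans T1; exact: sqr_ge0.

have lt_Tbe2  : T * be ^+ 2 <= 200^-1.
apply: (@le_trans _ _ (2 * r ^+ 2 * be ^+ 2)).
  by rewrite ler_wpM2r ?sqr_ge0.
by rewrite -mulrA (mulrC (r ^+ 2)) lt_be2r; clear; lra.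

have lt_aj_ge  : expR (- (T * v * be) + T * be ^+ 2 / 8) <= a ^+ j.
have hm : - 2^-1 <= h * m.
  have : h * (- be) <= h * m by rewrite ler_wpM2l.
  have : h * be <= 16^-1 * 20^-1 by rewrite ler_pM ?(ltW lt_be0).
  clear; lra.
apply: (@le_trans _ _ (expR (h * m - 2 * (h * m) ^+ 2) ^+ j)); last first.
  by apply: lerXn2r; rewrite ?nnegrE ?expR_ge0// aE ?expR_le_1Dx//; move: hm; clear; lra.
rewrite -expRM_natl ler_expR.
have -> : j%:R * (h * m - 2 * (h * m) ^+ 2) = T * m - 2 * T * h * m ^+ 2 by rewrite TE; ring.
have e1 : T * (- v * be + be ^+ 2 / 4) <= T * m by rewrite ler_wpM2l.
have e2 : 2 * T * h * m ^+ 2 <= T * be ^+ 2 / 8.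
  have : T * h * m ^+ 2 <= T * 16^-1 * be ^+ 2.
    by apply: ler_pM; [rewrite mulr_ge0|exact: sqr_ge0|rewrite ler_wpM2l|].
  clear; lra.
move: e1 e2; clear; lra.

have lt_a_ge  : 9 / 10 <= a.
have h1 : h * (- be) <= h * m by rewrite ler_wpM2l.
have h2 : h * be <= 16^-1 * 20^-1 by rewrite ler_pM ?(ltW lt_be0).
rewrite aE; move: h1 h2; clear; lra.

have lt_aj_le  : a ^+ j <= expR (- (T * v * be) + 2 * (T * be ^+ 2)).
apply: (@le_trans _ _ (expR (h * m) ^+ j)).
  apply: lerXn2r; rewrite ?nnegrE ?expR_ge0//; last by rewrite aE expR_ge1Dx.
  by apply: le_trans lt_a_ge; clear; lra.
rewrite -expRM_natl ler_expR mulrA -TE.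
have : T * m <= T * (- v * be + 2 * be ^+ 2) by rewrite ler_wpM2l.
clear; lra.

(* The ratio is at most [exp (5 * T * be ^ 2) <= exp (1 / 40)], which is below [40 / 39]. *)
have lt_bj_le  : b ^+ j <= 103 / 100 * (a ^+ j) ^+ 2.
have bb : b <= a ^+ 2 * (1 + 5 * h * be ^+ 2).
  have -> : b = a ^+ 2 + (h * (p * (expR (- be) - 1) ^+ 2 + q * (expR be - 1) ^+ 2) - h ^+ 2 * m ^+ 2).
    rewrite bE aE mE; have -> : p = 1 - q by rewrite -pq addrK.
    by ring.
  rewrite [leRHS]mulrDr mulr1 lerD2l.
  apply: (@le_trans _ _ (h * (4 * be ^+ 2))).
    apply: le_trans (_ : _ <= h * (p * (expR (- be) - 1) ^+ 2 + q * (expR be - 1) ^+ 2)) _.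
      by rewrite gerBl; apply: mulr_ge0; exact: sqr_ge0.
    rewrite ler_wpM2l//.
    have e1 : (expR (- be) - 1) ^+ 2 <= 4 * be ^+ 2.
      rewrite -sqrrN (_ : 4 * be ^+ 2 = (2 * be) ^+ 2); last by ring.
      apply: lerXn2r; rewrite ?nnegrE ?mulr_ge0 ?(ltW lt_be0)//.
        by rewrite opprB subr_ge0 -[leRHS]expR0 ler_expR oppr_le0 ltW.
      by have := expR_ge1Dx (- be); move: lt_be0; clear; lra.
    have e2 : (expR be - 1) ^+ 2 <= 4 * be ^+ 2.
      rewrite (_ : 4 * be ^+ 2 = (2 * be) ^+ 2); last by ring.
      apply: lerXn2r; rewrite ?nnegrE ?mulr_ge0 ?(ltW lt_be0)//.
        by rewrite subr_ge0 -[leLHS]expR0 ler_expR ltW.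
      apply: le_trans lt_ebe _; move: lt_be_le lt_be0; clear; nra.
    apply: (@le_trans _ _ (p * (4 * be ^+ 2) + q * (4 * be ^+ 2))).
      by apply: lerD; apply: ler_wpM2l => //; exact: ltW.
    by rewrite -mulrDl pq mul1r.
  have : (9 / 10) ^+ 2 <= a ^+ 2.
    have h9 : 0 <= 9 / 10 :> R by clear; lra.
    by apply: lerXn2r; rewrite ?nnegrE// (le_trans h9).
  move=> a2; apply: (@le_trans _ _ ((9 / 10) ^+ 2 * (5 * h * be ^+ 2))); last first.
    by rewrite ler_wpM2r// !mulr_ge0.
  have : 0 <= h * be ^+ 2 by rewrite mulr_ge0 ?sqr_ge0.
  clear; lra.
apply: (@le_trans _ _ ((a ^+ 2 * (1 + 5 * h * be ^+ 2)) ^+ j)).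
  apply: lerXn2r => //; rewrite nnegrE.
    have -> : b = (1 - h) + h * (p * expR (- be) ^+ 2 + q * expR be ^+ 2) by rewrite bE; ring.
    rewrite addr_ge0//; first by move: h16; clear; lra.
    by rewrite mulr_ge0 ?addr_ge0 ?mulr_ge0 ?sqr_ge0// ltW.
  by rewrite mulr_ge0 ?sqr_ge0// addr_ge0 ?mulr_ge0 ?sqr_ge0.
rewrite exprMn (exprAC a 2 j) [leLHS]mulrC; apply: ler_wpM2r; first exact: sqr_ge0.
apply: (@le_trans _ _ (expR (5 * h * be ^+ 2) ^+ j)).
  by apply: lerXn2r; rewrite ?nnegrE ?expR_ge0 ?expR_ge1Dx// addr_ge0 ?mulr_ge0 ?sqr_ge0.
rewrite -expRM_natl.
have -> : j%:R * (5 * h * be ^+ 2) = 5 * (T * be ^+ 2) by rewrite TE; ring.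
apply: (@le_trans _ _ (expR 40^-1)); first by rewrite ler_expR; move: lt_Tbe2; clear; lra.
apply: le_trans (expR_le_inv _) _; first by lra.
by rewrite -[leLHS]mul1r ler_pdivrMr; clear; lra.

have gsub_val  (z : int) : w <= (z - y)%:~R -> (z - y)%:~R <= w + 1 ->
  2 * pmin R <= gsub p q h y be 401 (kmin R) j z.
move=> z1 z2; rewrite /gsub -mE -aE -bE.
set X := expR (be * _); set Y := a ^+ j * X.
have bew : be * w = T * v * be - T * be ^+ 2 / 8 + 80^-1 * 80^-1.
  rewrite wE beE; field; by rewrite gt_eqF.
have a0 : 0 <= a ^+ j by rewrite exprn_ge0// (le_trans _ lt_a_ge)//; clear; lra.
have Y1 : 1 + 80^-1 * 80^-1 <= Y.
  apply: le_trans (expR_ge1Dx _) _.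
  apply: (@le_trans _ _ (expR (- (T * v * be) + T * be ^+ 2 / 8) * expR (be * w))).
    by rewrite -expRD bew ler_expR; clear; lra.
  by rewrite ler_pM ?expR_ge0// ler_expR ler_wpM2l// ltW.
have Y2 : Y <= 2.
  apply: (@le_trans _ _ (expR (- (T * v * be) + 2 * (T * be ^+ 2)) * expR (be * (w + 1)))).
    by rewrite ler_pM ?expR_ge0// ler_expR ler_wpM2l// ltW.
  rewrite -expRD mulrDr mulr1 bew.
  apply: (@le_trans _ _ (expR 2^-1)).
    rewrite ler_expR; move: lt_Tbe2 lt_be_le; have : 0 <= T * be ^+ 2 by rewrite mulr_ge0 ?sqr_ge0.
    clear; lra.
  apply: le_trans (expR_le_inv _) _; first by lra.
  by rewrite -[leLHS]mul1r ler_pdivrMr; clear; lra.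
have bX : b ^+ j * X ^+ 2 <= 103 / 100 * Y ^+ 2.
  by rewrite /Y exprMn [leRHS]mulrA ler_wpM2r ?sqr_ge0.
have h3 : 0 <= (Y - (1 + 80^-1 * 80^-1)) * (2 - Y) by rewrite mulr_ge0 ?subr_ge0.
(* The root [x2 = 401] is large because the slope 400 at the root 1, times the margin [1 / 6400],
   must beat the loss of 3 percent in [bX] and leave [1 / 50]. *)
have -> : 2 * pmin R = kmin R * (50^-1) :> R by rewrite /pmin; field.
apply: ler_wpM2l; first by rewrite /kmin mulr_ge0// invr_ge0 ler0n.
have h4 : Y ^+ 2 <= (3 + 80^-1 * 80^-1) * Y - 2 * (1 + 80^-1 * 80^-1).
  by rewrite -subr_ge0 [leRHS](_ : _ = (Y - (1 + 80^-1 * 80^-1)) * (2 - Y))//; ring.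
move: Y1 Y2 bX h4; set YY := Y ^+ 2; set bb := b ^+ j * _.
clearbody Y YY bb; clear; lra.

move=> n0 tn; have hL' : h * (size (box B))%:R <= 1 by rewrite size_box.
have invP : forall c H, c.1 \in box B -> boxed B y H -> boxed B y (hmove c H).
  by move=> c' H; exact: hmove_boxed.
have Tbe : r / 20 <= T * be.
  apply: (@le_trans _ _ (r ^+ 2 * be)); last by rewrite ler_wpM2r// ltW.
  by rewrite expr2 -mulrA (mulrC r be) lt_ber.
(* [T * be / 8 >= r / 160] exceeds the offset [r / 320] by [r / 320]; half of this absorbs the 1,
   since [r >= 640]. *)
have wle : w + 1 <= v * T - r / (8 * 80).
  rewrite wE; move: Tbe r640; clear; lra.
have w0 : 0 <= w.
  have : T * (2 * be) <= T * v by rewrite ler_wpM2l.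
  have : 0 <= T * be by rewrite mulr_ge0// ltW.
  rewrite wE; move: lt_r_gt0; clear; lra.
pose k := Num.ceil w.
have k1 : w <= k%:~R by exact: ceil_ge.
have k2 : k%:~R < w + 1 by have := gt_pred_ceil w; rewrite -/k intrB ltrBlDr.
have k0 : 0 <= k.
  by rewrite -(ler_int R) (le_trans w0).
have [zB|zB] := lerP B%:Z (y + k).
  apply: (@le_trans _ _ 1); first by rewrite /pmin /kmin; clear; lra.
  rewrite -[leLHS](congr1 (@^~ (stepf y)) (@Ex_cst R p q h (box B) _ hmove j 1)).
  apply: Ex_le => //.
  move=> H; have -> // : ((xi B n H)%:R <= (y + B%:Z)%:~R + v * T - r / (8 * 80)).
  apply: (@le_trans _ _ ((y + k + B%:Z)%:~R)).
    rewrite -[leLHS]/(_%:Z%:~R) ler_int; apply: (@le_trans _ _ (B + B)%N%:Z).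
      by rewrite lez_nat -size_box /xi count_size.
    by clear -zB; lia.
  have -> : y + k + B%:Z = (y + B%:Z) + k by rewrite addrAC.
  rewrite intrD -[leRHS]addrA lerD2l.
  by apply: le_trans (ltW k2) _.
have z1 : w <= (y + k - y)%:~R by rewrite addrAC subrr add0r.
have z2 : (y + k - y)%:~R <= w + 1 by rewrite addrAC subrr add0r ltW.
have g := gsub_val _ z1 z2.
have t01 : 0 <= q / p <= 1 by rewrite divr_ge0 ?(ltW lt_p0)//= ler_pdivrMr// mul1r ltW.
have qE : q = q / p * p by rewrite divfK// gt_eqF.
have h1 : h <= 1 by apply: le_trans h16 _; rewrite invf_le1// ler1n.
have mle1 : p * expR (- be) + q * expR be <= 1 by rewrite -subr_le0 -mE.
have y1' : - B%:Z - 1 <= y by clear -y1; lia.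
have zB1 : - B%:Z - 1 <= y + k by clear -y1 k0; lia.
have k00 : 0 <= kmin R by rewrite /kmin mulr_ge0// invr_ge0 ler0n.
have k0E : kmin R * (401 - 1) ^+ 2 <= 4 :> R by rewrite /kmin expr2; clear; lra.
have x21 : 1 <= 401 :> R by rewrite ler1n.
have := prob_ge (ltW lt_p0) q0 pq h0 h1 hL t01 qE y1' y2 (ltW lt_be0) mle1 x21 k00 k0E j n.-1 zB1 (ltW zB).
rewrite prednK// => hh.
apply: (@le_trans _ _ (gsub p q h y be 401 (kmin R) j (y + k) - (q / p) ^+ n)).
  by move: g tn; clear; lra.
apply: le_trans hh _.
apply: (Ex_le_in (ltW lt_p0) q0 pq h0 hL' invP); last exact: boxed_stepf.
move=> H [aH HB]; rewrite ler_nat; case: (lerP (H (y + k)) n.-1%:Z) => // Hk /=.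
rewrite lt0b.
have -> // : (xi B n H)%:R <= (y + B%:Z)%:~R + v * T - r / (8 * 80).
have : (xi B n H)%:Z <= y + k + B%:Z.
  by apply: xi_le_H => //; [clear -y1 k0; lia | exact: ltW | clear -Hk n0; lia].
rewrite -(ler_int R) => /le_trans; apply.
have -> : y + k + B%:Z = (y + B%:Z) + k by rewrite addrAC.
  rewrite intrD -[leRHS]addrA lerD2l.
by apply: le_trans (ltW k2) _.
Qed.

(** * Upper tail by blocks *)

(** The gap in [2 * exp w <= 1 + exp (2 * w)] is [(1 - exp w) ^ 2], which is at least [1 / 2] where
    [exp w <= 1 / 4]. *)
Lemma block_pointwise (R : realType) (w : R) (b : bool) : (b -> w <= -2) ->
  expR w <= 2^-1 + 2^-1 * expR (2 * w) - 4^-1 * b%:R.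
Proof.
move=> bw; have E : expR (2 * w) = expR w ^+ 2 by rewrite expRM_natl.
have e0 := expR_ge0 w; rewrite E; case: b bw => /= [/(_ isT) w2|_].
  have h1 : expR w <= 4^-1.
    have : 1 + 1 <= expR 1 :> R by exact: expR_ge1Dx.
    move=> h1; have h2 : 4 <= expR 2 :> R.
      have -> : expR 2 = expR 1 ^+ 2 :> R by rewrite -expRM_natl; congr expR; lra.
      by rewrite expr2; nra.
    apply: (@le_trans _ _ (expR (- 2))); first by rewrite ler_expR.
    by rewrite expRN lef_pV2 ?posrE ?expR_gt0.
  have := sqr_ge0 (expR w); move: h1; clear; lra.
have := sqr_ge0 (expR w - 1); rewrite sqrrB expr1n mulr1 mulr2n; lra.
Qed.

(** The second exponential moment is within a factor [1 + pm / 4] of its deterministic value, while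
    the lower tail has probability at least [pm]; so the passage from the first to the second moment
    loses, and [1 - pm / 8] remains. The constants depend on [p] and [q] alone, which permits
    iteration. *)
Lemma block (R : realType) (p q : R) (q0 : 0 <= q) (qp : q < p) (pq : p + q = 1) :
  exists (ga th s : R) (N0 : nat) (r0 : R),
  [/\ 0 <= ga < 1, 0 < th, 0 <= s < 1, 1 <= r0 &
  forall B n (h r : R) j y, (N0 <= n)%N -> s ^+ n.-1 * r <= 1 ->
   0 <= h -> h <= 16^-1 -> h * (B + B)%:R <= 1 -> r0 <= r ->
   r ^+ 2 <= j%:R * h <= 2 * r ^+ 2 -> n%:Z <= y + B%:Z -> y <= B%:Z ->
   Ex p q h (box B) hmove j (fun H => expR (th / r * (xi B n H)%:R)) (stepf y) <=
   ga * expR (th / r * ((y + B%:Z)%:~R + (p - q) * (j%:R * h)))].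
Proof.
have p0 : 0 < p by exact: le_lt_trans qp.
have pm0 : 0 < pmin R by rewrite /pmin /kmin divr_gt0// mulr_gt0// invr_gt0 ltr0n.
have pm1 : pmin R <= 1 by rewrite /pmin /kmin; lra.
have {}pm1 : pmin R <= 1 := pm1.
move: (pmin R) (@lower_tail R p q q0 qp pq) pm0 pm1 => pm LT pm0 pm1.
(* With [th / 640 = 2] the lower tail event lowers the exponent by 2, as [block_pointwise]
   requires. *)
have [th th0 th2] : exists2 th : R, 0 < th & th / (8 * 80) = 2.
  exists ((8 * 80) * 2); first by rewrite !mulr_gt0 ?ltr0n.
  by rewrite mulrC mulKf// mulf_neq0// pnatr_eq0.
have K0 : 0 < 32 * th ^+ 2 + 8 * th by rewrite addr_gt0// mulr_gt0// ?exprn_gt0.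
set K := _ + _ in K0.
(* At least [q / p] for the geometric weights, and close enough to 1 for both errors of [Ex_expo],
   which are proportional to [1 - s], to add up to at most [pm / 8]. *)
pose s := Num.max (q / p) (1 - pm / (8 * K)).
have t01 : 0 <= q / p < 1 by rewrite divr_ge0 ?(ltW p0)//= ltr_pdivrMr// mul1r.
have s1 : s < 1.
  by rewrite /s gt_max; case/andP: t01 => _ ->; rewrite gtrBl divr_gt0// mulr_gt0.
have s0 : 0 <= s by rewrite /s le_max; case/andP: t01 => ->.
have ps : q <= p * s.
  by rewrite mulrC -ler_pdivrMr// /s le_max lexx.
have sK : (1 - s) * K <= pm / 8.
  have : 1 - s <= pm / (8 * K).
    by rewrite lerBlDr addrC -lerBlDr /s le_max lexx orbT.
  move=> /(ler_wpM2r (ltW K0)) /le_trans; apply.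
  by rewrite invfM mulrA divfK// gt_eqF.
have [N0 HN0] := small_pow t01 pm0.
exists (1 - pm / 8), th, s, (maxn N0 1), (Num.max (Num.max (4 * th) (8 * 80)) (Num.max (10^-1 / (p - q)) 2)).
split => //.
- by rewrite subr_ge0 gtrBl; apply/andP; split; [lra | rewrite divr_gt0].
- by rewrite s0 s1.
- by rewrite !le_max; apply/orP; right; apply/orP; right; rewrite ler1n.
move=> B n h r j y; rewrite geq_max => /andP[N0n n0] sr h0 h16 hL.
rewrite !ge_max => /andP[/andP[r4 r640] /andP[rv r2]] /andP[T1 T2] ny yB.
have r0 : 0 < r by apply: lt_le_trans r2; rewrite ltr0n.
have rv' : 10^-1 <= r * (p - q) by rewrite -ler_pdivrMr ?subr_gt0.
have hL' : h * (size (box B))%:R <= 1 by rewrite size_box.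
have y1 : - B%:Z <= y by clear -ny; lia.
have lt := LT B h r (j%:R * h) j y h0 h16 hL r640 rv' erefl T1 T2 y1 yB n n0 (HN0 n N0n).
set T := j%:R * h in T1 T2 lt *.
pose lam := 2 * th / r.
have lam0 : 0 < lam by rewrite divr_gt0// mulr_gt0.
pose S := \sum_(i < n) s ^+ i.
have SE : (1 - s) * S = 1 - s ^+ n by rewrite -[RHS]opprB subrX1 -mulNr opprB.
have sn1 : s ^+ n <= s ^+ n.-1 by rewrite ler_wiXn2l// ?leq_pred// ltW.
have sn0 : 0 <= s ^+ n.-1 by rewrite exprn_ge0.
have sn : s ^+ n <= 2^-1.
  apply: le_trans sn1 _; rewrite -(@ler_pM2r _ r)//; apply: le_trans sr _.
  by rewrite ler_pdivlMl// mulr1.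
have S2 : 1 <= 2 * (1 - s) * S by rewrite -mulrA SE; move: sn; clear; lra.
have S0 : 0 < S.
  have h1 : 0 < 2 * (1 - s) by rewrite mulr_gt0// subr_gt0.
  by rewrite -(pmulr_rgt0 _ h1); apply: lt_le_trans S2.
have S1 : 1 <= S.
  rewrite /S -(prednK n0) big_ord_recl expr0 lerDl; apply: sumr_ge0 => i _.
  exact: exprn_ge0.
pose a := lam / S.
have aS : a * S = lam by rewrite divfK// gt_eqF.
have a0 : 0 < a by rewrite divr_gt0.
have alam : a <= 2 * (1 - s) * lam.
  by rewrite -aS mulrCA ler_peMr// ltW.
have a2 : 0 <= a <= 2^-1.
  rewrite ltW//=; apply: (@le_trans _ _ lam).
    by rewrite -aS ler_peMr// ltW.
  by rewrite /lam ler_pdivrMr//; move: r4; clear; lra.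
have s01 : 0 <= s <= 1 by rewrite s0 ltW.
have := @Ex_expo R B p q h (ltW p0) q0 pq h0 hL n a s n0 a2 s01 ps y j yB ny.
rewrite (lamE n a s) -/S aS -/T.
set D := (y + B%:Z)%:~R + (p - q) * T.
move=> ex.
have ex2 : Ex p q h (box B) hmove j (fun H => expR (lam * (xi B n H)%:R)) (stepf y) <=
   expR (lam * D) * (1 + pm / 4).
  apply: le_trans ex _.
  apply: (@le_trans _ _ (expR (lam * D + pm / 8))); last first.
    rewrite expRD ler_wpM2l ?expR_ge0//.
    have hpm : 0 <= pm / 8 <= 2^-1 by move: pm0 pm1; clear => ? ?; apply/andP; split; lra.
    have := expR_le_quad hpm.
    have : (pm / 8) ^+ 2 <= pm / 64.
      by rewrite expr2; move: pm0 pm1; clear; nra.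
    move: pm0 pm1; clear; lra.
  rewrite ler_expR (_ : lam * D + pm / 8 =
     lam * (y + B%:Z)%:~R + (lam * ((p - q) * T) + pm / 8)); last by rewrite /D; ring.
  rewrite lerD2l (_ : T * _ = lam * ((p - q) * T)
     + (T * (2 * a * lam) + T * (a * s ^+ n.-1))); last by ring.
  rewrite lerD2l.
  apply: le_trans sK; rewrite /K mulrDr.
  have rl : r * lam = 2 * th by rewrite /lam mulrCA divff ?mulr1// gt_eqF.
  have s1' : 0 <= 1 - s by rewrite subr_ge0 ltW.
  have a_ge0 := ltW a0; have lam_ge0 := ltW lam0; have th_ge0 := ltW th0.
  apply: lerD.
    apply: (@le_trans _ _ (2 * r ^+ 2 * (2 * (2 * (1 - s) * lam) * lam))).
      apply: ler_pM => //; first by rewrite (le_trans _ T1)// sqr_ge0.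
        by do 2 (apply: mulr_ge0 => //).
      by rewrite ler_wpM2r ?(ltW lam0)// ler_wpM2l.
    rewrite [leLHS](_ : _ = 8 * (1 - s) * (r * lam) ^+ 2); last by ring.
    rewrite rl [leLHS](_ : _ = (1 - s) * (32 * th ^+ 2)) ?lexx//; ring.
  apply: (@le_trans _ _ (2 * r ^+ 2 * ((2 * (1 - s) * lam) * s ^+ n.-1))).
    apply: ler_pM => //; first by rewrite (le_trans _ T1)// sqr_ge0.
      by apply: mulr_ge0.
    by rewrite ler_wpM2r.
  rewrite [leLHS](_ : _ = 4 * (1 - s) * (r * lam) * (s ^+ n.-1 * r)); last by ring.
  rewrite rl; apply: (@le_trans _ _ (4 * (1 - s) * (2 * th) * 1)).
    by rewrite ler_wpM2l// !mulr_ge0 ?ler0n.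
  rewrite [leLHS](_ : _ = (1 - s) * (8 * th)) ?lexx//; ring.
pose c := expR (th / r * D).
pose bad (H : int -> int) := ((xi B n H)%:R <= (y + B%:Z)%:~R + (p - q) * T - r / (8 * 80))%R.
apply: (@le_trans _ _ (Ex p q h (box B) hmove j (fun H =>
   1 * (c / 2 + (2^-1 * expR (- (th / r * D))) * expR (lam * (xi B n H)%:R))
   + (- (c / 4)) * (bad H)%:R) (stepf y))).
  apply: (Ex_le (ltW p0) q0 pq h0 hL') => H.
  have bw : bad H -> th / r * ((xi B n H)%:R - D) <= -2.
    rewrite /bad /D => hb.
    apply: (@le_trans _ _ (th / r * (- (r / (8 * 80))))).
      by rewrite ler_wpM2l ?divr_ge0 ?(ltW th0) ?(ltW r0)//; move: hb; clear; lra.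
    by rewrite -th2 mulrN lerN2 [leRHS](_ : _ = th / (8 * 80) )//; field; rewrite gt_eqF.
  have := block_pointwise bw.
  rewrite -(ler_pM2l (expR_gt0 (th / r * D))) -expRD.
  have -> : th / r * D + th / r * ((xi B n H)%:R - D) = th / r * (xi B n H)%:R by ring.
  move=> /le_trans; apply; rewrite -/c le_eqVlt; apply/orP; left; apply/eqP.
  have -> : 2 * (th / r * ((xi B n H)%:R - D)) = - (th / r * D) - th / r * D + lam * (xi B n H)%:R.
    by rewrite /lam; ring.
  rewrite !expRD expRN -/c; field.
  by rewrite gt_eqF ?expR_gt0.
rewrite Ex_lin Ex_addf (@Ex_scale R p q h (box B) _ hmove j (2^-1 * expR (- (th / r * D)))) Ex_cst.
have c0 : 0 < c by exact: expR_gt0.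
rewrite -/bad in lt.
have e1 : 2^-1 * expR (- (th / r * D)) * Ex p q h (box B) hmove j (fun H => expR (lam * (xi B n H)%:R)) (stepf y)
   <= 2^-1 * c * (1 + pm / 4).
  apply: (@le_trans _ _ (2^-1 * expR (- (th / r * D)) * (expR (lam * D) * (1 + pm / 4)))).
    by rewrite ler_wpM2l// mulr_ge0 ?expR_ge0.
  rewrite le_eqVlt; apply/orP; left; apply/eqP.
  have -> : lam * D = th / r * D + th / r * D by rewrite /lam; ring.
  rewrite expRD expRN -/c; field.
  by rewrite gt_eqF.
have e2 : c / 4 * pm <= c / 4 * Ex p q h (box B) hmove j (fun H => (bad H)%:R) (stepf y).
  by rewrite ler_wpM2l// divr_ge0// ltW.
(* Balance of the block: [1 / 2 + (1 + pm / 4) / 2 - pm / 4 = 1 - pm / 8]. *)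
rewrite [leRHS](_ : _ = c / 2 + 2^-1 * c * (1 + pm / 4) - c / 4 * pm); last by rewrite -/c; field.
by rewrite mul1r mulNr; apply: lerB => //; rewrite lerD2l.
Qed.

Lemma xi_iff B n y H b : boxed B y H -> b \in box B ->
  (n%:Z <= H b) = (b < - B%:Z + (xi B n H)%:Z).
Proof.
rewrite mem_box => -[aH _] bB; apply/idP/idP => [nb|].
  have : (count (fun b' => b' < b + 1)%R (box B))%:Z = b + 1 + B%:Z.
    by apply: count_box_lt; lia.
  have : (count (fun b' => b' < b + 1)%R (box B) <= xi B n H)%N.
    apply: sub_count => b' /= bb'; apply: le_trans nb _.
    by apply: (adm_le aH); lia.
  lia.
apply: contraTT; rewrite -ltNge => Hb.
have := @xi_le_H B n b H aH; lia.
Qed.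

Lemma xi_le_size B n H : (xi B n H <= B + B)%N.
Proof. by rewrite -size_box count_size. Qed.

(** Filling every site up to the [n]-th particle and counting the particles ahead of it as [n] gives
    a step profile above [H]; this is how a block restarts. *)
Lemma le_add_stepf B n y H : (0 < n)%N -> y <= B%:Z -> boxed B y H ->
  forall z, H z <= n%:Z + stepf (- B%:Z + (xi B n H)%:Z) z.
Proof.
move=> n0 yB bH z; have [aH HB] := bH; set y' := - B%:Z + _.
have y'B : y' <= B%:Z by have := xi_le_size B n H; rewrite /y'; lia.
have H1 : H y' <= n%:Z.
  case: (lerP B%:Z y') => yy.
    rewrite HB; last by right.
    rewrite /stepf; lia.
  have bB : y' \in box B by rewrite mem_box /y' in yy *; lia.
  have := @xi_iff B n y H y' bH bB; rewrite -/y' ltxx; lia.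
case: (lerP y' z) => yz.
  have := adm_le aH yz; rewrite /stepf; lia.
have := adm_lip aH (ltW yz); rewrite /stepf; lia.
Qed.

(** The height at the left end of the box is frozen, so the [n]-th particle cannot retreat by more
    than [n]; enough particles remain for the later blocks. *)
Lemma xi_ge B n y H : - B%:Z <= y -> n%:Z <= y + B%:Z -> y <= B%:Z -> boxed B y H ->
  y + B%:Z - n%:Z <= (xi B n H)%:Z.
Proof.
move=> y1 ny yB [aH HB].
have <- : (count (fun b => b < y - n%:Z)%R (box B))%:Z = y + B%:Z - n%:Z.
  by rewrite count_box_lt; lia.
rewrite lez_nat; apply: sub_count => b /= bl.
case: (ltrP b (- B%:Z)) => bB.
  by rewrite HB; [rewrite /stepf; lia | left].
have : - B%:Z - 1 <= b by lia.
move=> /(adm_lip aH); rewrite HB; last by left; lia.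
rewrite /stepf; lia.
Qed.

Lemma hmove_mono (k : int) c H H' : (forall z, H z <= k + H' z) ->
  forall z, hmove c H z <= k + hmove c H' z.
Proof.
case: c => b d hH z; rewrite /hmove /=; case: eqP => // _.
have := hH (b - 1); have := hH (b + 1); case: d; lia.
Qed.

(** Each block restarts from the step profile at the [n]-th particle of the preceding one. By
    monotonicity the factors [ga] multiply, and every block gives up [n] particles. *)
Lemma blocks (R : realType) (p q : R) (q0 : 0 <= q) (qp : q < p) (pq : p + q = 1)
    (ga th : R) B n (h r : R) :
  0 <= ga -> 0 <= h -> h * (B + B)%:R <= 1 -> (0 < n)%N -> 0 <= th / r ->
  (forall j y,   r ^+ 2 <= j%:R * h <= 2 * r ^+ 2 -> n%:Z <= y + B%:Z -> y <= B%:Z ->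
   Ex p q h (box B) hmove j (fun H => expR (th / r * (xi B n H)%:R)) (stepf y) <=
   ga * expR (th / r * ((y + B%:Z)%:~R + (p - q) * (j%:R * h)))) ->
  forall js j y, r ^+ 2 <= j%:R * h <= 2 * r ^+ 2 ->
  all (fun j : nat => r ^+ 2 <= j%:R * h <= 2 * r ^+ 2) js ->
  ((size js).+1 * n)%N%:Z <= y + B%:Z -> y <= B%:Z ->
  Ex p q h (box B) hmove (j + sumn js) (fun H => expR (th / r * (xi B ((size js).+1 * n) H)%:R)) (stepf y) <=
   ga ^+ (size js).+1 * expR (th / r * ((y + B%:Z)%:~R + (p - q) * ((j + sumn js)%:R * h))).
Proof.
move=> ga0 h0 hL n0 thr Hb.
have p0 : 0 <= p by exact: le_trans (ltW qp).
have hL' : h * (size (box B))%:R <= 1 by rewrite size_box.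
have invP y : forall c H, c.1 \in box B -> boxed B y H -> boxed B y (hmove c H).
  by move=> c' H; exact: hmove_boxed.
elim=> [|j' js IH] j y jP jsP ny yB.
  by rewrite /= addn0 mul1n expr1; apply: Hb => //; rewrite mul1n in ny.
have {}jsP : r ^+ 2 <= j'%:R * h <= 2 * r ^+ 2 /\
   all (fun j : nat => r ^+ 2 <= j%:R * h <= 2 * r ^+ 2) js by apply/andP.
case: jsP => j'P jsP; rewrite /= in ny *.
have y1 : - B%:Z <= y by move: ny; set X := (_ * n)%N; clear; lia.
rewrite Ex_add.
set m := ((size js).+1 * n)%N.
have nm : ((size js).+2 * n = n + m)%N by rewrite mulSn.
have {}ny : (n + m)%N%:Z <= y + B%:Z by rewrite -nm.
have ny' : n%:Z <= y + B%:Z by clear -ny; lia.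
pose C := ga ^+ (size js).+1 * expR (th / r * ((p - q) * ((j' + sumn js)%:R * h))).
have C0 : 0 <= C by rewrite mulr_ge0 ?expR_ge0// exprn_ge0.
apply: (@le_trans _ _ (Ex p q h (box B) hmove j (fun H => C * expR (th / r * (xi B n H)%:R)) (stepf y))).
  apply: (Ex_le_in p0 q0 pq h0 hL' (invP y)); last exact: boxed_stepf.
  move=> H bH; set y' := - B%:Z + (xi B n H)%:Z.
  have y'B : y' <= B%:Z by have := xi_le_size B n H; rewrite /y'; clear; lia.
  have my' : m%:Z <= y' + B%:Z.
    by have := xi_ge y1 ny' yB bH; rewrite /y'; clear -ny; lia.
  apply: (@le_trans _ _ (Ex p q h (box B) hmove (j' + sumn js)
       (fun H => expR (th / r * (xi B m H)%:R)) (stepf y'))).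
    apply: (@Ex_couple _ _ _ _ _ p0 q0 pq h0 hL' _ _ hmove hmove
       (fun H H' => forall z, H z <= n%:Z + H' z)) => [c' G G' _|G G' GG'|].
    - exact: hmove_mono.
    - rewrite ler_expR ler_wpM2l// ler_nat; apply: sub_count => b /=.
      by have := GG' b; rewrite nm; clear; lia.
    - exact: le_add_stepf bH.
  apply: le_trans (IH j' y' j'P jsP my' y'B) _.
  rewrite /C -[leRHS]mulrA ler_wpM2l ?exprn_ge0// -expRD ler_expR.
  have -> : y' + B%:Z = (xi B n H)%:Z by rewrite /y'; clear; lia.
  by rewrite [leLHS]mulrDr -pmulrn [leRHS]addrC.
rewrite Ex_scale; apply: le_trans (ler_wpM2l C0 (Hb j y jP ny' yB)) _.
rewrite /C [ga ^+ (size js).+2]exprSr le_eqVlt; apply/orP; left; apply/eqP.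
rewrite [th / r * ((y + B%:Z)%:~R + (p - q) * ((j + (j' + sumn js))%:R * h))](_ : _ =
   th / r * ((p - q) * ((j' + sumn js)%:R * h)) + th / r * ((y + B%:Z)%:~R + (p - q) * (j%:R * h))); last first.
  rewrite natrD; ring.
rewrite expRD; ring.
Qed.

Lemma xi_ge_at B m y H z : boxed B y H -> z \in box B -> m%:Z <= H z ->
  z + 1 + B%:Z <= (xi B m H)%:Z.
Proof. move=> bH zB; rewrite (@xi_iff B m y H z bH zB); lia. Qed.

(** * Density of particles near the origin *)

(** Translation by one bond, closed up cyclically to be a permutation of the box: the translated
    clocks then have the same law. *)
Definition cyc (B : nat) (b : int) : int := if b == - B%:Z then B%:Z - 1 else b - 1.

Lemma cyc_box B : perm_eq [seq cyc B b | b <- box B] (box B).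
Proof.
apply: uniq_perm; [|exact: uniq_box|].
  rewrite map_inj_in_uniq ?uniq_box// => b b'; rewrite !mem_box /cyc.
  by case: eqP; case: eqP; lia.
move=> b; rewrite mem_box; apply/mapP/idP => [[b']|bB].
  by rewrite mem_box /cyc => bB ->; case: eqP; lia.
case: (eqVneq b (B%:Z - 1)) => [->|bb].
  by exists (- B%:Z); [rewrite mem_box; lia | rewrite /cyc eqxx].
exists (b + 1); first by rewrite mem_box; lia.
by rewrite /cyc; case: eqP; lia.
Qed.

(** Attractiveness: under common clocks the inclusion of one configuration in another is preserved;
    it is expressed by the drops of the heights. *)
Lemma hmove_attr c H H' : adm H -> adm H' -> (forall z, H (z - 1) - H z <= H' (z - 1) - H' z) ->
  forall z, hmove c H (z - 1) - hmove c H z <= hmove c H' (z - 1) - hmove c H' z.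
Proof.
case: c => b d aH aH' HH z; rewrite /hmove /=.
have := HH b; have := HH (b + 1); have := HH z.
have := aH b; have := aH (b + 1); have := aH' b; have := aH' (b + 1).
rewrite !addrK; case: eqP => [zb|zb]; case: eqP => [zb'|zb'] //; first by lia.
- have -> : z = b + 1 by lia.
  rewrite ?addrK; move: (H (b - 1)) (H b) (H (b + 1)) (H' (b - 1)) (H' b) (H' (b + 1)).
  by clear; move=> a0 a1 a2 b0 b1 b2; case: d; lia.
- rewrite zb'; move: (H (b - 1)) (H b) (H (b + 1)) (H' (b - 1)) (H' b) (H' (b + 1)).
  by clear; move=> a0 a1 a2 b0 b1 b2; case: d; lia.
Qed.

Section Translate.
Context {R : realType}.
Variables (p q h : R) (B : nat).
Hypotheses (p0 : 0 <= p) (q0 : 0 <= q) (pq : p + q = 1) (h0 : 0 <= h)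
  (hL : h * (B + B)%:R <= 1).

Definition pact (c : int * bool) (x : (int -> int) * (int -> int)) :=
  (hmove c x.1, hmove (cyc B c.1, c.2) x.2).

Definition disc (z : int) (x : (int -> int) * (int -> int)) : R := (x.1 z != x.2 (z - 1))%:R.

(** Away from the ends of the box the two translated copies follow the same rule, so a discrepancy
    at [z] comes from one at a neighbour. *)
Lemma stp_disc z x : - B%:Z + 2 <= z -> z <= B%:Z - 2 ->
  stp p q h (box B) pact (disc z) x <= disc z x + h * (disc (z - 1) x + disc (z + 1) x).
Proof.
move=> z1 z2; rewrite /stp lerD2l; apply: ler_wpM2l => //.
have cz b : b \in box B -> (z - 1 == cyc B b) = (z == b).
  rewrite mem_box /cyc => bB; clear -bB z1 z2.
  by case: (eqVneq b (- B%:Z)) => [->|_]; lia.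
have zB : z \in box B by rewrite mem_box; clear -z1 z2; lia.
rewrite /gen (bigD1_seq z) ?uniq_box//= big_seq_cond big1 ?addr0; last first.
  move=> b /andP[bB bz]; have zb : (z == b) = false by rewrite eq_sym; exact: negbTE.
  rewrite /disc /pact /= /hmove /= cz// zb.
  by rewrite !subrr !mulr0 addr0.
have D0 z' : 0 <= disc z' x by rewrite /disc ler0n.
have dd b : disc z (pact (z, b) x) <= disc (z - 1) x + disc (z + 1) x.
  rewrite /disc /pact /= /hmove /= eqxx cz// eqxx.
  have -> : cyc B z = z - 1 by rewrite /cyc; case: eqP => //; clear -z1 z2; lia.
  have -> : z - 1 + 1 = z by rewrite subrK.
  rewrite addrK; set X := (_ != _ in X in X <= _).
  case: (eqVneq (x.1 (z - 1)) (x.2 (z - 1 - 1))) => [E1|_] /=.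
    case: (eqVneq (x.1 (z + 1)) (x.2 z)) => [E2|_] /=; last by rewrite add0r lern1 leq_b1.
    by rewrite /X E1 E2 eqxx addr0.
  by rewrite (@le_trans _ _ 1)// ?lern1 ?leq_b1// lerDl.
apply: (@le_trans _ _ (p * (disc (z - 1) x + disc (z + 1) x) + q * (disc (z - 1) x + disc (z + 1) x))).
  by apply: lerD; apply: ler_wpM2l => //; rewrite lerBlDr (le_trans (dd _))// lerDl.
by rewrite -mulrDl pq mul1r.
Qed.

Lemma expR1_le4 : expR 1 <= 4 :> R.
Proof.
have -> : expR 1 = expR 2^-1 ^+ 2 :> R by rewrite -expRM_natl divff// pnatr_eq0.
have : expR 2^-1 <= 2 :> R.
  apply: le_trans (expR_le_inv _) _; first by rewrite invf_lt1// ltr1n.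
  by rewrite (_ : 1 - 2^-1 = 2^-1) ?invrK//; field.
have := expR_ge0 (2^-1 : R); set e := expR _ => e0 e2.
by rewrite expr2 (_ : 4 = 2 * 2) ?ler_pM// -natrM.
Qed.

(** Discrepancies enter at the ends of the box and move by one site per ring. The exponential weight
    changes by at most [exp 1 <= 4] per site and there are two neighbours, whence the factor
    [1 + 8 * h]. *)
Lemma Ex_disc j z y : 
  Ex p q h (box B) pact j (disc z) (stepf (y + 1), stepf y) <=
  (1 + 8 * h) ^+ j * expR (`|z|%:~R - B%:R + 2).
Proof.
have hL' : h * (size (box B))%:R <= 1 by rewrite size_box.
have h8 : 0 <= 1 + 8 * h by rewrite addr_ge0// mulr_ge0.
have E1 (z' : int) : expR (`|z' - 1|%:~R - B%:R + 2) <= 4 * expR (`|z'|%:~R - B%:R + 2) :> R.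
  apply: le_trans (ler_wpM2r (expR_ge0 _) expR1_le4); rewrite -expRD ler_expR.
  rewrite (_ : 1 + _ = 1 + `|z'|%:~R - B%:R + 2); last by rewrite !addrA.
  rewrite 2!lerD2r -(intrD _ 1) ler_int; lia.
have E2 (z' : int) : expR (`|z' + 1|%:~R - B%:R + 2) <= 4 * expR (`|z'|%:~R - B%:R + 2) :> R.
  apply: le_trans (ler_wpM2r (expR_ge0 _) expR1_le4); rewrite -expRD ler_expR.
  rewrite (_ : 1 + _ = 1 + `|z'|%:~R - B%:R + 2); last by rewrite !addrA.
  rewrite 2!lerD2r -(intrD _ 1) ler_int; lia.
elim: j z => [|j IH] z.
  rewrite /Ex /= mul1r /disc /= (_ : stepf (y + 1) z = stepf y (z - 1)) ?eqxx ?expR_ge0//.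
  by rewrite /stepf; lia.
have [/andP[z1 z2]|zB] := boolP ((- B%:Z + 2 <= z) && (z <= B%:Z - 2)); last first.
  apply: (@le_trans _ _ 1).
    rewrite -[leRHS](congr1 (@^~ (stepf (y + 1), stepf y)) (@Ex_cst R p q h (box B) _ pact j.+1 1)).
    by apply: (Ex_le p0 q0 pq h0 hL') => x; rewrite /disc; case: eqP => _ /=; rewrite ?ler01.
  rewrite -[leLHS]mulr1; apply: ler_pM => //.
    by rewrite exprn_ege1// lerDl mulr_ge0.
  rewrite -[leLHS]expR0 ler_expR.
  have : B%:Z - 2 <= `|z| by clear -zB; lia.
  by rewrite -(ler_int R) intrB; lra.
rewrite ExSr.
apply: (@le_trans _ _ (Ex p q h (box B) pact j
    (fun x => disc z x + h * (disc (z - 1) x + disc (z + 1) x)) (stepf (y + 1), stepf y))).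
  by apply: (Ex_le p0 q0 pq h0 hL') => x; exact: stp_disc.
rewrite Ex_addf Ex_scale Ex_addf /=.
set E := expR _; rewrite exprSr -mulrA (_ : (1 + 8 * h) * E = E + h * (4 * E + 4 * E)); last by ring.
rewrite [leRHS]mulrDr; apply: lerD; first exact: IH.
rewrite [leRHS]mulrCA ler_wpM2l// [leRHS]mulrDr.
by apply: lerD; apply: le_trans (IH _) _; apply: ler_wpM2l; rewrite ?exprn_ge0.
Qed.

Definition occ (z : int) (H : int -> int) : R := (H (z - 1) != H z)%:R.

Lemma occE z H : adm H -> occ z H = (H (z - 1) - H z)%:~R.
Proof.
move=> /(_ z) aH; rewrite /occ.
have [->|->] : H (z - 1) = H z \/ H (z - 1) = H z + 1 by lia.
  by rewrite eqxx subrr.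
by rewrite (_ : (_ != _) = true); [rewrite addrAC subrr add0r|lia].
Qed.

(** The density is nearly nonincreasing in space: adding a particle at the edge of the step can only
    raise it, and the new profile is a translate of the old one, up to discrepancies from the
    boundary. *)
Lemma rho_shift j z y (K0 : int) : `|z| <= K0 -> `|z - 1| <= K0 ->
  Ex p q h (box B) hmove j (occ z) (stepf y) <=
  Ex p q h (box B) hmove j (occ (z - 1)) (stepf y)
    + 2 * ((1 + 8 * h) ^+ j * expR (K0%:~R - B%:R + 2)).
Proof.
move=> zK zK1.
have hL' : h * (size (box B))%:R <= 1 by rewrite size_box.
have h8 : 0 <= 1 + 8 * h by rewrite addr_ge0// mulr_ge0.
apply: (@le_trans _ _ (Ex p q h (box B) hmove j (occ z) (stepf (y + 1)))).
  apply: (@Ex_couple _ _ _ _ _ p0 q0 pq h0 hL' _ _ hmove hmove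
    (fun H H' => [/\ adm H, adm H' & forall z, H (z - 1) - H z <= H' (z - 1) - H' z])).
  - by move=> c H H' _ [aH aH' HH]; split; [exact: hmove_adm|exact: hmove_adm|exact: hmove_attr].
  - by move=> H H' [aH aH' HH]; rewrite !occE// ler_int.
  - by split; try exact: adm_stepf; move=> z'; rewrite /stepf; lia.
pose x0 := (stepf (y + 1), stepf y).
have -> : Ex p q h (box B) hmove j (occ z) (stepf (y + 1)) =
   Ex p q h (box B) pact j (fun x => occ z x.1) x0.
  by rewrite (Ex_proj p0 q0 pq h0 hL' (act' := hmove) (inv := fun=> True)).
have -> : Ex p q h (box B) hmove j (occ (z - 1)) (stepf y) =
   Ex p q h (box B) pact j (fun x => occ (z - 1) x.2) x0.
  rewrite -(Ex_reindex _ _ _ hmove (cyc_box B)).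
  by rewrite (Ex_proj p0 q0 pq h0 hL' (act' := fun c => hmove (cyc B c.1, c.2)) (inv := fun=> True)).
apply: (@le_trans _ _ (Ex p q h (box B) pact j
   (fun x => occ (z - 1) x.2 + (disc (z - 1) x + disc z x)) x0)).
  apply: (Ex_le p0 q0 pq h0 hL') => -[H K]; rewrite /occ /disc /=.
  case: (eqVneq (H (z - 1)) (K (z - 1 - 1))) => [->|_]; last first.
    by rewrite -!natrD ler_nat; do 3 case: (_ != _).
  case: (eqVneq (H z) (K (z - 1))) => [->|_] /=; first by rewrite !addr0.
  by rewrite -!natrD ler_nat; do 2 case: (_ != _).
rewrite !Ex_addf lerD2l mulr_natl mulr2n; apply: lerD; apply: le_trans (Ex_disc _ _ _) _;
  rewrite ler_wpM2l ?exprn_ge0// ler_expR !lerD2r ler_int//.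
Qed.

Lemma rho_shiftn j z y (K0 : int) i : `|z| + i%:Z <= K0 ->
  Ex p q h (box B) hmove j (occ z) (stepf y) <=
  Ex p q h (box B) hmove j (occ (z - i%:Z)) (stepf y)
    + 2 * i%:R * ((1 + 8 * h) ^+ j * expR (K0%:~R - B%:R + 2)).
Proof.
elim: i => [|i IH] zK; first by rewrite subr0 mulr0 mul0r addr0.
have {}IH := IH (ltac:(lia)).
apply: le_trans IH _.
have := @rho_shift j (z - i%:Z) y K0 (ltac:(lia)) (ltac:(lia)).
have -> : z - i%:Z - 1 = z - i.+1%:Z by lia.
set e := _ * expR _; rewrite -natr1; set r1 := Ex _ _ _ _ _ _ _ _; set r2 := Ex _ _ _ _ _ _ _ _.
move=> hr; apply: le_trans (lerD hr (lexx _)) _.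
rewrite -addrA lerD2l le_eqVlt; apply/orP; left; apply/eqP; ring.
Qed.

(** A nearly monotone density is bounded by its mean over the [m] preceding sites, a height
    increment, which is at most [a] unless the height itself reaches [a], and never more than
    [m]. *)
Lemma density j z y (K0 : int) (m : nat) (a : nat) : y <= B%:Z -> `|z| + m%:Z <= K0 ->
  m%:R * Ex p q h (box B) hmove j (occ z) (stepf y) <=
  a%:R + m%:R * Ex p q h (box B) hmove j (fun H => (a%:Z <= H (z - m%:Z))%R%:R) (stepf y)
   + 2 * m%:R * m%:R * ((1 + 8 * h) ^+ j * expR (K0%:~R - B%:R + 2)).
Proof.
move=> yB zK.
have hL' : h * (size (box B))%:R <= 1 by rewrite size_box.
have invP : forall c H, c.1 \in box B -> boxed B y H -> boxed B y (hmove c H).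
  by move=> c' H; exact: hmove_boxed.
set e := _ * expR _.
have e0 : 0 <= e by rewrite mulr_ge0 ?expR_ge0// exprn_ge0// addr_ge0// mulr_ge0.
apply: (@le_trans _ _ (\sum_(i <- iota 0 m) (Ex p q h (box B) hmove j (occ (z - i%:Z)) (stepf y)
    + 2 * m%:R * e))).
  have -> : forall x, m%:R * x = \sum_(i <- iota 0 m) x :> R.
    by move=> x; rewrite big_const_seq count_predT size_iota iter_addr_0 mulr_natl.
  rewrite big_seq [leRHS]big_seq; apply: ler_sum => i; rewrite mem_iota => im.
  apply: le_trans (@rho_shiftn j z y K0 i _) _; first by lia.
  by rewrite lerD2l ler_wpM2r// ler_wpM2l// ler_nat; lia.
rewrite big_split /= [X in _ + X](_ : _ = 2 * m%:R * m%:R * e); last first.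
  by rewrite big_const_seq count_predT size_iota iter_addr_0 -[LHS]mulr_natr; ring.
rewrite lerD2r.
have := @Ex_scale R p q h (box B) _ hmove j m%:R (fun H => (a%:Z <= H (z - m%:Z))%R%:R).
move=> /(congr1 (@^~ (stepf y))) /= <-.
have := @Ex_sum R p q h (box B) _ hmove j _ (iota 0 m) (fun i => occ (z - i%:Z)).
move=> /(congr1 (@^~ (stepf y))) /= <-.
rewrite -[X in _ <= X + _](congr1 (@^~ (stepf y)) (@Ex_cst R p q h (box B) _ hmove j a%:R)).
have := @Ex_addf R p q h (box B) _ hmove j (fun=> a%:R) (fun H => m%:R * (a%:Z <= H (z - m%:Z))%R%:R).
move=> /(congr1 (@^~ (stepf y))) /= <-.
apply: (Ex_le_in p0 q0 pq h0 hL' invP); last exact: boxed_stepf.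
move=> H bH; have [aH _] := bH; have H0 := boxed_ge0 yB bH.
have -> : \sum_(i <- iota 0 m) occ (z - i%:Z) H = (H (z - m%:Z) - H z)%:~R.
  elim: m {zK e e0} => [|m IH]; first by rewrite big_nil subr0 subrr.
  rewrite -addn1 iotaD big_cat /= big_seq1 IH add0n occE// -intrD addn1.
  have -> : z - m%:Z - 1 = z - m.+1%:Z by lia.
  congr (_%:~R); ring.
have := adm_lip aH (_ : z - m%:Z <= z); have := H0 z.
case: (lerP a%:Z (H (z - m%:Z))) => Ha hz /(_ ltac:(lia)) hm /=.
  rewrite mulr1 -natrD -[leRHS]/((a + m)%N%:Z%:~R) ler_int; lia.
rewrite mulr0 addr0 -[leRHS]/(a%:Z%:~R) ler_int; lia.
Qed.

(** Exponential Chebyshev inequality: a height [m] at [z] means that the [m]-th particle is to the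
    right of [z]. *)
Lemma tail_xi j z y m (lam : R) : 0 <= lam -> z \in box B ->
  Ex p q h (box B) hmove j (fun H => (m%:Z <= H z)%R%:R) (stepf y) <=
  expR (- lam * (z + 1 + B%:Z)%:~R) *
  Ex p q h (box B) hmove j (fun H => expR (lam * (xi B m H)%:R)) (stepf y).
Proof.
move=> lam0 zB.
have hL' : h * (size (box B))%:R <= 1 by rewrite size_box.
have invP : forall c H, c.1 \in box B -> boxed B y H -> boxed B y (hmove c H).
  by move=> c' H; exact: hmove_boxed.
have := @Ex_scale R p q h (box B) _ hmove j (expR (- lam * (z + 1 + B%:Z)%:~R))
  (fun H => expR (lam * (xi B m H)%:R)).
move=> /(congr1 (@^~ (stepf y))) /= <-.
apply: (Ex_le_in p0 q0 pq h0 hL' invP); last exact: boxed_stepf.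
move=> H bH; case: (lerP m%:Z (H z)) => Hm /=; last by rewrite mulr_ge0 ?expR_ge0.
rewrite -expRD -[leLHS]expR0 ler_expR mulNr addrC subr_ge0 ler_wpM2l//.
by rewrite -[leRHS]/(_%:Z%:~R) ler_int; exact: xi_ge_at bH zB Hm.
Qed.

End Translate.

(** * Words and their inversions *)

Fixpoint invw (c : seq nat) : nat :=
  if c is x :: l then count (fun y => y < x)%N l + invw l else 0%N.

Fixpoint swp (w : nat) (c : seq nat) : seq nat :=
  match w, c with
  | 0%N, x :: y :: l => y :: x :: l
  | w'.+1, x :: l => x :: swp w' l
  | _, _ => c
  end.

Definition wmove (c : nat * bool) (s : seq nat) : seq nat :=
  let a := nth 0%N s c.1 in let b := nth 0%N s c.1.+1 in
  if (if c.2 then (b < a)%N else (a < b)%N) then swp c.1 s else s.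

(** The sorted word: the initial arrangement of the middle classes, and the only one without
    inversions. *)
Definition gs (k : nat) : seq nat := nseq k 1%N ++ 2%N :: nseq k 3%N.

Lemma perm_swp w c : perm_eq (swp w c) c.
Proof.
elim: w c => [|w IH] [|x l] //=; last by rewrite perm_cons.
by case: l => [|y l] //; rewrite -(cat1s x) -(cat1s y) perm_catCA /=.
Qed.

Lemma size_swp w c : size (swp w c) = size c.
Proof. exact/perm_size/perm_swp. Qed.

Lemma swpK w c : swp w (swp w c) = c.
Proof. by elim: w c => [|w IH] [|x l] //=; [case: l | rewrite IH]. Qed.

Lemma nth_swp w c i : (w.+1 < size c)%N -> nth 0%N (swp w c) i =
  if i == w then nth 0%N c w.+1 else if i == w.+1 then nth 0%N c w else nth 0%N c i.
Proof.
elim: w c i => [|w IH] [|x l] //= i.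
  by case: l => // y l _; case: i => [|[|i]].
by rewrite ltnS => wl; case: i => [|i] //=; rewrite IH// !eqSS.
Qed.

Lemma drop_swp w c i : i != w.+1 -> perm_eq (drop i (swp w c)) (drop i c).
Proof.
elim: w c i => [|w IH] [|x l] //= [|i] //=.
- by case: l => // y l _; rewrite !drop0 -(cat1s x) -(cat1s y) perm_catCA.
- by case: l => // y l; case: i.
- by rewrite perm_cons perm_swp.
- by rewrite eqSS => /IH; exact.
Qed.

Lemma swp_eq w c : (w.+1 < size c)%N -> nth 0%N c w = nth 0%N c w.+1 -> swp w c = c.
Proof.
elim: w c => [|w IH] [|x l] //=; first by case: l => //= y l _ ->.
by rewrite ltnS => wl e; rewrite IH.
Qed.

Lemma invw_swp w c : (w.+1 < size c)%N -> (nth 0%N c w < nth 0%N c w.+1)%N ->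
  invw (swp w c) = (invw c).+1.
Proof.
elim: w c => [|w IH] [|x l] //=.
  case: l => //= y l _ xy; rewrite xy ltnNge (ltnW xy) /=; lia.
rewrite ltnS => wl e; rewrite IH// addnS; congr (_ + _).+1.
by apply/permP/perm_swp.
Qed.

Lemma invw_swp_gt w c : (w.+1 < size c)%N -> (nth 0%N c w.+1 < nth 0%N c w)%N ->
  (invw (swp w c)).+1 = invw c.
Proof.
move=> wl e; have := @invw_swp w (swp w c).
rewrite size_swp swpK !nth_swp// !eqxx (gtn_eqF (ltnSn w)).
by move=> /(_ wl e) ->.
Qed.

Lemma perm_wmove x c : perm_eq (wmove x c) c.
Proof. by rewrite /wmove; case: ifP => // _; exact: perm_swp. Qed.

Lemma size_wmove x c : size (wmove x c) = size c.
Proof. exact/perm_size/perm_wmove. Qed.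

Lemma invw_right c i : (i < size c)%N ->
  (count (fun y => y < nth 0 c i)%N (drop i.+1 c) <= invw c)%N.
Proof.
elim: c i => [|x l IH] [|i] //=; first by rewrite drop0 leq_addr.
by rewrite ltnS => il; apply: leq_trans (IH _ il) _; exact: leq_addl.
Qed.

Lemma invw_left c i : (i < size c)%N ->
  (count (fun y => nth 0 c i < y)%N (take i c) <= invw c)%N.
Proof.
elim: c i => [|x l IH] [|i] //=; rewrite ltnS => il.
apply: leq_add; last exact: IH.
case: ltnP => // xi /=; rewrite -has_count; apply/hasP.
by exists (nth 0%N l i) => //; exact: mem_nth.
Qed.

Lemma count_lt3 (c : seq nat) : all (fun y => 1 <= y <= 3)%N c ->
  size c = (count_mem 1%N c + count_mem 2%N c + count_mem 3%N c)%N.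
Proof.
by elim: c => //= x l IH /andP[xP /IH ->]; case: x xP => [|[|[|[|x]]]] //= _; lia.
Qed.

Lemma invw0_sorted c : invw c = 0%N -> sorted leq c.
Proof.
elim: c => //= x [|y l] IH //= h.
move/eqP: h; rewrite !addn_eq0 eqb0 -leqNgt -!andbA => /and4P[-> _ h1 h2].
by rewrite /= in IH *; apply: IH; rewrite (eqP h1) (eqP h2).
Qed.

Lemma sorted_invw0 c : sorted leq c -> invw c = 0%N.
Proof.
elim: c => //= x l IH pl; rewrite IH ?(path_sorted pl)// addn0.
apply/eqP; rewrite -leqn0 leqNgt -has_count; apply/hasPn => y yl.
by rewrite -leqNgt; have /allP/(_ y yl) := order_path_min leq_trans pl.
Qed.

Lemma invw_desc c : (0 < invw c)%N ->
  exists2 w, (w.+1 < size c)%N & (nth 0 c w.+1 < nth 0 c w)%N.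
Proof.
move=> i0; apply: contrapT => nx.
have sc : sorted leq c.
  apply/(sortedP 0%N) => i ic; rewrite leqNgt; apply/negP => h; apply: nx.
  by exists i.
by move: i0; rewrite (sorted_invw0 sc).
Qed.

Lemma gs_sorted k : sorted leq (gs k).
Proof.
rewrite /gs; apply/(sortedP 0%N) => i.
rewrite size_cat /= !size_nseq => ik.
rewrite !nth_cat !size_nseq !nth_nseq.
case: (ltnP i k) => h1; case: (ltnP i.+1 k) => h2 //; try lia.
  have -> : (i.+1 - k = 0)%N by lia.
  by [].
case e1 : (i.+1 - k)%N => [|m]; first by lia.
case e2 : (i - k)%N => [|m'] /=; rewrite !nth_nseq; case: ifP => //; try lia.
by case: ifP => //; lia.
Qed.

Lemma invw_gs k : invw (gs k) = 0%N.
Proof. exact/sorted_invw0/gs_sorted. Qed.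

Section Gs.
Variables (k : nat) (c : seq nat).
Hypothesis cg : perm_eq c (gs k).

Lemma gs_size : size c = (k + k).+1.
Proof. by rewrite (perm_size cg) /gs size_cat /= !size_nseq addnS. Qed.

Lemma gs_all : all (fun y => 1 <= y <= 3)%N c.
Proof. by rewrite (perm_all _ cg) /gs all_cat /= !all_nseq !orbT. Qed.

Lemma gs_count1 : count_mem 1%N c = k.
Proof. by rewrite (permP cg) /gs count_cat /= !count_nseq /= mul1n mul0n !addn0. Qed.

Lemma gs_count2 : count_mem 2%N c = 1%N.
Proof. by rewrite (permP cg) /gs count_cat /= !count_nseq /= mul0n. Qed.

Lemma gs_count3 : count_mem 3%N c = k.
Proof. by rewrite (permP cg) /gs count_cat /= !count_nseq /= mul1n mul0n !add0n. Qed.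

Lemma gs_take_count1 i : (count_mem 1%N (take i c) <= k)%N.
Proof. by rewrite -gs_count1 -[in leqRHS](cat_take_drop i c) count_cat leq_addr. Qed.

(** The ones that do not precede a letter above 1 follow it, and each of these is an inversion. With
    its counterpart [gs_left] this confines the disorder of a word to within [invw c] places of
    [k]. *)
Lemma gs_right1 i : (i < size c)%N -> (1 < nth 0 c i)%N -> (k <= i + invw c)%N.
Proof.
move=> ic ci; have := invw_right ic.
have : (count_mem 1%N (drop i.+1 c) <= count (fun y => y < nth 0 c i)%N (drop i.+1 c))%N.
  by apply: sub_count => y /= /eqP ->.
have := gs_count1; rewrite -[X in count _ X](cat_take_drop i.+1 c) count_cat.
rewrite (take_nth 0%N ic) -cats1 count_cat /=.
have -> : (nth 0%N c i == 1%N) = false by lia.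
have : (count_mem 1%N (take i c) <= i)%N.
  by apply: leq_trans (count_size _ _) _; rewrite size_take ic.
move: (count_mem 1%N (take i c)) (count_mem 1%N (drop i.+1 c)) (count _ (drop i.+1 c)) (invw c).
by clear => a b d e /=; lia.
Qed.

Lemma gs_left i : (i < size c)%N -> (nth 0 c i < 3)%N -> (i <= k + invw c)%N.
Proof.
move=> ic ci; have := invw_left ic.
have tA : all (fun y => 1 <= y <= 3)%N (take i c).
  by have := gs_all; rewrite -[X in all _ X](cat_take_drop i c) all_cat => /andP[].
have := count_lt3 tA; rewrite size_take ic.
have t1 := gs_take_count1 i.
have := gs_count2; rewrite -[X in count _ X](cat_take_drop i c) count_cat.
rewrite (drop_nth 0%N ic) /=.
have := gs_count1; rewrite -[X in count _ X](cat_take_drop i c) count_cat.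
rewrite (drop_nth 0%N ic) /=.
have : (count_mem 3%N (take i c) <= count (fun y => nth 0 c i < y)%N (take i c))%N.
  by apply: sub_count => y /= /eqP ->.
have := mem_nth 0%N ic; move/(allP gs_all); case: (nth 0%N c i) ci => [|[|[|x]]] //= _ _.
  have : (count_mem 3%N (take i c) + count_mem 2%N (take i c) <= count (fun y => 1 < y)%N (take i c))%N.
    rewrite -count_predUI [X in (_ + X)%N](@eq_count _ _ pred0) ?count_pred0 ?addn0; last first.
      by move=> y /=; case: eqP => // ->.
    by apply: sub_count => y /= /orP[] /eqP ->.
  lia.
lia.
Qed.

Lemma gs_index2 : (`|(index 2%N c)%:Z - k%:Z| <= (invw c)%:Z)%R.
Proof.
have c2 : 2%N \in c by rewrite -has_pred1 has_count gs_count2.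
have ic : (index 2%N c < size c)%N by rewrite index_mem.
have h1 := gs_right1 ic; have h2 := gs_left ic.
rewrite !nth_index// in h1 h2; have {}h1 := h1 isT; have {}h2 := h2 isT.
lia.
Qed.

Lemma gs_inv0 : invw c = 0%N -> c = gs k.
Proof.
move=> i0; apply: (@sorted_eq _ leq); [exact: leq_trans|exact: anti_leq| | |exact: cg].
  exact: invw0_sorted.
exact: gs_sorted.
Qed.

End Gs.

(** * Partition functions of words, bounded uniformly in the length *)

Section Weights.
Context {R : realType}.
Variable x : R.
Hypothesis x01 : 0 <= x < 1.
Let x0 : 0 <= x. Proof. by case/andP: x01. Qed.
Let x1 : x < 1. Proof. by case/andP: x01. Qed.

(** The Gaussian multinomial coefficient of the letters of [s] at [x]. *)
Definition wsum (s : seq nat) : R := \sum_(c <- permutations s) x ^+ invw c.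

Lemma wsum_ge0 s : 0 <= wsum s.
Proof. by apply: sumr_ge0 => c _; rewrite exprn_ge0. Qed.

Lemma wsum_perm s s' : perm_eq s s' -> wsum s = wsum s'.
Proof. by move=> ss; apply: perm_big; exact: perm_permutations. Qed.

Lemma wsum_nil : wsum [::] = 1.
Proof.
have e : permutations ([::] : seq nat) = [:: [::]] by [].
by rewrite /wsum e big_seq1.
Qed.

Lemma wsum_rec s : (0 < size s)%N -> all (fun y => 1 <= y <= 3)%N s ->
  wsum s = \sum_(a <- [:: 1; 2; 3]%N | a \in s)
     x ^+ count (fun y => y < a)%N s * wsum (rem a s).
Proof.
move=> s0 sA; rewrite /wsum (perm_big _ (permutationsE s0)) /= big_allpairs_dep /=.
have up : perm_eq (undup s) [seq a <- [:: 1; 2; 3]%N | a \in s].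
  apply: uniq_perm; rewrite ?undup_uniq ?filter_uniq// => a.
  rewrite mem_undup mem_filter; case: (boolP (a \in s)) => //= ins.
  by have := allP sA a ins; rewrite !inE; case: a {ins} => [|[|[|[|a]]]].
rewrite (perm_big _ up) big_filter; apply: eq_bigr => a ains.
rewrite big_distrr big_seq [RHS]big_seq /=; apply: eq_bigr => t.
rewrite mem_permutations => ta; rewrite exprD; congr (x ^+ _ * _).
by rewrite (permP ta) [RHS](permP (perm_to_rem ains)) /= ltnn add0n.
Qed.

Definition word (a e b : nat) := nseq a 1%N ++ nseq e 2%N ++ nseq b 3%N.

Lemma word_all a e b : all (fun y => 1 <= y <= 3)%N (word a e b).
Proof. by rewrite !all_cat !all_nseq !orbT. Qed.

Lemma mem_word1 a e b : (1%N \in word a e b) = (0 < a)%N.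
Proof. by rewrite /word !mem_cat !mem_nseq !andbF !orbF andbT. Qed.
Lemma mem_word2 a e b : (2%N \in word a e b) = (0 < e)%N.
Proof. by rewrite /word !mem_cat !mem_nseq !andbF !orbF andbT. Qed.
Lemma mem_word3 a e b : (3%N \in word a e b) = (0 < b)%N.
Proof. by rewrite /word !mem_cat !mem_nseq !andbF andbT. Qed.

Lemma rem_word1 a e b : perm_eq (rem 1%N (word a.+1 e b)) (word a e b).
Proof. by []. Qed.
Lemma rem_word2 a e b : perm_eq (rem 2%N (word a e.+1 b)) (word a e b).
Proof.
have H : 2%N \in word a e.+1 b by rewrite mem_word2.
rewrite -(perm_cons 2%N) -(permPl (perm_to_rem H)) perm_sym.
by rewrite /word -[2%N :: _]cat1s perm_catCA.
Qed.
Lemma rem_word3 a e b : perm_eq (rem 3%N (word a e b.+1)) (word a e b).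
Proof.
have H : 3%N \in word a e b.+1 by rewrite mem_word3.
rewrite -(perm_cons 3%N) -(permPl (perm_to_rem H)) perm_sym.
by rewrite /word -[3%N :: _]cat1s perm_catCA perm_cat2l perm_catCA.
Qed.

Lemma count_word1 a e b : count (fun y => y < 1)%N (word a e b) = 0%N.
Proof. by rewrite !count_cat !count_nseq. Qed.
Lemma count_word2 a e b : count (fun y => y < 2)%N (word a e b) = a.
Proof. by rewrite !count_cat !count_nseq /= mul1n !mul0n !addn0. Qed.
Lemma count_word3 a e b : count (fun y => y < 3)%N (word a e b) = (a + e)%N.
Proof. by rewrite !count_cat !count_nseq /= !mul1n !mul0n !addn0. Qed.

Lemma wsum_word a e b : (0 < a + e + b)%N -> wsum (word a e b) =
  (if (0 < a)%N then wsum (word a.-1 e b) else 0)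
  + (if (0 < e)%N then x ^+ a * wsum (word a e.-1 b) else 0)
  + (if (0 < b)%N then x ^+ (a + e) * wsum (word a e b.-1) else 0).
Proof.
move=> s0; rewrite wsum_rec ?word_all//; last by rewrite !size_cat !size_nseq addnA.
rewrite !big_cons big_nil mem_word1 mem_word2 mem_word3 count_word1 count_word2 count_word3.
rewrite expr0 mul1r -addrA.
have E1 : (0 < a)%N -> wsum (rem 1%N (word a e b)) = wsum (word a.-1 e b).
  by case: a s0 => // a _ _; apply: wsum_perm; exact: rem_word1.
have E2 : (0 < e)%N -> wsum (rem 2%N (word a e b)) = wsum (word a e.-1 b).
  by case: e s0 E1 => // e _ _ _; apply: wsum_perm; exact: rem_word2.
have E3 : (0 < b)%N -> wsum (rem 3%N (word a e b)) = wsum (word a e b.-1).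
  by case: b s0 E1 E2 => // b _ _ _ _; apply: wsum_perm; exact: rem_word3.
case: ifP => [/E1 ->|_]; case: ifP => [/E2 ->|_]; case: ifP => [/E3 ->|_];
  by rewrite ?addr0 ?add0r.
Qed.

(** The generating function of the partitions with at most [a] parts, which is the limit of the
    Gaussian binomials [wsum (word a 0 b)] as [b] grows. *)
Definition Dx (a : nat) : R := \prod_(i < a) (1 - x ^+ i.+1)^-1.

Let xi_gt0 i : 0 < 1 - x ^+ i.+1.
Proof. by rewrite subr_gt0 exprn_ilt1. Qed.

Lemma DxS a : (1 - x ^+ a.+1) * Dx a.+1 = Dx a.
Proof. by rewrite /Dx big_ord_recr /= mulrC divfK// gt_eqF. Qed.

Lemma Dx_ge1 a : 1 <= Dx a.
Proof.
rewrite /Dx; elim/big_ind: _ => // [u v u1 v1|i _]; first exact: mulr_ege1.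
by rewrite invf_ge1// gerBl exprn_ge0.
Qed.

Lemma geom_le n : \sum_(i < n) x ^+ i <= (1 - x)^-1.
Proof.
have x1' : 0 < 1 - x by rewrite subr_gt0.
rewrite -[leRHS]mul1r ler_pdivlMr// mulrC -[X in X * _]opprB mulNr -subrX1 opprB.
by rewrite gerBl exprn_ge0.
Qed.

Definition Dinf : R := expR ((1 - x)^-1 * (1 - x)^-1).

Lemma Dx_le a : Dx a <= Dinf.
Proof.
have x1' : 0 < 1 - x by rewrite subr_gt0.
apply: (@le_trans _ _ (expR (\sum_(i < a) x ^+ i * (1 - x)^-1))).
  rewrite expR_sum /Dx; apply: ler_prod => i _.
  rewrite invr_ge0 (ltW (xi_gt0 i)) /=.
  have h : (1 - x ^+ i.+1)^-1 = 1 + x ^+ i.+1 / (1 - x ^+ i.+1).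
    by have := xi_gt0 i; set u := x ^+ _ => u0; field; rewrite gt_eqF.
  rewrite h; apply: le_trans (expR_ge1Dx _) _; rewrite ler_expR.
  apply: ler_pM; rewrite ?exprn_ge0 ?invr_ge0 ?(ltW (xi_gt0 i))//.
    by rewrite exprS ler_piMl ?exprn_ge0// ltW.
  rewrite lef_pV2 ?posrE// lerD2l lerN2 exprS ler_piMr// exprn_ile1// ltW//.
rewrite -big_distrl /= ler_expR ler_wpM2r ?geom_le// invr_ge0 ltW//.
Qed.

Lemma wsum_bin a b : wsum (word a 0 b) <= Dx a.
Proof.
have [n] := ubnP (a + b); elim: n a b => // n IH a b; rewrite ltnS => abn.
case: (posnP (a + b)) => ab0.
  have [-> ->] : a = 0%N /\ b = 0%N by lia.
  by rewrite /word /= wsum_nil Dx_ge1.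
rewrite wsum_word ?addn0//= addr0.
case: a abn ab0 => [|a] abn ab0.
  case: b abn ab0 => // b abn _ /=; rewrite add0r mul1r.
  by apply: IH; lia.
rewrite [in leLHS]/=.
apply: (@le_trans _ _ ((1 - x ^+ a.+1) * Dx a.+1 + x ^+ a.+1 * Dx a.+1)); last by rewrite -mulrDl subrK mul1r.
rewrite {1}DxS; apply: lerD; first by apply: IH; lia.
case: ifP => b0; last by rewrite mulr_ge0 ?exprn_ge0 ?(le_trans ler01 (Dx_ge1 _)).
by rewrite ler_wpM2l ?exprn_ge0// IH//; lia.
Qed.

(** A supersolution, free of [b], of the recursion [wsum_word] with one letter 2:
    [(1 - x ^+ a.+1) * Tx a] equals the preceding term plus [x ^+ a * Dx a * Dinf], where the extra
    [Dinf >= 1] is harmless. *)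
Definition Tx (a : nat) : R := Dx a.+1 * (1 + Dinf * \sum_(i < a.+1) x ^+ i).

Lemma Tx_ge0 a : 0 <= Tx a.
Proof.
rewrite /Tx mulr_ge0 ?(le_trans ler01 (Dx_ge1 _))// addr_ge0// mulr_ge0 ?expR_ge0//.
by apply: sumr_ge0 => i _; rewrite exprn_ge0.
Qed.

Lemma wsum_one a b : wsum (word a 1 b) <= Tx a.
Proof.
have D1 : 1 <= Dinf by apply: le_trans (Dx_ge1 0) (Dx_le 0).
have [n] := ubnP (a + b); elim: n a b => // n IH a b; rewrite ltnS => abn.
rewrite wsum_word ?addn1//=.
have e3 : (if (0 < b)%N then x ^+ a.+1 * wsum (word a 1 b.-1) else 0) <= x ^+ a.+1 * Tx a.
  case: ifP => b0; last by rewrite mulr_ge0 ?exprn_ge0 ?Tx_ge0.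
  by rewrite ler_wpM2l ?exprn_ge0// IH//; lia.
apply: (@le_trans _ _ ((1 - x ^+ a.+1) * Tx a + x ^+ a.+1 * Tx a)); last by rewrite -mulrDl subrK mul1r.
apply: lerD => //.
have E : (1 - x ^+ a.+1) * Tx a = Dx a * (1 + Dinf * \sum_(i < a) x ^+ i) + x ^+ a * (Dx a * Dinf).
  by rewrite /Tx [LHS]mulrA DxS big_ord_recr /=; ring.
rewrite E; apply: lerD.
  clear E; case: a abn e3 => [|a] abn e3 /=.
    by rewrite big_ord0 mulr0 addr0 mulr1 (le_trans ler01 (Dx_ge1 _)).
  by apply: IH; lia.
rewrite ler_wpM2l ?exprn_ge0// (le_trans (wsum_bin _ _))// ler_peMr//.
by rewrite (le_trans ler01 (Dx_ge1 _)).
Qed.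

Definition Zmax : R := Dinf * (1 + Dinf * (1 - x)^-1).

Lemma Zk_le k : wsum (gs k) <= Zmax.
Proof.
apply: le_trans (wsum_one k k) _; rewrite /Tx /Zmax.
apply: ler_pM; rewrite ?(le_trans ler01 (Dx_ge1 _)) ?Dx_le//.
  by rewrite addr_ge0// mulr_ge0 ?expR_ge0// sumr_ge0// => i _; rewrite exprn_ge0.
by rewrite lerD2l ler_wpM2l ?expR_ge0// geom_le.
Qed.

Lemma sum_image_le (T T' : eqType) (s : seq T) (s' : seq T') (f : T -> T') (F : T' -> R) :
  uniq s -> uniq s' -> injective f -> (forall c, c \in s -> f c \in s') ->
  (forall c, 0 <= F c) -> \sum_(c <- s) F (f c) <= \sum_(c <- s') F c.
Proof.
move=> us us' fi fs F0; rewrite (bigID (fun c => c \in [seq f i | i <- s])) /=.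
rewrite -[leLHS]addr0; apply: lerD; last by apply: sumr_ge0.
rewrite le_eqVlt; apply/orP; left; apply/eqP.
rewrite -[LHS](big_map f predT F) -[RHS]big_filter.
apply: perm_big; apply: uniq_perm; rewrite ?filter_uniq ?map_inj_uniq// => c.
rewrite mem_filter; case: (boolP (c \in _)) => //= /mapP[d ds ->].
by rewrite fs.
Qed.

Lemma invw_rcons c : all (fun y => 1 <= y <= 3)%N c -> invw (rcons c 3%N) = invw c.
Proof.
elim: c => //= y l IH /andP[y3 lA]; rewrite IH// -cats1 count_cat /=.
have -> : (3 < y)%N = false by lia.
by rewrite !addn0.
Qed.

Lemma embed_gs k c : perm_eq c (gs k) -> perm_eq (1%N :: rcons c 3%N) (gs k.+1).
Proof.
move=> cg; rewrite /gs /= perm_cons perm_rcons.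
have -> : nseq k 1%N ++ [:: 2%N, 3%N & nseq k 3%N] = (nseq k 1%N ++ [:: 2%N]) ++ [:: 3%N] ++ nseq k 3%N.
  by rewrite -catA.
rewrite perm_sym perm_catCA /= perm_cons -catA perm_sym.
exact: cg.
Qed.

(** A 1 in front and a 3 at the end create no inversion, so the words of one length embed, with
    their weights, in those of the next. *)
Lemma wsum_mono (phi : nat -> seq nat -> R) : (forall k c, 0 <= phi k c) ->
  (forall k c, perm_eq c (gs k) -> phi k.+1 (1%N :: rcons c 3%N) = phi k c) ->
  forall k, \sum_(c <- permutations (gs k)) x ^+ invw c * phi k c <=
   \sum_(c <- permutations (gs k.+1)) x ^+ invw c * phi k.+1 c.
Proof.
move=> p0 pE k.
rewrite (eq_big_seq (fun c => x ^+ invw (1%N :: rcons c 3%N) * phi k.+1 (1%N :: rcons c 3%N))).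
  apply: (@sum_image_le _ _ _ _ (fun c => 1%N :: rcons c 3%N) (fun c => x ^+ invw c * phi k.+1 c));
    rewrite ?permutations_uniq//.
  - by move=> c d /= [] /rcons_inj[].
  - by move=> c; rewrite !mem_permutations; exact: embed_gs.
  - by move=> c; rewrite mulr_ge0 ?exprn_ge0.
move=> c; rewrite mem_permutations => cg; rewrite pE//; congr (x ^+ _ * _).
rewrite [in RHS]/= invw_rcons ?(gs_all cg)//.
rewrite [X in (X + _)%N](_ : _ = 0%N) ?add0n//; apply/eqP; rewrite -leqn0 leqNgt -has_count.
apply/hasPn => y; rewrite mem_rcons inE => /orP[/eqP -> //|/(allP (gs_all cg))].
by case: y.
Qed.

End Weights.

(** * Stationarity and loss of variance at one pair of letters *)

Section Stationary.
Context {R : realType}.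
Variables (tau p q : R).
Hypotheses (pq : p + q = 1) (qE : q = tau * p).

(** Heat bath: an adjacent pair is sorted with probability [p] and antisorted
    with probability [q], which is stationary for the weight [tau ^ inversions]. *)
Lemma heat_bath k w (F : seq nat -> R) : (w.+1 < (k + k).+1)%N ->
  \sum_(c <- permutations (gs k)) tau ^+ invw c * (p * F (wmove (w, true) c) + q * F (wmove (w, false) c))
  = \sum_(c <- permutations (gs k)) tau ^+ invw c * F c.
Proof.
move=> wk; set P := permutations (gs k).
have sP : perm_eq [seq swp w c | c <- P] P.
  apply: uniq_perm; rewrite ?permutations_uniq//.
    by rewrite map_inj_uniq ?permutations_uniq//; exact: can_inj (swpK w).
  move=> c; rewrite mem_permutations; apply/mapP/idP => [[d]|cg].
    by rewrite mem_permutations => dg ->; rewrite (permPl (perm_swp _ _)).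
  by exists (swp w c); rewrite ?swpK// mem_permutations (permPl (perm_swp _ _)).
have dbl G : \sum_(c <- P) G c + \sum_(c <- P) G c = \sum_(c <- P) (G c + G (swp w c)) :> R.
  by rewrite big_split /=; congr (_ + _); rewrite -(perm_big _ sP) big_map.
have inj2 (u v : R) : u + u = v + v -> u = v.
  by move=> uv; apply: (@mulIf _ 2); rewrite ?pnatr_eq0// !mulr_natr !mulr2n.
apply: inj2; rewrite !dbl; apply: eq_big_seq => c; rewrite mem_permutations => cg.
have wc : (w.+1 < size c)%N by rewrite (gs_size cg).
rewrite /wmove /= !nth_swp// !eqxx (gtn_eqF (ltnSn w)).
have p1 : p = 1 - tau * p by rewrite -qE -pq addrK.
case: (ltngtP (nth 0%N c w) (nth 0%N c w.+1)) => h.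
- rewrite invw_swp// exprS swpK; set t := tau ^+ _; set f := F c; set g := F (swp w c).
  have -> : t * (p * f + q * g) + tau * t * (p * f + q * g) = (p + tau * p) * (t * f) + (q + tau * q) * t * g by ring.
  rewrite -qE pq mul1r; congr (_ + _).
  have -> : q + tau * q = tau * (p + q) by rewrite mulrDr -qE.
  by rewrite pq mulr1.
- have ei := invw_swp_gt wc h; rewrite -ei exprS swpK; set t := tau ^+ _; set f := F c; set g := F (swp w c).
  have -> : tau * t * (p * g + q * f) + t * (p * g + q * f) = (p + tau * p) * (t * g) + (q + tau * q) * t * f by ring.
  rewrite -qE pq mul1r [RHS]addrC; congr (_ + _).
  have -> : q + tau * q = tau * (p + q) by rewrite mulrDr -qE.
  by rewrite pq mulr1.
- by rewrite (swp_eq wc h) -!mulrDl pq mul1r.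
Qed.

(** A two-point law of masses [p] and [q] has variance [p * q] times the squared gap; the remaining
    part is stationarity. *)
Lemma heat_bath_sqr k w (F : seq nat -> R) : (w.+1 < (k + k).+1)%N ->
  \sum_(c <- permutations (gs k)) tau ^+ invw c * (p * F (wmove (w, true) c) + q * F (wmove (w, false) c)) ^+ 2
  = \sum_(c <- permutations (gs k)) tau ^+ invw c * F c ^+ 2
  - p * q * \sum_(c <- permutations (gs k)) tau ^+ invw c * (F (wmove (w, true) c) - F (wmove (w, false) c)) ^+ 2.
Proof.
move=> wk; rewrite -(heat_bath (fun c => F c ^+ 2) wk) big_distrr -sumrB /=.
apply: eq_bigr => c _; have -> : p = 1 - q by rewrite -pq addrK.
ring.
Qed.

End Stationary.

(** * Relaxation of the word in its environment *)

(** The heights of the particles of class 4 and of those of class at least 1. *)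
Definition env := ((int -> int) * (int -> int))%type.

(** The number of middle letters strictly to the right of [z]. *)
Definition mid (e : env) (z : int) : int := e.2 z - e.1 z.

(** Both sites of the bond carry letters of the word. *)
Definition openb (e : env) (b : int) : bool := mid e (b - 1) - mid e (b + 1) == 2.

(** The place in the word, counted from 0, of the letter at site [b]: [mid e (b - 1)] letters sit at
    [b] or to its right. *)
Definition widx (k : nat) (e : env) (b : int) : nat := absz ((k + k).+1%:Z - mid e (b - 1)).

Definition eact (c : int * bool) (e : env) : env := (hmove c e.1, hmove c e.2).

Definition fact (k : nat) (c : int * bool) (x : env * seq nat) : env * seq nat :=
  (eact c x.1, if openb x.1 c.1 then wmove (widx k x.1 c.1, c.2) x.2 else x.2).

(** The summand [0] gives both inequalities the shape of [hmove_mono]. *)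
Definition einv (k : nat) (e : env) :=
  [/\ adm e.1, adm e.2, forall z, e.1 z <= 0%:Z + e.2 z & forall z, e.2 z <= (k + k).+1%:Z + e.1 z].

Lemma einv_eact k c e : einv k e -> einv k (eact c e).
Proof.
move=> [a1 a2 h1 h2]; split; [exact: hmove_adm|exact: hmove_adm| |]; exact: hmove_mono.
Qed.

Lemma open_range k e b : einv k e -> openb e b ->
  [/\ e.1 (b - 1) = e.1 (b + 1), e.2 (b - 1) = e.2 (b + 1) + 2 & ((widx k e b).+1 < (k + k).+1)%N].
Proof.
move=> [a1 a2 h1 h2]; rewrite /openb /widx /mid => /eqP ob.
have := a1 b; have := a2 b; have := a1 (b + 1); have := a2 (b + 1); rewrite !addrK.
have := h1 (b + 1); have := h2 (b - 1).
move: (e.1 (b - 1)) (e.1 b) (e.1 (b + 1)) (e.2 (b - 1)) (e.2 b) (e.2 (b + 1)) ob.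
clear => u0 u1 u2 v0 v1 v2 *; split; lia.
Qed.

(** At an open bond the environment sees two equal contents, so a ring moves either the letters or
    the environment, never both. *)
Lemma eact_open k e b d : einv k e -> openb e b -> eact (b, d) e = e.
Proof.
move=> ie ob; have [e1 e2 _] := open_range ie ob; have [a1 a2 _ _] := ie.
have hb (H : int -> int) : adm H -> H (b - 1) = H (b + 1) \/ H (b - 1) = H (b + 1) + 2 -> hmove (b, d) H = H.
  move=> aH Hb; apply/funext => z; rewrite /hmove /=; case: eqP => // ->.
  have := aH b; have := aH (b + 1); rewrite addrK.
  move: (H (b - 1)) (H b) (H (b + 1)) Hb; clear => u0 u1 u2 *; case: d; lia.
rewrite /eact !hb//; [by case: e {ie ob e1 e2 a1 a2}|by right|by left].
Qed.

Lemma mul_le_sqrD (R : realType) (z dl : R) : z * dl <= dl * dl + z ^+ 2.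
Proof. have := sqr_ge0 (z - dl); rewrite !expr2; nra. Qed.

Section Mixing.
Context {R : realType}.
Variables (p q h tau : R) (k : nat) (bs : seq int).
Hypotheses (p0 : 0 <= p) (q0 : 0 <= q) (pq : p + q = 1) (h0 : 0 <= h)
  (hL : h * (size bs)%:R <= 1) (tau0 : 0 <= tau < 1) (qE : q = tau * p).

Notation P := (permutations (gs k)).
Notation wt c := (tau ^+ invw c).
Notation xst := (env * seq nat)%type.

(** Integration over the word against the unnormalized stationary weight, with the environment kept
    fixed. *)
Definition avg (F : xst -> R) (e : env) : R := \sum_(c <- P) wt c * F (e, c).

Let wt0 (c : seq nat) : 0 <= wt c.
Proof. by rewrite exprn_ge0//; case/andP: tau0. Qed.

(** An open bond is a heat bath; a closed one moves the environment alone and leaves the word as a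
    spectator. Hence the stationarity of the weight whatever the environment does. *)
Lemma avg_bond F e b : einv k e ->
  \sum_(c <- P) wt c * (p * F (fact k (b, true) (e, c)) + q * F (fact k (b, false) (e, c)))
  = p * avg F (eact (b, true) e) + q * avg F (eact (b, false) e).
Proof.
move=> ie; rewrite /fact /=; case: (boolP (openb e b)) => ob; last first.
  rewrite /avg !big_distrr -big_split /=; apply: eq_bigr => c _; ring.
have [_ _ w1] := open_range ie ob; rewrite !(eact_open _ ie ob) -mulrDl pq mul1r.
exact: (heat_bath pq qE (fun c => F (e, c)) w1).
Qed.

Lemma avg_stp F e : einv k e -> avg (stp p q h bs (fact k) F) e = stp p q h bs eact (avg F) e.
Proof.
move=> ie; rewrite (stpE h bs pq) /avg.
rewrite (eq_bigr (fun c => (1 - h * (size bs)%:R) * (wt c * F (e, c)) +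
  h * \sum_(b <- bs) wt c * (p * F (fact k (b, true) (e, c)) + q * F (fact k (b, false) (e, c))))); last first.
  by move=> c _; rewrite (stpE h bs pq) -big_distrr /=; ring.
rewrite big_split -!big_distrr /=; congr (_ + _ * _).
by rewrite exchange_big /=; apply: eq_bigr => b _; exact: avg_bond.
Qed.

Let einvP (c : int * bool) e : c.1 \in bs -> einv k e -> einv k (eact c e).
Proof. by move=> _; exact: einv_eact. Qed.

Lemma avg_Ex j F e : einv k e -> avg (Ex p q h bs (fact k) j F) e = Ex p q h bs eact j (avg F) e.
Proof.
elim: j e => // j IH e ie; rewrite !ExS avg_stp//.
by apply: (Ex_eq_in p0 q0 pq h0 hL einvP 1).
Qed.

(** The Dirichlet form of the word, restricted to the bonds that the environment currently leaves
    open. *)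
Definition diss (F : xst -> R) (e : env) : R :=
  p * q * \sum_(b <- bs | openb e b) \sum_(c <- P)
    wt c * (F (e, wmove (widx k e b, true) c) - F (e, wmove (widx k e b, false) c)) ^+ 2.

Lemma diss_ge0 F e : 0 <= diss F e.
Proof.
rewrite /diss mulr_ge0// ?mulr_ge0//; apply: sumr_ge0 => b _; apply: sumr_ge0 => c _.
by apply: mulr_ge0 => //; exact: sqr_ge0.
Qed.

Lemma jensen_sum (u a : R) (g : int -> R) : 0 <= u -> u + h * (size bs)%:R = 1 ->
  (u * a + h * \sum_(b <- bs) g b) ^+ 2 <= u * a ^+ 2 + h * \sum_(b <- bs) g b ^+ 2.
Proof.
move=> u0 u1; set m := u * a + _.
have : 0 <= u * (a - m) ^+ 2 + h * \sum_(b <- bs) (g b - m) ^+ 2.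
  apply: addr_ge0; apply: mulr_ge0 => //; first exact: sqr_ge0.
  by apply: sumr_ge0 => b _; exact: sqr_ge0.
have -> : \sum_(b <- bs) (g b - m) ^+ 2 = \sum_(b <- bs) g b ^+ 2 - 2 * m * \sum_(b <- bs) g b + (size bs)%:R * m ^+ 2.
  rewrite big_distrr -sumrB /=.
  have -> : (size bs)%:R * m ^+ 2 = \sum_(b <- bs) m ^+ 2.
    by rewrite big_const_seq count_predT iter_addr_0 mulr_natl.
  rewrite -big_split /=; apply: eq_bigr => b _; ring.
set S2 := \sum_(b <- bs) _; set S := \sum_(b <- bs) _ in m *.
have -> : u * (a - m) ^+ 2 + h * (S2 - 2 * m * S + (size bs)%:R * m ^+ 2) =
  (u * a ^+ 2 + h * S2) - 2 * m * (u * a + h * S) + (u + h * (size bs)%:R) * m ^+ 2 by ring.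
rewrite u1 -/m => h1; rewrite -subr_ge0; apply: le_trans h1 _.
rewrite le_eqVlt; apply/orP; left; apply/eqP; ring.
Qed.

(** Loss of square norm in one step: exact at open bonds by [heat_bath_sqr], mere convexity at
    closed bonds and in the choice of the bond. *)
Lemma avg_sqr_stp F e : einv k e ->
  avg (fun x => stp p q h bs (fact k) F x ^+ 2) e + h * diss F e <=
  stp p q h bs eact (avg (fun x => F x ^+ 2)) e.
Proof.
move=> ie; set u := 1 - h * (size bs)%:R.
have u0 : 0 <= u by rewrite subr_ge0.
pose G b c := p * F (fact k (b, true) (e, c)) + q * F (fact k (b, false) (e, c)).
apply: (@le_trans _ _ (\sum_(c <- P) wt c * (u * F (e, c) ^+ 2 + h * \sum_(b <- bs) G b c ^+ 2) + h * diss F e)).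
  rewrite lerD2r; apply: ler_sum => c _; rewrite ler_wpM2l// (stpE h bs pq).
  by apply: jensen_sum => //; rewrite subrK.
rewrite (stpE h bs pq) -/u.
rewrite (eq_bigr (fun c => u * (wt c * F (e, c) ^+ 2) + h * \sum_(b <- bs) wt c * G b c ^+ 2)); last first.
  by move=> c _; rewrite -big_distrr /=; ring.
rewrite big_split -!big_distrr /= -addrA lerD2l -mulrDr ler_wpM2l// exchange_big /=.
rewrite /diss big_distrr /= [X in _ + X]big_mkcond -big_split /=; apply: ler_sum => b _.
rewrite /G /fact /=; case: (boolP (openb e b)) => ob.
  have [_ _ w1] := open_range ie ob; rewrite !(eact_open _ ie ob) -mulrDl pq mul1r.
  by rewrite (heat_bath_sqr pq qE (fun c => F (e, c)) w1) subrK.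
rewrite addr0 /avg !big_distrr -big_split /=; apply: ler_sum => c _.
set f1 := F _; set f2 := F _.
have -> : p * (wt c * f1 ^+ 2) + q * (wt c * f2 ^+ 2) = wt c * (p * f1 ^+ 2 + q * f2 ^+ 2) by ring.
rewrite ler_wpM2l// -subr_ge0.
have -> : p * f1 ^+ 2 + q * f2 ^+ 2 - (p * f1 + q * f2) ^+ 2 = p * q * (f1 - f2) ^+ 2.
  by have -> : p = 1 - q; [rewrite -pq addrK | ring].
by apply: mulr_ge0; [exact: mulr_ge0 | exact: sqr_ge0].
Qed.

(** Energy balance over [m] steps: the mean square of [F] bounds the sum of the dissipations of its
    backward evolutions. *)
Lemma dissipation J m F e : einv k e ->
  Ex p q h bs eact J (avg (fun x => Ex p q h bs (fact k) m F x ^+ 2)) e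
  + h * \sum_(i < m) Ex p q h bs eact (J + i) (diss (Ex p q h bs (fact k) (m.-1 - i) F)) e
  <= Ex p q h bs eact (J + m) (avg (fun x => F x ^+ 2)) e.
Proof.
move=> ie; elim: m J => [|m IH] J; first by rewrite big_ord0 mulr0 addr0 addn0.
rewrite big_ord_recl /= subn0 addn0 mulrDr addrA addnS -addSn.
apply: le_trans (IH J.+1); apply: lerD.
  have := @Ex_lin R p q h bs _ eact J 1 h (avg (fun x => Ex p q h bs (fact k) m.+1 F x ^+ 2)) (diss (Ex p q h bs (fact k) m F)).
  move=> /(congr1 (@^~ e)) /=; rewrite mul1r => <-.
  rewrite -(ExS p q h bs eact J) (@ExSr R p q h bs _ eact J); apply: (Ex_le_in p0 q0 pq h0 hL einvP) => // e' ie'.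
  by rewrite mul1r; exact: avg_sqr_stp.
apply: ler_wpM2l => //; apply: ler_sum => i _; rewrite /bump leq0n add1n addnS -addSn.
by rewrite (_ : (m - i.+1)%N = (m.-1 - i)%N)//; case: (m) i => // m' i.
Qed.

(** The exchanges within [I] places of [k] are all available; by [gs_right1] and [gs_left] they
    suffice to sort any word with at most [I] inversions. *)
Definition free (I : nat) (e : env) : Prop :=
  forall w : nat, (k <= w + I)%N -> (w <= k + I)%N ->
  exists b, [/\ b \in bs, openb e b & widx k e b = w].

(** The word is sorted by exchanging descents, one inversion at a time. A gradient [y] is charged
    [dl + y ^ 2 / dl], and [y ^ 2] occurs in [diss] with weight at least [tau ^+ I]. *)
Lemma free_path I e F c (dl : R) : 0 < tau -> 0 < q -> 0 < dl -> free I e -> perm_eq c (gs k) -> (invw c <= I)%N ->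
  `|F (e, c) - F (e, gs k)| <= (invw c)%:R * (dl + diss F e / (dl * (p * q * tau ^+ I))).
Proof.
move=> t0 q1 d0 fI; have p1 : 0 < p by rewrite lt_neqAle p0 andbT; apply: contraTN q1 => /eqP p00; rewrite qE -p00 mulr0 ltxx.
move En : (invw c) => n; elim: n c En => [|n IH] c ic cg cI.
  by rewrite (gs_inv0 cg ic) subrr normr0 mul0r.
have [w wc wd] : exists2 w, (w.+1 < size c)%N & (nth 0 c w.+1 < nth 0 c w)%N.
  by apply: invw_desc; rewrite ic.
have ic' : invw (swp w c) = n by have := invw_swp_gt wc wd; rewrite ic => -[].
have cg' : perm_eq (swp w c) (gs k) by rewrite (permPl (perm_swp _ _)).
have {}IH := IH _ ic' cg' (ltnW cI).
have cA := allP (gs_all cg).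
have w1 : (0 < nth 0 c w.+1 <= 3)%N by apply: cA; exact: mem_nth.
have w2 : (0 < nth 0 c w <= 3)%N by apply: cA; apply: mem_nth; exact: ltnW.
have kw : (k <= w + I)%N.
  apply: leq_trans (gs_right1 cg (ltnW wc) _) _.
    by apply: leq_ltn_trans wd; case/andP: w1.
  by rewrite leq_add2l ic.
have wk : (w <= k + I)%N.
  have := gs_left cg wc; rewrite ic => h1.
  have h2 : (nth 0 c w.+1 < 3)%N by apply: leq_trans wd _; case/andP: w2.
  by have := h1 h2; clear -cI; lia.
have [b [bb ob wE]] := fI w kw wk.
have key : (F (e, c) - F (e, swp w c)) ^+ 2 * (p * q * tau ^+ I) <= diss F e.
  rewrite /diss [leLHS](_ : _ = p * q * (tau ^+ I * (F (e, c) - F (e, swp w c)) ^+ 2)); last by ring.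
  apply: ler_wpM2l; first exact: mulr_ge0.
  rewrite (big_rem b bb) /= ob -[leLHS]addr0; apply: lerD; last first.
    apply: sumr_ge0 => b' _; apply: sumr_ge0 => c' _.
    by apply: mulr_ge0 => //; exact: sqr_ge0.
  have cP : c \in P by rewrite mem_permutations.
  rewrite (big_rem c cP) /= -[leLHS]addr0; apply: lerD; last first.
    by apply: sumr_ge0 => c' _; apply: mulr_ge0 => //; exact: sqr_ge0.
  rewrite wE /wmove /= wd ltnNge (ltnW wd) /= -[X in _ <= _ * X]sqrrN opprB.
  apply: ler_wpM2r; first exact: sqr_ge0.
  by case/andP: tau0 => t0' t1'; rewrite ler_wiXn2l ?ic// ltW.
set K := dl + _ in IH *.
have -> : F (e, c) - F (e, gs k) = (F (e, c) - F (e, swp w c)) + (F (e, swp w c) - F (e, gs k)) by ring.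
apply: le_trans (ler_normD _ _) _; rewrite -natr1 mulrDl mul1r addrC; apply: lerD => //.
have ppos : 0 < p * q * tau ^+ I by rewrite !mulr_gt0// exprn_gt0.
have {}key : (F (e, c) - F (e, swp w c)) ^+ 2 / dl <= diss F e / (dl * (p * q * tau ^+ I)).
  rewrite ler_pdivrMr// invfM mulrA mulrAC divfK ?gt_eqF//.
  by rewrite ler_pdivlMr.
rewrite /K; apply: le_trans (lerD (lexx dl) key); set y := F (e, c) - _.
rewrite -(ler_pM2r d0) mulrDl divfK ?gt_eqF// -real_normK ?num_real//.
exact: mul_le_sqrD.
Qed.

Lemma Ex_01 (T : Type) (act : int * bool -> T -> T) j (F : T -> R) x :
  (forall x, 0 <= F x <= 1) -> 0 <= Ex p q h bs act j F x <= 1.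
Proof.
move=> F01; apply/andP; split.
  by apply: (Ex_ge0 p0 q0 pq h0 hL) => y; case/andP: (F01 y).
rewrite -[leRHS](congr1 (@^~ x) (@Ex_cst R p q h bs _ act j 1)).
by apply: (Ex_le p0 q0 pq h0 hL) => y; case/andP: (F01 y).
Qed.

Lemma stp_near (T : Type) (act : int * bool -> T -> T) (F : T -> R) x :
  (forall x, 0 <= F x <= 1) -> `|stp p q h bs act F x - F x| <= h * (size bs)%:R.
Proof.
move=> F01; rewrite /stp addrAC subrr add0r normrM ger0_norm// ler_wpM2l//.
rewrite /gen; apply: le_trans (ler_norm_sum _ _ _) _.
apply: (@le_trans _ _ (\sum_(b <- bs) 1)); last by rewrite big_const_seq count_predT iter_addr_0.
apply: ler_sum => b _; rewrite -[leRHS]pq.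
have h1 y : `|F y - F x| <= 1.
  case/andP: (F01 y) => *; case/andP: (F01 x) => *; rewrite ler_norml; apply/andP; split.
    by rewrite lerBrDr (@le_trans _ _ 0)// addrC subr_le0.
  by rewrite lerBlDr (@le_trans _ _ 1)// lerDl.
apply: le_trans (ler_normD _ _) _; rewrite !normrM (ger0_norm p0) (ger0_norm q0).
by apply: lerD; rewrite ler_piMr.
Qed.

Notation Z := (wsum tau (gs k)).

Definition ztail (I : nat) : R := \sum_(c <- P | (I < invw c)%N) wt c.

Lemma avg_free I e F (dl : R) : 0 < dl -> (forall x, 0 <= F x <= 1) -> free I e ->
  avg (fun x => `|F x - F (x.1, gs k)|) e <=
  Z * (I%:R * (dl + diss F e / (dl * (p * q * tau ^+ I)))) + ztail I.
Proof.
move=> d0 F01 fI; have t0 : 0 <= tau by case/andP: tau0.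
set K := I%:R * _.
have K0 : 0 <= K.
  rewrite /K mulr_ge0// addr_ge0 ?(ltW d0)// divr_ge0 ?diss_ge0//.
  by rewrite mulr_ge0 ?(ltW d0)// mulr_ge0 ?exprn_ge0// mulr_ge0.
have N1 x : `|F x - F (x.1, gs k)| <= 1.
  case/andP: (F01 x) => *; case/andP: (F01 (x.1, gs k)) => *.
  rewrite ler_norml; apply/andP; split.
    by rewrite lerBrDr (@le_trans _ _ 0)// addrC subr_le0.
  by rewrite lerBlDr (@le_trans _ _ 1)// lerDl.
rewrite /avg /wsum /ztail mulr_suml [X in _ + X]big_mkcond -big_split /=.
rewrite big_seq [leRHS]big_seq; apply: ler_sum => c; rewrite mem_permutations => cg.
case: ltnP => cI.
  rewrite addrC -[leLHS]addr0; apply: lerD; last exact: mulr_ge0.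
  by rewrite ler_piMr.
(* For [tau = 0] the division by [tau ^+ I] may be void of meaning, but then only the sorted word
   has positive weight. *)
rewrite addr0; have [tz|tp] := eqVneq tau 0.
  have [i0|i1] := posnP (invw c).
    by rewrite (gs_inv0 cg i0) subrr normr0 mulr0 mulr_ge0.
  by rewrite tz expr0n eqn0Ngt i1 !mul0r.
have tpos : 0 < tau by rewrite lt_neqAle eq_sym tp.
have q1 : 0 < q.
  rewrite qE mulr_gt0// lt_neqAle p0 andbT; apply/eqP => p00.
  by move: pq; rewrite qE -p00 mulr0 addr0 => /eqP; rewrite eq_sym oner_eq0.
rewrite ler_wpM2l//; apply: le_trans (free_path F tpos q1 d0 fI cg cI) _.
rewrite /K ler_wpM2r ?ler_nat// addr_ge0 ?(ltW d0)// divr_ge0 ?diss_ge0//.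
by rewrite mulr_ge0 ?(ltW d0)// mulr_ge0 ?exprn_ge0// mulr_ge0.
Qed.

Lemma gsP : gs k \in P.
Proof. by rewrite mem_permutations. Qed.

Lemma Z_ge1 : 1 <= Z.
Proof.
rewrite /wsum (big_rem _ gsP) /= invw_gs expr0 lerDl.
by apply: sumr_ge0.
Qed.

(** The total dissipation is at most [Z], so at one of [m] times it is at most [Z / (h * m)]. The
    backward evolution is then nearly independent of the word, hence close to its value at the
    sorted word. Both the expectation from [gs k] and the stationary mean are compared with the
    resulting number [E], which involves the environment alone. *)
Theorem mixing (phi : seq nat -> R) e0 J m I (dl eta : R) :
  (forall c, 0 <= phi c <= 1) -> einv k e0 -> (0 < m)%N -> 0 < h -> 0 < dl ->
  (forall i, (i < m)%N -> Ex p q h bs eact (J + i) (fun e => (~~ `[< free I e >])%:R) e0 <= eta) ->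
  `|Ex p q h bs (fact k) (J + m) (fun x => phi x.2) (e0, gs k)
    - (\sum_(c <- P) wt c * phi c) / Z| <=
  2 * (h * (size bs)%:R) + 2 * (Z * (I%:R * (dl + Z / (h * m%:R) / (dl * (p * q * tau ^+ I)))) + ztail I + Z * eta).
Proof.
move=> phi01 ie m0 hpos d0 Hfree.
have Z1 := Z_ge1; have Z0 : 0 < Z := lt_le_trans ltr01 Z1.
pose Phi (x : xst) := phi x.2.
have Phi01 x : 0 <= Phi x <= 1 by exact: phi01.
pose Fi i := Ex p q h bs (fact k) (m.-1 - i) Phi.
have Fi01 i x : 0 <= Fi i x <= 1 by exact: Ex_01.
have [i im Hi] : exists2 i, (i < m)%N & Ex p q h bs eact (J + i) (diss (Fi i)) e0 <= Z / (h * m%:R).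
  apply: contrapT => nx.
  have lb i : (i < m)%N -> Z / (h * m%:R) < Ex p q h bs eact (J + i) (diss (Fi i)) e0.
    by move=> im; rewrite ltNge; apply/negP => le; apply: nx; exists i.
  have := dissipation J m Phi ie; apply/negP; rewrite -ltNge.
  have up : Ex p q h bs eact (J + m) (avg (fun x => Phi x ^+ 2)) e0 <= Z.
    rewrite -[leRHS](congr1 (@^~ e0) (@Ex_cst R p q h bs _ eact (J + m) Z)).
    apply: (Ex_le p0 q0 pq h0 hL) => e; rewrite /avg /wsum; apply: ler_sum => c _.
    rewrite ler_piMr// exprn_ile1//; by case/andP: (Phi01 (e, c)).
  apply: le_lt_trans up _.
  have av0 : 0 <= Ex p q h bs eact J (avg (fun x => Ex p q h bs (fact k) m Phi x ^+ 2)) e0.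
    apply: (Ex_ge0 p0 q0 pq h0 hL) => e; apply: sumr_ge0 => c _.
    by apply: mulr_ge0 => //; exact: sqr_ge0.
  rewrite -[ltLHS]add0r; apply: ler_ltD => //.
  have -> : Z = h * \sum_(i < m) Z / (h * m%:R).
    rewrite sumr_const card_ord -mulr_natr; field.
    by rewrite pnatr_eq0 -lt0n m0 /= gt_eqF.
  rewrite ltr_pM2l//; apply: ltr_sum => [|j _]; last exact: lb.
  by apply/hasP; exists (Ordinal m0) => //; rewrite mem_index_enum.
pose F := Fi i; pose J' := (J + i)%N.
have F01 x : 0 <= F x <= 1 by exact: Fi01.
(* One step lies between the time of small dissipation and [F]; [stp_near] charges [h * size bs] for
   it. *)
have JE : (J + m)%N = (J'.+1 + (m.-1 - i))%N by rewrite /J'; clear -im; lia.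
have ExE T (act : int * bool -> T -> T) G : Ex p q h bs act (J + m) G =
    Ex p q h bs act J' (stp p q h bs act (Ex p q h bs act (m.-1 - i) G)).
  by rewrite JE Ex_add ExSr.
set X := Ex p q h bs eact J' (avg (fun x => `|F x - F (x.1, gs k)|)) e0.
have XB : X <= Z * (I%:R * (dl + Z / (h * m%:R) / (dl * (p * q * tau ^+ I)))) + ztail I + Z * eta.
  pose a := Z * (I%:R * dl) + ztail I; pose b := Z * I%:R / (dl * (p * q * tau ^+ I)).
  have t0 : 0 <= tau by case/andP: tau0.
  have den0 : 0 <= dl * (p * q * tau ^+ I).
    by rewrite mulr_ge0 ?(ltW d0)// mulr_ge0 ?exprn_ge0// mulr_ge0.
  have b0 : 0 <= b by rewrite /b divr_ge0// mulr_ge0 ?(ltW Z0).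
  have a0 : 0 <= a.
    rewrite /a addr_ge0 ?mulr_ge0 ?(ltW Z0) ?(ltW d0)//.
    by apply: sumr_ge0.
  apply: (@le_trans _ _ (Ex p q h bs eact J' (fun e => 1 * (a + b * diss F e) + Z * (~~ `[< free I e >])%:R) e0)).
    apply: (Ex_le p0 q0 pq h0 hL) => e; case: asboolP => fI /=.
      rewrite mulr0 addr0 mul1r; apply: le_trans (avg_free d0 F01 fI) _.
      rewrite /a /b le_eqVlt; apply/orP; left; apply/eqP; ring.
    rewrite mulr1 mul1r -[leLHS]add0r; apply: lerD.
      by rewrite addr_ge0// mulr_ge0 ?diss_ge0.
    rewrite /avg /wsum; apply: ler_sum => c _; rewrite ler_piMr//.
    case/andP: (F01 (e, c)) => *; case/andP: (F01 (e, gs k)) => *.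
    rewrite ler_norml; apply/andP; split.
      by rewrite lerBrDr (@le_trans _ _ 0)// addrC subr_le0.
    by rewrite lerBlDr (@le_trans _ _ 1)// lerDl.
  rewrite Ex_lin Ex_addf Ex_cst (@Ex_scale R p q h bs _ eact J' b).
  rewrite mul1r; apply: lerD; last by rewrite ler_wpM2l ?(ltW Z0)// Hfree.
  apply: (@le_trans _ _ (a + b * (Z / (h * m%:R)))); first by rewrite lerD2l ler_wpM2l.
  rewrite /a /b le_eqVlt; apply/orP; left; apply/eqP; ring.
pose E := Ex p q h bs eact J' (fun e => F (e, gs k)) e0.
have e1 : `|Ex p q h bs (fact k) (J + m) Phi (e0, gs k) - E| <= h * (size bs)%:R + X.
  rewrite ExE -/(Fi i) -/F.
  have EE : E = Ex p q h bs (fact k) J' (fun x => F (x.1, gs k)) (e0, gs k).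
    by rewrite (Ex_proj p0 q0 pq h0 hL (act' := eact) (inv := fun=> True) (pr := fst)
      _ _ _ (fun e => F (e, gs k))).
  have sub (f g : xst -> R) x : Ex p q h bs (fact k) J' f x - Ex p q h bs (fact k) J' g x
      = Ex p q h bs (fact k) J' (fun x => 1 * f x + (-1) * g x) x.
    by rewrite Ex_lin mul1r mulN1r.
  (* The sorted word is a term of weight one in the stationary sum, so the latter dominates the
     chain started from it. *)
  have X2 : Ex p q h bs (fact k) J' (fun x => `|F x - F (x.1, gs k)|) (e0, gs k) <= X.
    rewrite /X -avg_Ex// /avg (big_rem _ gsP) /= invw_gs expr0 mul1r lerDl.
    apply: sumr_ge0 => c _; apply: mulr_ge0 => //.
    exact: (Ex_ge0 p0 q0 pq h0 hL).
  have abs f x : `|Ex p q h bs (fact k) J' f x| <= Ex p q h bs (fact k) J' (fun x => `|f x|) x.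
    rewrite ler_norml; apply/andP; split; last first.
      by apply: (Ex_le p0 q0 pq h0 hL) => z; exact: ler_norm.
    have := @Ex_scale R p q h bs _ (fact k) J' (-1) (fun x => `|f x|).
    move=> /(congr1 (@^~ x)) /=; rewrite mulN1r => <-.
    by apply: (Ex_le p0 q0 pq h0 hL) => z; rewrite mulN1r lerNl ler_normr lexx orbT.
  rewrite EE sub; apply: le_trans (abs _ _) _.
  apply: (@le_trans _ _ (Ex p q h bs (fact k) J' (fun x => h * (size bs)%:R + `|F x - F (x.1, gs k)|) (e0, gs k))).
    apply: (Ex_le p0 q0 pq h0 hL) => x; rewrite mul1r mulN1r.
    have -> : stp p q h bs (fact k) F x - F (x.1, gs k) = (stp p q h bs (fact k) F x - F x) + (F x - F (x.1, gs k)) by ring.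
    by apply: le_trans (ler_normD _ _) _; rewrite lerD2r; exact: stp_near.
  by rewrite Ex_addf Ex_cst lerD2l.
have avgle (f g : xst -> R) e : (forall x, `|f x - g x| <= h * (size bs)%:R) -> `|avg f e - avg g e| <= Z * (h * (size bs)%:R).
  move=> fg; rewrite /avg -sumrB; apply: le_trans (ler_norm_sum _ _ _) _.
  rewrite /wsum mulr_suml; apply: ler_sum => c _.
  by rewrite -mulrBr normrM (ger0_norm (wt0 c)) ler_wpM2l.
have e2 : `|(\sum_(c <- P) wt c * phi c) - Z * E| <= Z * (h * (size bs)%:R) + X.
  have -> : \sum_(c <- P) wt c * phi c = avg (Ex p q h bs (fact k) (J + m) Phi) e0.
    rewrite avg_Ex// (_ : avg Phi = fun=> \sum_(c <- P) wt c * phi c)//.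
    by rewrite Ex_cst.
  rewrite ExE -/(Fi i) -/F avg_Ex//.
  have -> : Z * E = Ex p q h bs eact J' (fun e => Z * F (e, gs k)) e0.
    by rewrite (congr1 (@^~ e0) (@Ex_scale R p q h bs _ eact J' Z (fun e => F (e, gs k)))).
  have pw e : `|avg (stp p q h bs (fact k) F) e - Z * F (e, gs k)| <=
      Z * (h * (size bs)%:R) + avg (fun x => `|F x - F (x.1, gs k)|) e.
    have -> : avg (stp p q h bs (fact k) F) e - Z * F (e, gs k) =
      (avg (stp p q h bs (fact k) F) e - avg F e) + (avg F e - Z * F (e, gs k)) by ring.
    apply: le_trans (ler_normD _ _) _; apply: lerD.
      by apply: avgle => x; exact: stp_near.
    rewrite /avg /wsum mulr_suml -sumrB; apply: le_trans (ler_norm_sum _ _ _) _.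
    by apply: ler_sum => c _; rewrite -mulrBr normrM (ger0_norm (wt0 c)).
  have cD : Z * (h * (size bs)%:R) + X =
      Ex p q h bs eact J' (fun e => Z * (h * (size bs)%:R) + avg (fun x => `|F x - F (x.1, gs k)|) e) e0.
    by rewrite Ex_addf Ex_cst.
  have le1 (f g : env -> R) : (forall e, f e <= g e) -> Ex p q h bs eact J' f e0 <= Ex p q h bs eact J' g e0.
    by move=> fg; apply: (Ex_le p0 q0 pq h0 hL).
  rewrite cD ler_norml lerBlDr lerNl.
  have ad f g : Ex p q h bs eact J' f e0 + Ex p q h bs eact J' g e0 = Ex p q h bs eact J' (fun e => f e + g e) e0.
    by rewrite Ex_addf.
  apply/andP; split; last first.
    rewrite ad; apply: le1 => e; rewrite -lerBlDr; exact: le_trans (ler_norm _) (pw e).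
  rewrite opprB lerBlDr ad; apply: le1 => e; rewrite -lerBlDr.
  by apply: le_trans (pw e); rewrite -normrN opprB ler_norm.
have hl0 : 0 <= h * (size bs)%:R by rewrite mulr_ge0.
have X0 : 0 <= X.
  apply: (Ex_ge0 p0 q0 pq h0 hL) => e; apply: sumr_ge0 => c _.
  by apply: mulr_ge0.
have {}e2 : `|E - (\sum_(c <- P) wt c * phi c) / Z| <= h * (size bs)%:R + X.
  have -> : E - (\sum_(c <- P) wt c * phi c) / Z = - (((\sum_(c <- P) wt c * phi c) - Z * E) / Z).
    rewrite mulrBl mulrAC divff ?gt_eqF// mul1r; ring.
  rewrite normrN normrM normfV (gtr0_norm Z0) ler_pdivrMr//; apply: le_trans e2 _.
  rewrite mulrDl (mulrC Z) lerD2l ler_peMr//.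
apply: le_trans (le_trans (ler_distD E _ _) (lerD e1 e2)) _.
rewrite (_ : _ + X + (_ + X) = 2 * (h * (size bs)%:R) + 2 * X); last by ring.
by rewrite lerD2l ler_wpM2l.
Qed.

End Mixing.

(** * The stationary law of the place of the letter 2 in long words *)

Section StationaryLimit.
Context {R : realType}.
Variable tau : R.
Hypothesis tau01 : 0 <= tau < 1.
Notation wt c := (tau ^+ invw c).

Definition stat (k : nat) (phi : seq nat -> R) : R :=
  (\sum_(c <- permutations (gs k)) wt c * phi c) / wsum tau (gs k).

Definition far (r : R) (k : nat) (c : seq nat) : R :=
  (r < `|(index 2%N c)%:R - k%:R|)%R%:R.

Lemma sqrt01 : 0 <= Num.sqrt tau < 1.
Proof.
by case/andP: tau01 => t0 t1; rewrite sqrtr_ge0 -sqrtr1 ltr_sqrt.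
Qed.

Lemma Zmax_ge0 : 0 <= Zmax (Num.sqrt tau).
Proof. by apply: le_trans (Zk_le sqrt01 0); apply: wsum_ge0 => //; exact: sqrt01. Qed.

Lemma wt_sqrt c : wt c = Num.sqrt tau ^+ invw c * Num.sqrt tau ^+ invw c.
Proof. by case/andP: tau01 => t0 _; rewrite -exprD addnn -mul2n exprM sqr_sqrtr. Qed.

(** Half of the exponent [invw c] pays for the tail; the weights [sqrt tau ^ invw c] that remain
    still have a bounded sum. *)
Lemma ztail_le k I : ztail tau k I <= Num.sqrt tau ^+ I * Zmax (Num.sqrt tau).
Proof.
have /andP[s0 s1] := sqrt01.
apply: (@le_trans _ _ (Num.sqrt tau ^+ I * wsum (Num.sqrt tau) (gs k))); last first.
  by rewrite ler_wpM2l ?exprn_ge0//; exact: Zk_le sqrt01 k.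
rewrite /ztail /wsum big_distrr /= big_mkcond; apply: ler_sum => c _.
case: ltnP => Ic; last by rewrite mulr_ge0 ?exprn_ge0.
by rewrite wt_sqrt ler_wpM2r ?exprn_ge0// ler_wiXn2l ?(ltW s1) ?(ltnW Ic).
Qed.

Lemma wt_ge0 c : 0 <= wt c.
Proof. by case/andP: tau01 => t0 _; exact: exprn_ge0. Qed.

Lemma wsum_gs_ge1 k : 1 <= wsum tau (gs k).
Proof. exact: Z_ge1 tau01. Qed.

Lemma far_dist (c : seq nat) k : perm_eq c (gs k) ->
  `|(index 2%N c)%:R - k%:R| <= (invw c)%:R :> R.
Proof.
move=> cg; have := gs_index2 cg.
rewrite -(ler_int R) intr_norm rmorphB /= !pmulrn; exact.
Qed.

Lemma stat_far_le k n r : n%:R <= r -> stat k (far r k) <= Num.sqrt tau ^+ n * Zmax (Num.sqrt tau).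
Proof.
move=> nr; have W := wsum_gs_ge1 k; have W0 : 0 < wsum tau (gs k) := lt_le_trans ltr01 W.
rewrite /stat ler_pdivrMr//; apply: (@le_trans _ _ (ztail tau k n)); last first.
  apply: le_trans (ztail_le k n) _; rewrite ler_peMr// mulr_ge0 ?Zmax_ge0// exprn_ge0//.
rewrite /ztail [leRHS]big_mkcond big_seq [leRHS]big_seq; apply: ler_sum => c.
rewrite mem_permutations => cg; rewrite /far; case: ltP => h; last first.
  by rewrite mulr0; case: ifP => // _; exact: wt_ge0.
have : n%:R < (invw c)%:R :> R by apply: le_lt_trans nr (lt_le_trans h (far_dist cg)).
by rewrite ltr_nat => ->; rewrite mulr1.
Qed.

Lemma stat_far_ge0 k r : 0 <= stat k (far r k).
Proof.
rewrite /stat divr_ge0 ?(le_trans ler01 (wsum_gs_ge1 k))//.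
by apply: sumr_ge0 => c _; rewrite mulr_ge0 ?wt_ge0.
Qed.

(** Numerator and denominator are nondecreasing and bounded in [k], because the embedding of
    [wsum_mono] also keeps the place of the letter 2 relative to the middle. The inner limit of the
    theorem exists for this reason. *)
Lemma stat_far_cvg r : cvgn (fun k => stat k (far r k)).
Proof.
have cv (phi : nat -> seq nat -> R) : (forall k c, 0 <= phi k c <= 1) ->
    (forall k c, perm_eq c (gs k) -> phi k.+1 (1%N :: rcons c 3%N) = phi k c) ->
    cvgn (fun k => \sum_(c <- permutations (gs k)) wt c * phi k c).
  move=> p01 pE; apply: nondecreasing_is_cvgn.
    apply/nondecreasing_seqP => k; apply: (wsum_mono tau01) pE k.
    by move=> k c; case/andP: (p01 k c).
  exists (Zmax tau) => _ [k _ <-]; apply: le_trans (Zk_le tau01 k).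
  rewrite /wsum; apply: ler_sum => c _; rewrite ler_piMr ?wt_ge0//.
  by case/andP: (p01 k c).
have cW : cvgn (fun k => wsum tau (gs k)).
  rewrite (_ : (fun k => _) = fun k => \sum_(c <- permutations (gs k)) wt c * (fun _ _ => 1) k c); last first.
    by apply/funext => k; apply: eq_bigr => c _; rewrite mulr1.
  by apply: cv => // *; rewrite ler01 lexx.
have cN : cvgn (fun k => \sum_(c <- permutations (gs k)) wt c * far r k c).
  apply: cv => [k c|k c cg]; first by rewrite /far; case: (_ < _); rewrite ?lexx ler01.
  rewrite /far /=.
  have c2 : 2%N \in c.
    by rewrite -has_pred1 has_count (gs_count2 cg).
  by rewrite -cats1 index_cat c2 -![in LHS]natr1 [in LHS]opprD addrACA subrr addr0.
apply: is_cvgM => //; apply: is_cvgV => //.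
rewrite gt_eqF// (lt_le_trans ltr01)//; apply: limr_ge => //.
by near=> k; exact: wsum_gs_ge1.
Unshelve. all: by end_near. Qed.

Lemma stat_far_lim0 (u : nat -> R) : u @ \oo --> +oo ->
  limn (fun k => stat k (far (u M) k)) @[M --> \oo] --> 0.
Proof.
move=> uoo; have /andP[s0 s1] := sqrt01.
have Zm0 := Zmax_ge0.
apply/cvgrPdist_le => e e0.
have : (Num.sqrt tau ^+ n * Zmax (Num.sqrt tau)) @[n --> \oo] --> 0 * Zmax (Num.sqrt tau).
  by apply: cvgMr_tmp; apply: cvg_expr; rewrite ger0_norm.
rewrite mul0r => /cvgrPdist_le /(_ _ e0) [n _ /(_ n (leqnn n))]; rewrite /= sub0r normrN => He.
near=> M; have nM : n%:R <= u M by near: M; move/cvgryPge: uoo; exact.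
rewrite sub0r normrN ger0_norm; last first.
  by apply: limr_ge; [exact: stat_far_cvg | near=> k; exact: stat_far_ge0].
apply: limr_le; first exact: stat_far_cvg.
near=> k; apply: le_trans (stat_far_le k nM) _; exact: le_trans (ler_norm _) He.
Unshelve. all: by end_near. Qed.

End StationaryLimit.

(** * Heights of the classes *)

(** The height of the particles of class at least [t], for [t] in {1, 2, 3}. *)
Definition hgt (t k : nat) (x : env * seq nat) (z : int) : int :=
  x.1.1 z + (count (fun y => t <= y)%N (drop (absz ((k + k).+1%:Z - mid x.1 z)) x.2))%:Z.

Definition xinv (k : nat) (x : env * seq nat) :=
  [/\ einv k x.1, forall z, x.1.1 (z - 1) - x.1.1 z <= x.1.2 (z - 1) - x.1.2 z & perm_eq x.2 (gs k)].

Lemma xinv_fact k c x : xinv k x -> xinv k (fact k c x).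
Proof.
move=> [i1 i2 i3]; split => /=; first exact: einv_eact.
  by move=> z; have [a1 a2 _ _] := i1; exact: hmove_attr.
by case: ifP => // _; rewrite (permPl (perm_wmove _ _)).
Qed.

(** A finite check: the contents of the two sites are four bits, and [g] matters only through its
    increments at the places met there. *)
Lemma closed_step (g : int -> int) (u0 u1 u2 v0 v1 v2 : int) (d : bool) :
  (forall m m', m = m' -> g m = g m') ->
  (v0 - u0 = v1 - u1 + 1 -> 0 <= g (v0 - u0) - g (v1 - u1) <= 1) ->
  (v1 - u1 = v2 - u2 + 1 -> 0 <= g (v1 - u1) - g (v2 - u2) <= 1) ->
  u1 <= u0 <= u1 + 1 -> u2 <= u1 <= u2 + 1 -> v1 <= v0 <= v1 + 1 -> v2 <= v1 <= v2 + 1 ->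
  u0 - u1 <= v0 - v1 -> u1 - u2 <= v1 - v2 -> (v0 - u0) - (v2 - u2) != 2 ->
  let mv (w0 w2 : int) := if d then Num.min w0 (w2 + 1) else Num.max w2 (w0 - 1) in
  mv u0 u2 + g (mv v0 v2 - mv u0 u2) = mv (u0 + g (v0 - u0)) (u2 + g (v2 - u2)).
Proof.
move=> gE g0 g1 h1 h2 h3 h4 h5 h6 h7 mv; rewrite /mv.
have {h1 h2 h3 h4 h5 h6 h7} H : exists a b c e : bool, [/\ u0 = u1 + a%:Z, u2 = u1 - b%:Z, v0 = v1 + c%:Z, v2 = v1 - e%:Z &
    [/\ (a <= c)%N, (b <= e)%N & ~~ [&& c - a == 1 & e - b == 1]%N]].
  exists (u0 != u1), (u2 != u1), (v0 != v1), (v2 != v1); split; try lia.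
  by split; move: h1 h2 h3 h4 h5 h6 h7; clear; lia.
set x' := (X in u0 + g X) in g0 g1 *; set x1 := v1 - u1 in g0 g1; set x2 := v2 - u2 in g1 *.
set nu := if d then _ else _; set nv := if d then _ else _.
have e0 := gE (nv - nu) x'; have e1 := gE (nv - nu) x1; have e2 := gE (nv - nu) x2.
have e3 := gE x' x1; have e4 := gE x1 x2.
clear gE mv; move: (g (nv - nu)) (g x') (g x1) (g x2) g0 g1 e0 e1 e2 e3 e4.
rewrite {}/nu {}/nv {}/x' {}/x1 {}/x2; case: H => a [b [c [e [-> -> -> -> [H1 H2 H3]]]]].
by case: d; case: a H1 H3; case: b H2; case: c; case: e => //= _ _ _; clear => *; lia.
Qed.

Lemma count_drop (a : pred nat) c i : (i < size c)%N ->
  count a (drop i c) = (a (nth 0 c i) + count a (drop i.+1 c))%N.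
Proof. by move=> ic; rewrite (drop_nth 0%N ic). Qed.

Lemma open_step (c0 c1 r t : nat) (u : int) (d : bool) :
  let a (y : nat) := (t <= y)%N : nat in
  u + ((if (if d then c1 < c0 else c0 < c1)%N then a c0 else a c1) + r)%N%:Z =
  if d then Num.min (u + (a c0 + (a c1 + r))%N%:Z) (u + r%:Z + 1)
  else Num.max (u + r%:Z) (u + (a c0 + (a c1 + r))%N%:Z - 1).
Proof. by case: d => /=; case: ltnP; case: (leqP t c0); case: (leqP t c1); lia. Qed.

(** Merging of classes: each threshold sees an exclusion process under the same clocks. The
    thresholds 3 and 2 recover the first class particles and the particles of both classes from the
    environment and the word. *)
Lemma hgt_fact t k c x : xinv k x -> hgt t k (fact k c x) = hmove c (hgt t k x).
Proof.
case: x => e w; case: c => b d [ie ia iw] /=; apply/funext => z; rewrite /= in ie ia iw.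
have sw := gs_size iw; have [a1 a2 h1 h2] := ie.
have m01 z' : 0 <= mid e z' <= (k + k).+1%:Z.
  rewrite /mid; have := h1 z'; have := h2 z'; clear; lia.
case: (boolP (openb e b)) => ob.
  have -> : fact k (b, d) (e, w) = (e, wmove (widx k e b, d) w) by rewrite /fact /= ob (eact_open _ ie ob).
  rewrite /hgt /=.
  have [e1 e2 wk] := open_range ie ob.
  have eb : e.1 b = e.1 (b - 1) by have := a1 b; have := a1 (b + 1); rewrite addrK e1; clear; lia.
  have vb : e.2 b = e.2 (b + 1) + 1 by have := a2 b; have := a2 (b + 1); rewrite addrK e2; clear; lia.
  have mb : mid e (b - 1) = mid e b + 1 by rewrite /mid e2 vb eb; clear; lia.
  have mb' : mid e b = mid e (b + 1) + 1 by rewrite /mid vb eb e1; clear; lia.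
  set i := widx k e b in wk *.
  have i0 : absz ((k + k).+1%:Z - mid e (b - 1)) = i by [].
  have i1 : absz ((k + k).+1%:Z - mid e b) = i.+1.
    by rewrite /i /widx mb; have := m01 (b - 1); rewrite mb; clear; lia.
  have i2 : absz ((k + k).+1%:Z - mid e (b + 1)) = i.+2.
    by rewrite /i /widx mb mb'; have := m01 (b - 1); have := m01 (b + 1); rewrite mb mb'; clear; lia.
  have wk' : (i.+1 < size w)%N by rewrite sw.
  rewrite /hmove /=; case: eqP => [->|zb].
    rewrite i0 i1 i2 eb -e1 (count_drop _ (ltnW wk')) !(count_drop _ wk') //.
    rewrite (@count_drop _ (wmove (i, d) w)) ?size_wmove//.
    have -> : count (fun y => t <= y)%N (drop i.+2 (wmove (i, d) w)) = count (fun y => t <= y)%N (drop i.+2 w).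
      rewrite /wmove; case: ifP => // _; apply/permP; by apply: drop_swp; rewrite gtn_eqF.
    have -> : ((t <= nth 0 (wmove (i, d) w) i.+1)%N : nat) =
       (if (if d then nth 0 w i.+1 < nth 0 w i else nth 0 w i < nth 0 w i.+1)%N then (t <= nth 0 w i)%N : nat else (t <= nth 0 w i.+1)%N).
      rewrite /wmove /=; case: ifP => // _; rewrite nth_swp//.
      by rewrite gtn_eqF// eqxx.
    exact: open_step.
  have zi : absz ((k + k).+1%:Z - mid e z) != i.+1.
    have mm z1 z2 : z1 <= z2 -> mid e z2 <= mid e z1.
      move=> z12; have -> : z2 = z1 + (absz (z2 - z1))%:Z by move: z12; clear; lia.
      elim: (absz _) => [|n IH]; first by rewrite addr0.
      apply: le_trans IH; have := ia (z1 + n.+1%:Z).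
      by rewrite (_ : z1 + n.+1%:Z - 1 = z1 + n%:Z) /mid; clear; lia.
    rewrite -i1; apply/eqP; have := m01 z; have := m01 b.
    have [zl|zr] : z <= b - 1 \/ b + 1 <= z by move: zb; clear; lia.
      have := mm _ _ zl; rewrite mb; clear; lia.
    have := mm _ _ zr; rewrite mb'; clear; lia.
  rewrite /wmove; case: ifP => // _; congr (_ + _%:Z); apply/permP.
  by apply: drop_swp.
rewrite [RHS]/hmove /hgt /fact /= (negPf ob) /mid /eact /=; case: (eqVneq z b) => [->|zb]; last first.
  by rewrite /hmove /= (negPf zb).
rewrite /hmove /= eqxx.
pose g (m : int) := (count (fun y => t <= y)%N (drop (absz ((k + k).+1%:Z - m)) w))%:Z.
have gl m : 0 <= m -> m + 1 <= (k + k).+1%:Z -> 0 <= g (m + 1) - g m <= 1.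
  move=> m0 mk; rewrite /g.
  have -> : absz ((k + k).+1%:Z - m) = (absz ((k + k).+1%:Z - (m + 1))%R).+1 by move: m0 mk; clear; lia.
  rewrite (@count_drop _ w (absz ((k + k).+1%:Z - (m + 1))%R)); last by rewrite sw; move: m0 mk; clear; lia.
  by case: (t <= _)%N; clear; lia.
apply: (@closed_step g (e.1 (b - 1)) (e.1 b) (e.1 (b + 1)) (e.2 (b - 1)) (e.2 b) (e.2 (b + 1)) d).
- by move=> m m' ->.
- have := m01 b; have := m01 (b - 1); rewrite /mid => q1 q2 q3; rewrite q3; apply: gl; move: q1 q2 q3; clear; lia.
- have := m01 b; have := m01 (b + 1); rewrite /mid => q1 q2 q3; rewrite q3; apply: gl; move: q1 q2 q3; clear; lia.
- exact: a1.
- by have := a1 (b + 1); rewrite addrK.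
- exact: a2.
- by have := a2 (b + 1); rewrite addrK.
- exact: ia.
- by have := ia (b + 1); rewrite addrK.
- exact: ob.
Qed.

(** * Runs along a finite pattern of rings *)

(** An entry [None] is a cell of the time grid without any ring. *)
Definition run (C T : Type) (act : C -> T -> T) (l : seq (option C)) (x : T) : T :=
  foldl (fun x o => if o is Some c then act c x else x) x l.

Lemma run_cat (C T : Type) (act : C -> T -> T) l l' x : run act (l ++ l') x = run act l' (run act l x).
Proof. exact: foldl_cat. Qed.

Lemma run_ind (C T : Type) (act : C -> T -> T) (inv : T -> Prop) l x :
  (forall c x, inv x -> inv (act c x)) -> inv x -> inv (run act l x).
Proof.
move=> H; elim: l x => //= o l IH x ix; apply: IH; case: o => //= c; exact: H.
Qed.

Lemma run_proj (C T T' : Type) (act : C -> T -> T) (act' : C -> T' -> T') (inv : T -> Prop) (pr : T -> T') l x :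
  (forall c x, inv x -> inv (act c x)) -> (forall c x, inv x -> pr (act c x) = act' c (pr x)) ->
  inv x -> pr (run act l x) = run act' l (pr x).
Proof.
move=> H H'; elim: l x => //= o l IH x ix; case: o => /= [c|]; last exact: IH.
by rewrite IH ?H'//; exact: H.
Qed.

Definition x_start (k : nat) : env * seq nat := ((stepf (- k%:Z - 1), stepf k%:Z), gs k).

Lemma xinv_start k : xinv k (x_start k).
Proof.
split => //=; last by move=> z; rewrite /stepf; lia.
by split => [||z|z]; [exact: adm_stepf|exact: adm_stepf| |]; rewrite /= /stepf; lia.
Qed.

Definition first_height (k : nat) (z : int) : int := stepf (- k%:Z - 1) z + Num.min k%:Z (stepf k%:Z z).
Definition second_height (k : nat) (z : int) : int := stepf (- k%:Z - 1) z + Num.min (k%:Z + 1) (stepf k%:Z z).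

Lemma count_nseq_drop (a : pred nat) m y i : count a (drop i (nseq m y)) = (a y * (m - i))%N.
Proof. by rewrite drop_nseq count_nseq. Qed.

Lemma hgt_start2 k : hgt 2 k (x_start k) = second_height k.
Proof.
apply/funext => z; rewrite /hgt /second_height /= /mid /= /gs drop_cat size_nseq.
congr (_ + _); case: ltnP => i1.
  rewrite count_cat count_nseq_drop /= count_nseq; move: i1; rewrite /stepf; lia.
case E : (absz _ - k)%N => [|i] /=.
  by rewrite count_nseq; move: E i1; rewrite /stepf; lia.
by rewrite count_nseq_drop /=; move: E i1; rewrite /stepf; lia.
Qed.

Lemma hgt_start3 k : hgt 3 k (x_start k) = first_height k.
Proof.
apply/funext => z; rewrite /hgt /first_height /= /mid /= /gs drop_cat size_nseq.
congr (_ + _); case: ltnP => i1.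
  rewrite count_cat count_nseq_drop /= count_nseq; move: i1; rewrite /stepf; lia.
case E : (absz _ - k)%N => [|i] /=.
  by rewrite count_nseq; move: E i1; rewrite /stepf; lia.
by rewrite count_nseq_drop /=; move: E i1; rewrite /stepf; lia.
Qed.

Lemma hgt_run t k l : hgt t k (run (fact k) l (x_start k)) = run hmove l (hgt t k (x_start k)).
Proof.
apply: (run_proj (inv := xinv k)); first by move=> c x; exact: xinv_fact.
  by move=> c x; exact: hgt_fact.
exact: xinv_start.
Qed.

Lemma xinv_run k l x : xinv k x -> xinv k (run (fact k) l x).
Proof. by apply: run_ind => c y; exact: xinv_fact. Qed.

(** * The good event *)

(** The environment of class 0 seen through the reflection exchanging particles
    and holes: it has the law of the environment of class 4. *)
Definition refl (k : nat) (H : int -> int) (z : int) : int := H (- z - 1) - z - 1 - k%:Z.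

(** No particle at the sites from [- W] to [W], and at most [W / 4] of them further to the right. *)
Definition flat (W : nat) (H : int -> int) : bool :=
  [&& H (- W%:Z - 1) == H W%:Z, 0 <= H (- W%:Z - 1) & H (- W%:Z - 1) *+ 4 <= W%:Z].

Definition calm (k W : nat) (e : env) : bool := flat W e.1 && flat W (refl k e.2).

(** At both times the window is free and the word nearly sorted, and the numbers of environment
    particles and holes beyond the window agree. The factors 4 keep the disordered part of the word,
    displaced by those two numbers, inside the window. *)
Definition good (k W : nat) (xs xt : env * seq nat) : bool :=
  [&& calm k W xs.1, calm k W xt.1,
      xs.1.1 (- W%:Z - 1) == xt.1.1 (- W%:Z - 1),
      refl k xs.1.2 (- W%:Z - 1) == refl k xt.1.2 (- W%:Z - 1),
      (4 * invw xs.2 <= W)%N & (4 * invw xt.2 <= W)%N].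

Lemma refl_adm k H : adm H -> adm (refl k H).
Proof.
move=> aH z; rewrite /refl; have := aH (- z); rewrite (_ : - (z - 1) - 1 = - z); last by clear; lia.
move: (H _) (H _) => u v; clear => /andP[h1 h2]; apply/andP; split; lia.
Qed.

Lemma flat_win W H z : adm H -> flat W H -> - W%:Z - 1 <= z -> z <= W%:Z -> H z = H (- W%:Z - 1).
Proof.
move=> aH /and3P[/eqP h1 _ _] z1 z2; have := adm_le aH z1; have := adm_le aH z2; rewrite -h1.
move: (H z) (H _); clear => *; lia.
Qed.

Lemma calm_win k W e z : einv k e -> calm k W e -> - W%:Z - 1 <= z -> z <= W%:Z ->
  e.1 z = e.1 (- W%:Z - 1) /\ e.2 z = refl k e.2 (- W%:Z - 1) - z + k%:Z.
Proof.
move=> [a1 a2 _ _] /andP[f1 f2] z1 z2; split; first exact: flat_win.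
have := @flat_win W (refl k e.2) (- z - 1) (refl_adm k a2) f2; rewrite /refl.
rewrite (_ : - (- z - 1) - 1 = z); last by clear; lia.
by move=> h; move: h z1 z2; move: (e.2 z) (e.2 _); clear => *; lia.
Qed.

(** In a free window the letter at place [w] sits at the site [w - k + E - r]. *)
Lemma calm_free k W I B e : einv k e -> calm k W e -> (4 * I + 8 <= W)%N -> (W < B)%N -> free k (box B) I e.
Proof.
move=> ie ce IW WB w w1 w2; have cw := calm_win ie ce; have /andP[/and3P[_ f1 f2] /and3P[_ g1 g2]] := ce.
set E := refl k e.2 _ in cw g1 g2; set r := e.1 _ in cw f1 f2.
pose b := w%:Z - k%:Z + E - r.
have bW : - W%:Z + 1 < b /\ b < W%:Z - 1.
  move: f1 f2 g1 g2 w1 w2 IW; rewrite /b; generalize E, r; clear => *; lia.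
have [|| h1 h2] := cw (b - 1); [move: bW; clear; lia|move: bW; clear; lia|].
have [|| h3 h4] := cw (b + 1); [move: bW; clear; lia|move: bW; clear; lia|].
exists b; split.
- by rewrite mem_box; move: bW WB; clear; lia.
- by rewrite /openb /mid h1 h2 h3 h4; clear; lia.
- by rewrite /widx /mid h1 h2 /b; generalize E, r; clear; lia.
Qed.

Section GoodEvent.
Variables (k W : nat) (xs xt : env * seq nat).
Hypotheses (is_ : xinv k xs) (it : xinv k xt) (g : good k W xs xt).
Let r := xs.1.1 (- W%:Z - 1).
Let E := refl k xs.1.2 (- W%:Z - 1).

Lemma good_ge0 : 0 <= r /\ 0 <= E.
Proof. by case/and5P: g => /andP[/and3P[_ h1 _] /and3P[_ h2 _]] _ _ _ _. Qed.

(** A letter 3 to the left of the window would force more than [W / 4] inversions, so all [k] of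
    them count in the height at the left edge, together with the [r] particles of class 4. *)
Lemma good_first : hgt 3 k xs (- W%:Z - 1) = r + k%:Z.
Proof.
have [ie ia ic] := is_; case/and5P: g => cs _ _ _ /andP[inv1 _].
have /andP[/and3P[_ f1 f2] /and3P[_ g1 g2]] := cs; rewrite -/r -/E in f1 f2 g1 g2.
have [|| h1 h2] := @calm_win k W xs.1 (- W%:Z - 1) ie cs; [by []|by clear; lia|].
have [_ _ _ H2] := ie; have := H2 (- W%:Z - 1); rewrite h2 -/r -/E => {}H2.
rewrite /hgt /mid -/r h2 -/E; congr (_ + _%:Z).
set i := absz _.
rewrite (_ : count _ (drop i xs.2) = count (fun y => 3 <= y)%N xs.2).
  rewrite -[in RHS](gs_count3 ic); apply: eq_in_count => y yc.
  have /andP[y1 y3] := allP (gs_all ic) y yc.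
  by rewrite /=; apply/idP/eqP; move: y3; clear; lia.
rewrite -[in RHS](cat_take_drop i xs.2) count_cat (_ : count _ (take i _) = 0%N)//.
apply/eqP; rewrite -leqn0 leqNgt -has_count; apply/hasPn => y /(nthP 0%N)[j jl <-].
have ji : (j < i)%N by move: jl; rewrite size_take_min leq_min => /andP[].
rewrite nth_take// -ltnNge ltnNge; apply/negP => y3.
have jc : (j < size xs.2)%N by move: jl; rewrite size_take_min leq_min => /andP[].
have := gs_right1 ic jc (ltnW y3); move: H2 ji inv1 f1 f2 g1 g2; rewrite /i; generalize r, E; clear; lia.
Qed.

Lemma good_second : hgt 2 k xs W%:Z = E - W%:Z + k%:Z.
Proof.
have [ie ia ic] := is_; case/and5P: g => cs _ _ _ /andP[inv1 _].
have /andP[/and3P[_ f1 f2] /and3P[_ g1 g2]] := cs; rewrite -/r -/E in f1 f2 g1 g2.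
have [|| h1 h2] := @calm_win k W xs.1 W%:Z ie cs; [by clear; lia|by []|].
have [_ _ H1 H2] := ie; have := H2 W%:Z; have := H1 W%:Z.
rewrite /hgt /mid h1 h2 -/r -/E => B1 B2.
set i := absz _.
rewrite (_ : count _ (drop i xs.2) = size (drop i xs.2)).
  rewrite size_drop (gs_size ic) /i; move: B1 B2; clear; lia.
rewrite -[RHS]count_predT; apply: eq_in_count => y /(nthP 0%N)[j jl <-] /=.
rewrite size_drop in jl; have jc : (i + j < size xs.2)%N by rewrite -ltn_subRL.
rewrite nth_drop; apply/idP; rewrite leqNgt; apply/negP => y3.
have := gs_left ic jc (ltnW y3).
by move: B1 B2 inv1 f1 f2 g1 g2; rewrite /i; generalize r, E; clear; lia.
Qed.

Lemma count2_drop c j : perm_eq c (gs k) ->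
  count (fun y => 2 <= y)%N (drop j c) = (count (fun y => 3 <= y)%N (drop j c) + (j <= index 2%N c))%N.
Proof.
move=> cg; have c2 : 2%N \in c by rewrite -has_pred1 has_count (gs_count2 cg).
have -> : ((j <= index 2%N c)%N : nat) = count_mem 2%N (drop j c).
  have := gs_count2 cg; rewrite -[in X in X -> _](cat_take_drop j c) count_cat.
  rewrite (leqNgt j) -(in_take j c2) -has_pred1 has_count.
  by move: (count _ _) (count _ _) => a b; clear; case: a; lia.
elim: (drop j c) => //= y s ->; move: (count _ _) (count _ _); clear => *; lia.
Qed.

(** The second class particle is where the two heights separate, that is, where the index of the
    letter 2 is passed; the free window converts this index into a site. *)
Lemma good_position X : hgt 2 k xt (X - 1) - hgt 2 k xt X = 1 -> hgt 3 k xt (X - 1) = hgt 3 k xt X ->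
  X = (index 2%N xt.2)%:Z - k%:Z + E - r.
Proof.
have [ie ia ic] := it; case/and5P: g => _ ct /eqP er /eqP eE /andP[_ inv1].
have /andP[/and3P[_ f1 f2] /and3P[_ g1 g2]] := ct.
rewrite -er -/r -eE -/E in f1 f2 g1 g2.
have cw z := @calm_win k W xt.1 z ie ct; rewrite -er -eE -/r -/E in cw.
rewrite /hgt !(count2_drop _ ic); set j := fun z => absz ((k + k).+1%:Z - mid xt.1 z).
move=> h1 h2; have {h1 h2} : ((j (X - 1)%R <= index 2%N xt.2)%N && (index 2%N xt.2 < j X)%N).
  move: h1 h2; rewrite /j ltnNge; clear.
  by case: (_ <= index 2%N xt.2)%N; case: (_ <= index 2%N xt.2)%N => //=; lia.
have [_ _ H1 H2] := ie.
have jm z1 z2 : z1 <= z2 -> (j z1 <= j z2)%N.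
  move=> z12; have -> : z2 = z1 + (absz (z2 - z1))%:Z by move: z12; clear; lia.
  elim: (absz _) => [|n IH]; first by rewrite addr0.
  apply: leq_trans IH _; have := ia (z1 + n.+1%:Z); rewrite /j /mid.
  have -> : z1 + n.+1%:Z - 1 = z1 + n%:Z by clear; lia.
  have := H1 (z1 + n%:Z); have := H2 (z1 + n%:Z); have := H1 (z1 + n.+1%:Z); have := H2 (z1 + n.+1%:Z).
  by move: (xt.1.1 _) (xt.1.1 _) (xt.1.2 _) (xt.1.2 _); clear; lia.
have idx := gs_index2 ic; set i2 := index _ _ in idx *.
set z1 := i2%:Z - k%:Z + E - r => /andP[j1 j2].
have z1W : - W%:Z <= z1 /\ z1 <= W%:Z.
  move: idx inv1 f1 f2 g1 g2; rewrite /z1; generalize i2, E, r; clear; lia.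
have [|| q1 q2] := cw z1; [move: z1W; clear; lia|move: z1W; clear; lia|].
have [|| q3 q4] := cw (z1 - 1); [move: z1W; clear; lia|move: z1W; clear; lia|].
have J1 : j z1 = i2.+1 by rewrite /j /mid q1 q2 /z1; generalize i2, E, r; clear; lia.
have J2 : j (z1 - 1) = i2 by rewrite /j /mid q3 q4 /z1; generalize i2, E, r; clear; lia.
have [Xl|[//|Xr]] : X <= z1 - 1 \/ X = z1 \/ z1 <= X - 1 by clear; lia.
  by have := jm _ _ Xl; rewrite J2; move: j2; clear; lia.
by have := jm _ _ Xr; rewrite J1; move: j1; clear; lia.
Qed.

End GoodEvent.

(** * Asymptotics in the window *)

Lemma powR_ev (R : realType) (c a : R) : 0 < a -> \forall t \near +oo, c <= t `^ a.
Proof.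
move=> a0; near=> t.
have t1 : (Num.max c 1) `^ a^-1 <= t by near: t; exact: nbhs_pinfty_ge.
apply: (@le_trans _ _ (((Num.max c 1) `^ a^-1) `^ a)).
  rewrite -powRrM mulVf ?gt_eqF// powRr1 ?le_max ?lexx//.
  by rewrite ler01 orbT.
by apply: ge0_ler_powR => //; rewrite ?nnegrE ?powR_ge0// ?(le_trans (powR_ge0 _ _) t1)// ltW.
Unshelve. all: by end_near. Qed.

Lemma powR_ev2 (R : realType) (c a b : R) : a < b -> \forall t \near +oo, c * t `^ a <= t `^ b.
Proof.
move=> ab; near=> t; have t0 : 0 < t by near: t; exact: nbhs_pinfty_gt.
have -> : t `^ b = t `^ (b - a) * t `^ a by rewrite -powRD ?subrK// (gt_eqF t0) implybT.
by rewrite ler_wpM2r ?powR_ge0//; near: t; apply: powR_ev; rewrite subr_gt0.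
Unshelve. all: by end_near. Qed.

(** For [D >= t ^ dl] also [t <= exp (2 / dl * sqrt D)], so both factors are exponentials of
    [sqrt D] and lose against [g ^ D]. *)
Lemma exp_decay_ev (R : realType) (g K dl : R) : 0 <= g < 1 -> 0 < dl ->
  \forall t \near +oo, forall D : nat, t `^ dl <= D%:R -> g ^+ D * expR (K * Num.sqrt D%:R) * t <= 1.
Proof.
move=> /andP[g0 g1] dl0.
pose g' := Num.max g 2^-1; pose b := - ln g'.
have g'0 : 0 < g' by rewrite /g' lt_max invr_gt0 ltr0n orbT.
have g'1 : g' < 1 by rewrite /g' gt_max g1 invf_lt1// ltr1n.
have b0 : 0 < b by rewrite /b oppr_gt0 ln_lt0// g'0.
near=> t => D tD.
have t0 : 0 < t by near: t; exact: nbhs_pinfty_gt.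
have gE : g ^+ D <= expR (- b * D%:R).
  apply: (@le_trans _ _ (g' ^+ D)).
    by apply: lerXn2r; rewrite ?nnegrE ?(ltW g'0)// /g' le_max lexx.
  by rewrite -[g' in leLHS](@lnK R) ?posrE// -expRM_natr /b opprK.
have D1 : ((K + 2 / dl) / b) `^ 2 <= D%:R.
  by apply: le_trans tD; near: t; apply: powR_ev.
have D0 : 0 < D%:R :> R by apply: lt_le_trans tD; rewrite powR_gt0.
have sD0 : 0 < Num.sqrt D%:R :> R by rewrite sqrtr_gt0.
have sq : Num.sqrt D%:R * Num.sqrt D%:R = D%:R :> R by rewrite -expr2 sqr_sqrtr// ltW.
have tE : t <= expR (2 / dl * Num.sqrt D%:R).
  rewrite -[leLHS](@lnK R) ?posrE// ler_expR mulrAC ler_pdivlMr//.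
  have : dl * ln t <= ln D%:R.
    by rewrite -ln_powR ler_ln ?posrE ?powR_gt0.
  have : ln (Num.sqrt D%:R) <= Num.sqrt D%:R - 1 :> R.
    rewrite -ler_expR lnK ?posrE//; have := expR_ge1Dx (Num.sqrt D%:R - 1 : R).
    by move: (Num.sqrt _) => s; clear; lra.
  rewrite -[in ln D%:R]sq lnM ?posrE//.
  move: (ln t) (ln _) (Num.sqrt _) => u w s; clear; lra.
apply: (@le_trans _ _ (expR (- b * D%:R) * expR (K * Num.sqrt D%:R) * expR (2 / dl * Num.sqrt D%:R))).
  apply: ler_pM => //; first by rewrite mulr_ge0 ?exprn_ge0 ?expR_ge0.
  by rewrite ler_wpM2r ?expR_ge0.
rewrite -!expRD -[leRHS]expR0 ler_expR.
have : (K + 2 / dl) / b <= Num.sqrt D%:R.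
  have [n0|p0] := lerP ((K + 2 / dl) / b) 0; first exact: le_trans n0 (ltW sD0).
  rewrite -[leLHS]ger0_norm ?(ltW p0)// -sqrtr_sqr ler_sqrt ?(ltW D0)//.
  by rewrite -powR_mulrn ?(ltW p0).
rewrite ler_pdivrMr// => h1; rewrite -[X in - b * X]sq.
have : (K + 2 / dl) * Num.sqrt D%:R <= Num.sqrt D%:R * b * Num.sqrt D%:R by rewrite ler_wpM2r// ltW.
move: (2 / dl) (Num.sqrt _) => u s; clear; nra.
Unshelve. all: by end_near. Qed.

(** The first block takes the remainder of the division by [D]; by [D ^ 2 * h <= t / 10] it does not
    double the length. *)
Lemma block_lengths (R : realType) (t h : R) (J D : nat) : (0 < D)%N -> 0 <= h ->
  (D * D)%:R * h <= t / 10 -> 9 / 10 * t <= J%:R * h <= t ->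
  3 / 4 * t / D%:R <= (J %/ D)%:R * h /\ (J %/ D + J %% D)%:R * h <= 2 * (3 / 4 * t / D%:R).
Proof.
move=> D0 h0 hD /andP[h1 h2].
have D1 : 1 <= D%:R :> R by rewrite ler1n.
have Dp : 0 < D%:R :> R by rewrite ltr0n.
have JE : J%:R = (J %/ D)%:R * D%:R + (J %% D)%:R :> R by rewrite -natrM -natrD -divn_eq.
have rD : (J %% D)%:R <= D%:R :> R by rewrite ler_nat ltnW// ltn_mod.
have r0 : 0 <= (J %% D)%:R :> R by [].
have q0 : 0 <= (J %/ D)%:R :> R by [].
rewrite natrM in hD; rewrite natrD; move: ((J %% D)%:R) ((J %/ D)%:R) JE rD r0 q0 => r u JE rD r0 q0.
rewrite {}JE in h1 h2.
have rh : r * h <= D%:R * h by rewrite ler_wpM2r.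
have Dh : D%:R * h <= D%:R * D%:R * h by rewrite -mulrA ler_peMl// mulr_ge0// ltW.
have rDh : r * h * D%:R <= D%:R * D%:R * h by rewrite mulrAC ler_wpM2r// ler_wpM2r// ltW.
split.
  rewrite ler_pdivrMr//; move: h1 h2 hD rh Dh; clear; lra.
have rh0 : 0 <= r * h by rewrite mulr_ge0.
rewrite mulrA ler_pdivlMr//; move: h1 h2 hD rh Dh rDh rh0; clear; lra.
Qed.

(** With [D] blocks of scale [l], where [l ^ 2] is of order [t / D], the exponent is a distance of
    order [sqrt t] divided by [l], hence of order [sqrt D]. The factor [ga ^ D] from [blocks] wins,
    at the price of [D] particles per block, [D * D] in all. *)
Lemma tail_H (R : realType) (p q dl C : R) : 0 <= q -> q < p -> p + q = 1 -> 0 < dl < 1 -> 0 <= C ->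
  \forall t \near +oo, forall (D k B J : nat) (h : R) (z : int),
  t `^ dl <= D%:R <= 2 * t `^ dl -> (p - q) * (t - C * Num.sqrt t) <= k.+1%:R ->
  (D * D)%N%:Z <= - k%:Z - 1 + B%:Z -> 0 <= h -> h <= 16^-1 -> h * (B + B)%:R <= 1 ->
  (D * D)%:R * h <= t / 10 -> 9 / 10 * t <= J%:R * h <= t -> z \in box B -> - 2 * Num.sqrt t <= z%:~R ->
  Ex p q h (box B) hmove J (fun H => ((D * D)%N%:Z <= H z)%R%:R) (stepf (- k%:Z - 1)) <= t^-1.
Proof.
move=> q0 qp pq /andP[dl0 dl1] C0; have v0 : 0 < p - q by rewrite subr_gt0.
have [ga [th [s [N0 [r0 [ga01 th0 s01 r01 Hb]]]]]] := @block R p q q0 qp pq.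
have ga0 : 0 <= ga by case/andP: (ga01).
have s0 : 0 <= s by case/andP: (s01).
pose K := 2 * (th * ((p - q) * C + 2)).
near=> t => D k B J h z /andP[D1 D2] Hk DB h0 h16 hB hD hJ zB zt.
have t1 : 1 < t by near: t; exact: nbhs_pinfty_gt.
have t0 : 0 < t := lt_trans ltr01 t1.
have D2' : 2 <= D%:R :> R by apply: le_trans D1; near: t; exact: powR_ev.
have D0 : (0 < D)%N by rewrite -(ltr_nat R) (lt_le_trans _ D2')// ltr0n.
have Dp : 0 < D%:R :> R by rewrite ltr0n.
pose l := Num.sqrt (3 / 4 * t / D%:R).
have l20 : 0 < 3 / 4 * t / D%:R by rewrite divr_gt0// mulr_gt0.
have l2 : l ^+ 2 = 3 / 4 * t / D%:R by rewrite sqr_sqrtr// ltW.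
have l0 : 0 < l by rewrite sqrtr_gt0.
have N0D : (N0 <= D)%N by rewrite -(ler_nat R); apply: le_trans D1; near: t; exact: powR_ev.
have lt : l <= t.
  rewrite -(ler_pXn2r (_ : (0 < 2)%N)) ?nnegrE ?(ltW l0) ?(ltW t0)// l2 ler_pdivrMr// expr2.
  have : t <= t * t by rewrite ler_peMr ?(ltW t0) ?(ltW t1).
  move: D2' t0 t1; move: (D%:R) => x; clear; nra.
have sl : s ^+ D.-1 * l <= 1.
  have Dh : t `^ (dl / 2) <= D.-1%:R.
    have : 2 * t `^ (dl / 2) <= t `^ dl.
      by near: t; apply: powR_ev2; rewrite ltr_pdivrMr// ltr_pMr// ltr1n.
    have : 2 <= t `^ (dl / 2) by near: t; apply: powR_ev; rewrite divr_gt0.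
    have -> : D.-1%:R = D%:R - 1 :> R by rewrite -{2}(prednK D0) -natr1 addrK.
    move: D1; move: (t `^ _) (t `^ _) (D%:R) => a b c; clear; lra.
  have : s ^+ D.-1 * expR (0 * Num.sqrt D.-1%:R) * t <= 1.
    by move: (D.-1) Dh; near: t; apply: exp_decay_ev => //; rewrite divr_gt0.
  rewrite mul0r expR0 mulr1; apply: le_trans; rewrite ler_wpM2l// exprn_ge0//.
have r0l : r0 <= l.
  have r00 : 0 <= r0 := le_trans ler01 r01.
  rewrite -(ler_pXn2r (_ : (0 < 2)%N)) ?nnegrE ?(ltW l0)// l2 ler_pdivlMr//.
  have : (8 / 3 * r0 ^+ 2) * t `^ dl <= t `^ 1 by near: t; apply: powR_ev2.
  rewrite powRr1 ?(ltW t0)// => h1.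
  apply: (@le_trans _ _ (r0 ^+ 2 * (2 * t `^ dl))).
    by apply: ler_wpM2l => //; exact: sqr_ge0.
  move: h1; move: (r0 ^+ 2) (t `^ dl) => a b; clear; lra.
have [j1 j2] := block_lengths D0 h0 hD hJ; rewrite -l2 in j1 j2.
have HB j y : l ^+ 2 <= j%:R * h <= 2 * l ^+ 2 -> D%:Z <= y + B%:Z -> y <= B%:Z ->
   Ex p q h (box B) hmove j (fun H => expR (th / l * (xi B D H)%:R)) (stepf y) <=
   ga * expR (th / l * ((y + B%:Z)%:~R + (p - q) * (j%:R * h))).
  by move=> hj yD yB; apply: Hb.
have thl : 0 <= th / l by rewrite divr_ge0 ?ltW.
have := blocks q0 qp pq ga0 h0 hB D0 thl HB.
move=> /(_ (nseq D.-1 (J %/ D)%N) (J %/ D + J %% D)%N (- k%:Z - 1)).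
rewrite size_nseq (prednK D0) sumn_nseq.
have -> : (J %/ D + J %% D + J %/ D * D.-1)%N = J.
  by rewrite addnAC -mulnS (prednK D0) -divn_eq.
have jj : (J %/ D)%:R * h <= (J %/ D + J %% D)%:R * h by rewrite ler_wpM2r// ler_nat leq_addr.
have al : all (fun j => l ^+ 2 <= j%:R * h <= 2 * l ^+ 2) (nseq D.-1 (J %/ D)%N).
  by apply/allP => j /nseqP[-> _]; rewrite j1 (le_trans jj).
move=> /(_ ltac:(by rewrite (le_trans j1 jj)) al DB ltac:(clear; lia)) bl.
have p0 : 0 <= p by apply: le_trans (ltW qp).
apply: le_trans (@tail_xi R p q h B p0 q0 pq h0 hB J z (- k%:Z - 1) (D * D) (th / l) thl zB) _.
apply: le_trans (ler_wpM2l (expR_ge0 _) bl) _.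
rewrite mulrCA -expRD -(ler_pM2r t0) mulVf ?gt_eqF//.
apply: (@le_trans _ _ (ga ^+ D * expR (K * Num.sqrt D%:R) * t)); last first.
  by move: (D) D1; near: t; exact: exp_decay_ev.
rewrite ler_pM2r// ler_wpM2l ?exprn_ge0// ler_expR.
have sD : Num.sqrt D%:R * Num.sqrt D%:R = D%:R :> R by rewrite -expr2 sqr_sqrtr// ltW.
have sD0 : 0 < Num.sqrt D%:R :> R by rewrite sqrtr_gt0.
have sT : Num.sqrt t * Num.sqrt t = t by rewrite -expr2 sqr_sqrtr// ltW.
have sT0 : 0 < Num.sqrt t by rewrite sqrtr_gt0.
have lb : Num.sqrt t <= l * (2 * Num.sqrt D%:R).
  rewrite -(ler_pXn2r (_ : (0 < 2)%N)) ?nnegrE ?(ltW sT0) ?mulr_ge0 ?(ltW l0) ?(ltW sD0)//.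
  rewrite !exprMn l2 !sqr_sqrtr ?(ltW t0) ?(ltW Dp)//.
  rewrite [leRHS](_ : _ = 3 * t); first by move: t0; clear; lra.
  by field; rewrite gt_eqF.
rewrite [leLHS](_ : _ = th / l * (- z%:~R - 1 + ((- k%:Z - 1)%:~R + (p - q) * (J%:R * h)))); last first.
  by rewrite !rmorphD !rmorphN /= ; ring.
have le1 : - z%:~R - 1 + ((- k%:Z - 1)%:~R + (p - q) * (J%:R * h)) <= ((p - q) * C + 2) * Num.sqrt t.
  have : (p - q) * (J%:R * h) <= (p - q) * t by rewrite ler_wpM2l ?(ltW v0)//; case/andP: hJ.
  have -> : (- k%:Z - 1)%:~R = - k.+1%:R :> R by rewrite -natr1 rmorphB rmorphN /= ; ring.
  move: Hk zt; move: (z%:~R) (k.+1%:R) (J%:R * h) (Num.sqrt t) => a b c e; clear; nra.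
apply: le_trans (ler_wpM2l thl le1) _.
rewrite mulrAC ler_pdivrMr// /K.
have tv0 : 0 <= th * ((p - q) * C + 2) by rewrite mulr_ge0 ?(ltW th0)// addr_ge0// mulr_ge0// ltW.
rewrite [leLHS]mulrA; apply: le_trans (ler_wpM2l tv0 lb) _.
by rewrite le_eqVlt; apply/orP; left; apply/eqP; ring.
Unshelve. all: by end_near. Qed.

(** The order of choice is visible here: [t] and [k], a box so large that its boundary is not felt,
    and a time step small compared with the box. *)
Definition regime (R : realType) (p q dl C t : R) (D k B : nat) (h : R) : Prop :=
  [/\ t `^ dl <= D%:R <= 2 * t `^ dl, (p - q) * (t - C * Num.sqrt t) <= k.+1%:R,
      (D * D)%N%:Z <= - k%:Z - 1 + B%:Z, 0 <= h &
  [/\ h <= 16^-1, h * (B + B)%:R <= 1, (D * D)%:R * h <= t / 10, 2 * Num.sqrt t + 2 <= B%:R &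
      2 * Num.sqrt t * expR (8 * t + 2 * Num.sqrt t + 2 - B%:R) <= t^-1]].

(** Eight of the ten parts are [D * D / m] with [D <= 2 * t ^ dl] and [m >= sqrt t / 2]; the tail of
    the height and the boundary of the box take one each. *)
Definition rho (R : realType) (dl t : R) : R := 10 * (t `^ dl * t `^ dl) / Num.sqrt t.

Lemma truncn_half (R : realType) (x : R) : 2 <= x -> (Num.truncn x)%:R <= x /\ x <= 2 * (Num.truncn x)%:R.
Proof.
move=> x2; have x0 : 0 <= x by apply: le_trans x2.
have /andP[h1 h2] := truncn_itv x0; split => //; move: h2 x2; rewrite -natr1; clear; lra.
Qed.

Lemma density_H (R : realType) (p q dl C : R) : 0 <= q -> q < p -> p + q = 1 -> 0 < dl < 1 -> 0 <= C ->
  \forall t \near +oo, forall (D k B : nat) (h : R), regime p q dl C t D k B h ->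
  forall (J : nat), 9 / 10 * t <= J%:R * h <= t ->
  (forall z : int, `|z|%:~R <= 2 * Num.sqrt t ->
    Ex p q h (box B) hmove J (fun H => ((D * D)%N%:Z <= H z)%R%:R) (stepf (- k%:Z - 1)) <= t^-1) /\
  (forall z : int, `|z|%:~R <= Num.sqrt t ->
    Ex p q h (box B) hmove J (occ z) (stepf (- k%:Z - 1)) <= rho dl t).
Proof.
move=> q0 qp pq dl01 C0; have p0 : 0 <= p by apply: le_trans (ltW qp).
have dl0 : 0 < dl by case/andP: (dl01).
move: (tail_H q0 qp pq dl01 C0); apply: filter_app; near=> t => TH D k B h [D12 Hk DB h0 [h16 hB hD tB eB]] J hJ.
have t4 : 4 <= t by near: t; exact: nbhs_pinfty_ge.
have t0 : 0 < t by apply: lt_le_trans t4.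
have s2 : 2 <= Num.sqrt t.
  have -> : 2 = Num.sqrt 4 :> R.
    by rewrite (_ : 4 = 2 ^+ 2) ?sqrtr_sqr ?ger0_norm// -natrX.
  by rewrite ler_sqrt.
have s0 : 0 < Num.sqrt t by apply: lt_le_trans s2.
have sT : Num.sqrt t * Num.sqrt t = t by rewrite -expr2 sqr_sqrtr// ltW.
have T1 (z : int) : `|z|%:~R <= 2 * Num.sqrt t ->
    Ex p q h (box B) hmove J (fun H => ((D * D)%N%:Z <= H z)%R%:R) (stepf (- k%:Z - 1)) <= t^-1.
  rewrite intr_norm ler_norml => /andP[z1 z2].
  have zB : z \in box B.
    rewrite mem_box -(ler_int R) -(ltr_int R) rmorphN /= -!pmulrn; move: z1 z2 tB; clear => *.
    by apply/andP; split; lra.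
  by apply: TH => //; rewrite mulNr.
split => // z zs.
pose m := Num.truncn (Num.sqrt t).
have [m1 m2] := truncn_half s2; rewrite -/m in m1 m2.
have m0 : 0 < m%:R :> R by rewrite -(pmulr_rgt0 _ (_ : 0 < 2))// (lt_le_trans s0).
have yB : - k%:Z - 1 <= B%:Z by clear; lia.
have := @density R p q h B p0 q0 pq h0 hB J z (- k%:Z - 1) (`|z| + m%:Z) m (D * D) yB (lexx _).
set e := _ * expR _; set ta := Ex _ _ _ _ _ _ (fun H => (_ <= H (z - _))%R%:R) _; set r := Ex _ _ _ _ _ _ _ _ => mr.
have taB : ta <= t^-1.
  apply: T1; rewrite intr_norm rmorphB /= -pmulrn; apply: le_trans (ler_normB _ _) _.
  by rewrite -intr_norm (ger0_norm (ltW m0)) mulr_natl mulr2n lerD.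
have eB' : 2 * m%:R * e <= t^-1.
  apply: le_trans eB; apply: ler_pM => //.
  - by rewrite /e mulr_ge0 ?expR_ge0// exprn_ge0// addr_ge0// mulr_ge0.
  - by rewrite ler_wpM2l.
  rewrite /e; have h8 : (1 + 8 * h) ^+ J <= expR (8 * t).
    apply: (@le_trans _ _ (expR (8 * h) ^+ J)).
      by apply: lerXn2r; rewrite ?nnegrE ?expR_ge0 ?expR_ge1Dx// addr_ge0// mulr_ge0.
    rewrite -expRM_natr ler_expR -mulrA ler_wpM2l// mulrC; by case/andP: hJ.
  apply: le_trans (ler_wpM2r (expR_ge0 _) h8) _; rewrite -expRD ler_expR.
  rewrite rmorphD /= -pmulrn; move: zs m1; move: (_%:~R) (m%:R) (Num.sqrt t) (B%:R) => a b c f; clear; lra.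
have rE : r <= (D * D)%:R / m%:R + ta + 2 * m%:R * e.
  rewrite -(ler_pM2l m0); apply: le_trans mr _.
  rewrite le_eqVlt; apply/orP; left; apply/eqP; field; exact: lt0r_neq0.
have u1 : 1 <= t `^ dl by near: t; exact: powR_ev.
have case1 : (D * D)%:R / m%:R <= 8 * (t `^ dl * t `^ dl) / Num.sqrt t.
  rewrite ler_pdivrMr// mulrAC ler_pdivlMr// natrM.
  apply: (@le_trans _ _ ((2 * t `^ dl) * (2 * t `^ dl) * (2 * m%:R))).
    apply: ler_pM => //.
    by case/andP: D12 => _ D2; apply: ler_pM.
  rewrite le_eqVlt; apply/orP; left; apply/eqP; ring.
have case2 : t^-1 <= (t `^ dl * t `^ dl) / Num.sqrt t.
  rewrite ler_pdivlMr// mulrC ler_pdivrMr//; apply: (@le_trans _ _ (1 * t)); last first.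
    rewrite ler_wpM2r ?(ltW t0)// -[leLHS]mulr1; apply: ler_pM => //.
  by rewrite mul1r -[leRHS]sT ler_peMl ?(ltW s0)// (le_trans _ s2)// ler1n.
rewrite /rho; move: rE taB eB' case1 case2; rewrite -!mulrA.
move: (_ / m%:R) (_ * (m%:R * e)) (t^-1) (t `^ dl * _) => a b c f; clear; lra.
Unshelve. all: by end_near. Qed.

(** * The window is free and undisturbed with high probability *)

Section Flat.
Context {R : realType}.
Variables (p q h : R) (B : nat).
Hypotheses (p0 : 0 <= p) (q0 : 0 <= q) (pq : p + q = 1) (h0 : 0 <= h)
  (hL : h * (B + B)%:R <= 1).

Let hL' : h * (size (box B))%:R <= 1. Proof. by rewrite size_box. Qed.

Lemma not_flat_le W (a : nat) H : adm H -> (forall z, 0 <= H z) -> (4 * a <= W)%N ->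
  (~~ flat W H)%:R <= \sum_(i <- iota 0 (W + W).+1) occ (i%:Z - W%:Z) H + (a%:Z <= H (- W%:Z - 1)%R)%R%:R :> R.
Proof.
move=> aH H0 aW.
have -> : \sum_(i <- iota 0 (W + W).+1) occ (i%:Z - W%:Z) H = (H (- W%:Z - 1) - H W%:Z)%:~R :> R.
  have key n : \sum_(i <- iota 0 n) occ (i%:Z - W%:Z) H = (H (- W%:Z - 1) - H (n%:Z - W%:Z - 1))%:~R :> R.
    elim: n => [|n IH]; first by rewrite big_nil sub0r subrr.
    rewrite -addn1 iotaD big_cat /= big_seq1 IH add0n (occE p0 q0 h0 hL)// -intrD addn1.
    have -> : n.+1%:Z - W%:Z - 1 = n%:Z - W%:Z by clear; lia.
    by congr (_%:~R); ring.
  by rewrite key; congr (_ - H _)%:~R; clear; lia.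
have le := adm_le aH (_ : - W%:Z - 1 <= W%:Z); have h1 := H0 (- W%:Z - 1).
rewrite /flat h1 /=; have := le ltac:(clear; lia); move: (H W%:Z) (H (- W%:Z - 1)) h1 => u v v0 uv.
have [e|ne] := eqVneq v u => /=.
  rewrite e subrr add0r ler_nat -ltNge; case: ltP => // h2.
  by have -> : (a%:Z <= u)%R by move: h2 aW; clear; lia.
apply: (@le_trans _ _ ((v - u)%:~R)); last by rewrite lerDl.
by rewrite -[leLHS]/(1%:~R) ler_int; move: ne uv; clear; lia.
Qed.

Lemma not_flat_Ex W a J y (rh ta : R) : y <= B%:Z -> (4 * a <= W)%N ->
  (forall z : int, `|z| <= W%:Z -> Ex p q h (box B) hmove J (occ z) (stepf y) <= rh) ->
  Ex p q h (box B) hmove J (fun H => (a%:Z <= H (- W%:Z - 1)%R)%R%:R) (stepf y) <= ta ->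
  Ex p q h (box B) hmove J (fun H => (~~ flat W H)%:R) (stepf y) <= (W + W).+1%:R * rh + ta.
Proof.
move=> yB aW Hr Ht.
have invP c H : c.1 \in box B -> boxed B y H -> boxed B y (hmove c H) by exact: hmove_boxed.
have := Ex_le_in p0 q0 pq h0 hL' invP J (f := fun H => (~~ flat W H)%:R)
  (g := fun H => \sum_(i <- iota 0 (W + W).+1) occ (i%:Z - W%:Z) H + (a%:Z <= H (- W%:Z - 1)%R)%R%:R).
move=> /(_ _ _ (boxed_stepf B y)) le; apply: le_trans (le _) _.
  by move=> H bH; have [aH _] := bH; apply: not_flat_le => //; exact: boxed_ge0 bH.
rewrite Ex_addf Ex_sum; apply: lerD => //.
apply: (@le_trans _ _ (\sum_(i <- iota 0 (W + W).+1) rh)).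
  rewrite big_seq [leRHS]big_seq; apply: ler_sum => i; rewrite mem_iota => iW.
  by apply: Hr; move: iW; clear; lia.
by rewrite big_const_seq count_predT size_iota iter_addr_0 mulr_natl.
Qed.

(** [H z] can only change when one of the sites [z], [z + 1] is occupied. *)
Lemma cross_Ex z (a : int) m H0 :
  Ex p q h (box B) hmove m (fun H => (H z != a)%:R) H0 <=
  (H0 z != a)%:R + h * \sum_(j < m) (Ex p q h (box B) hmove j (occ z) H0 + Ex p q h (box B) hmove j (occ (z + 1)) H0).
Proof.
elim: m => [|m IH]; first by rewrite big_ord0 mulr0 addr0.
rewrite ExSr big_ord_recr /= mulrDr addrA.
apply: le_trans (lerD IH (lexx _)).
have := @Ex_lin R p q h (box B) _ hmove m 1 h (fun H => (H z != a)%:R) (fun H => occ z H + occ (z + 1) H).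
move=> /(congr1 (@^~ H0)) /=; rewrite mul1r Ex_addf => <-.
apply: (Ex_le p0 q0 pq h0 hL') => H; rewrite mul1r /stp lerD2l ler_wpM2l// /gen.
set o := _ + _; have o0 : 0 <= o by rewrite addr_ge0.
apply: (@le_trans _ _ (\sum_(b <- box B) (b == z)%:R * o)).
  apply: ler_sum => b _; rewrite /hmove /= (eq_sym z b); case: (eqVneq b z) => [->|_]; last first.
    by rewrite !subrr !mulr0 addr0 mul0r.
  rewrite mul1r -[leRHS]mul1r -[in leRHS]pq mulrDl.
  have [oz|oz] := eqVneq o 0.
    move: (oz) => /eqP; rewrite paddr_eq0// => /andP[]; rewrite /occ addrK !pnatr_eq0 !eqb0 !negbK => /eqP e1 /eqP e2.
    have -> : Num.min (H (z - 1)) (H (z + 1) + 1) = H z by rewrite e1 -e2; move: (H z) => u; clear; lia.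
    have -> : Num.max (H (z + 1)) (H (z - 1) - 1) = H z by rewrite e1 -e2; move: (H z) => u; clear; lia.
    by rewrite subrr oz.
  have o1 : 1 <= o by move: oz; rewrite /o /occ; rewrite -natrD pnatr_eq0 ler1n lt0n.
  have d1 (u v : bool) : u%:R - v%:R <= 1 :> R by case: u; case: v => /=; rewrite ?subrr ?subr0 ?sub0r ?ler01 ?lexx// (le_trans _ ler01)// oppr_le0.
  by apply: lerD; apply: ler_wpM2l => //; apply: le_trans (d1 _ _) o1.
rewrite -mulr_suml -natr_sum -[leRHS]mul1r ler_wpM2r//.
have -> : (\sum_(i <- box B) (i == z : nat))%N = count_mem z (box B).
  by rewrite -sum1_count [RHS]big_mkcond; apply: eq_bigr => i _ /=; case: (i == z).
by rewrite -[leRHS]/(1%:R) ler_nat count_uniq_mem ?uniq_box// leq_b1.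
Qed.

Lemma cross_Ex2 z m1 m2 (rh : R) y : 
  (forall j, (j < m2)%N -> Ex p q h (box B) hmove (m1 + j) (occ z) (stepf y) <= rh) ->
  (forall j, (j < m2)%N -> Ex p q h (box B) hmove (m1 + j) (occ (z + 1)) (stepf y) <= rh) ->
  Ex p q h (box B) hmove m1 (fun H0 => Ex p q h (box B) hmove m2 (fun H => (H z != H0 z)%:R) H0) (stepf y) <=
  m2%:R * h * (2 * rh).
Proof.
move=> r1 r2.
apply: (@le_trans _ _ (Ex p q h (box B) hmove m1 (fun H0 => h * \sum_(j < m2) (Ex p q h (box B) hmove j (occ z) H0 + Ex p q h (box B) hmove j (occ (z + 1)) H0)) (stepf y))).
  apply: (Ex_le p0 q0 pq h0 hL') => H0; apply: le_trans (cross_Ex z (H0 z) m2 H0) _.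
  by rewrite eqxx add0r.
rewrite Ex_scale Ex_sum (mulrC m2%:R) -[leRHS]mulrA ler_wpM2l//.
apply: (@le_trans _ _ (\sum_(j < m2) (rh + rh))); last first.
  by rewrite sumr_const card_ord mulr2n mulrDl mul1r mulr_natl.
apply: ler_sum => j _; rewrite Ex_addf -!Ex_add; apply: lerD; [exact: r1|exact: r2].
Qed.

(** Reflection and exchange of particles with holes reverse the order twice, so sorting remains
    sorting. *)
Lemma refl_hmove k c H : refl k (hmove c H) = hmove (- c.1 - 1, c.2) (refl k H).
Proof.
case: c => b d; apply/funext => z; rewrite /refl /hmove /=.
have -> : (- z - 1 == b) = (z == - b - 1) by apply/eqP/eqP; clear; lia.
case: eqP => // ->.
rewrite (_ : - (- b - 1 - 1) - 1 = b + 1); last by clear; lia.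
rewrite (_ : - (- b - 1 + 1) - 1 = b - 1); last by clear; lia.
by move: (H _) (H _) => u v; case: d; clear; lia.
Qed.

Lemma Ex_refl j (f : (int -> int) -> R) : Ex p q h (box B) (fun c => hmove (- c.1 - 1, c.2)) j f = Ex p q h (box B) hmove j f.
Proof.
apply: (Ex_reindex p q h (bs := box B) hmove (s := fun b => - b - 1)).
apply: uniq_perm; [|exact: uniq_box|].
  by rewrite map_inj_uniq ?uniq_box// => x y /=; clear; lia.
move=> b; apply/mapP/idP => [[x + ->]|]; rewrite !mem_box; first by clear; lia.
by move=> bB; exists (- b - 1); rewrite ?mem_box; move: bB; clear; lia.
Qed.

Lemma Ex_pr1 j f (e : env) : Ex p q h (box B) eact j (fun e => f e.1) e = Ex p q h (box B) hmove j f e.1.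
Proof. exact: (Ex_proj p0 q0 pq h0 hL' (act' := hmove) (inv := fun=> True) (pr := fst)). Qed.

Lemma Ex_pr2 k j f (e : env) : Ex p q h (box B) eact j (fun e => f (refl k e.2)) e = Ex p q h (box B) hmove j f (refl k e.2).
Proof.
rewrite -Ex_refl.
apply: (Ex_proj p0 q0 pq h0 hL' (inv := fun=> True) (pr := fun e : env => refl k e.2)) => // c x _ _.
exact: refl_hmove.
Qed.

Lemma Ex_env k j f (x : env * seq nat) : Ex p q h (box B) (fact k) j (fun x => f x.1) x = Ex p q h (box B) eact j f x.1.
Proof. exact: (Ex_proj p0 q0 pq h0 hL' (act' := eact) (inv := fun=> True) (pr := fst)). Qed.

End Flat.

Lemma calm_Ex (R : realType) (p q h : R) (B k W a J : nat) (rh ta : R) :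
  0 <= p -> 0 <= q -> p + q = 1 -> 0 <= h -> h * (B + B)%:R <= 1 -> (4 * a <= W)%N ->
  (forall z : int, `|z| <= W%:Z -> Ex p q h (box B) hmove J (occ z) (stepf (- k%:Z - 1)) <= rh) ->
  Ex p q h (box B) hmove J (fun H => (a%:Z <= H (- W%:Z - 1)%R)%R%:R) (stepf (- k%:Z - 1)) <= ta ->
  Ex p q h (box B) eact J (fun e => (~~ calm k W e)%:R) (x_start k).1 <= 2 * ((W + W).+1%:R * rh + ta).
Proof.
move=> p0 q0 pq h0 hL aW Hr Ht; have hL' : h * (size (box B))%:R <= 1 by rewrite size_box.
have yB : - k%:Z - 1 <= B%:Z by clear; lia.
have FH := not_flat_Ex p0 q0 pq h0 hL yB aW Hr Ht.
apply: (@le_trans _ _ (Ex p q h (box B) eact J (fun e => (~~ flat W e.1)%:R + (~~ flat W (refl k e.2))%:R) (x_start k).1)).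
  apply: (Ex_le p0 q0 pq h0 hL') => e; rewrite /calm; case: (flat W e.1); case: (flat W _) => //=; rewrite ?addr0 ?add0r ?lerDl//.
rewrite Ex_addf (Ex_pr1 p0 q0 pq h0 hL _ (fun H => (~~ flat W H)%:R)) (Ex_pr2 p0 q0 pq h0 hL _ _ (fun H => (~~ flat W H)%:R)).
rewrite mulr2n mulrDl !mul1r; apply: lerD => //.
rewrite (_ : refl k (x_start k).1.2 = stepf (- k%:Z - 1))//.
by apply/funext => z; rewrite /refl /x_start /stepf /=; clear; lia.
Qed.

(** The initial word has weight one in the stationary sum, so at every time its probabilities are
    below the unnormalized stationary ones. *)
Lemma inv_Ex (R : realType) (p q h tau : R) (B k n J : nat) :
  0 <= p -> 0 <= q -> p + q = 1 -> 0 <= h -> h * (B + B)%:R <= 1 -> 0 <= tau < 1 -> q = tau * p ->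
  Ex p q h (box B) (fact k) J (fun x => (n < invw x.2)%N%:R) (x_start k) <= ztail tau k n.
Proof.
move=> p0 q0 pq h0 hL t01 qE; have hL' : h * (size (box B))%:R <= 1 by rewrite size_box.
have tau0 : 0 <= tau by case/andP: t01.
have ie : einv k (x_start k).1 by have [] := xinv_start k.
have -> : ztail tau k n = avg tau k (Ex p q h (box B) (fact k) J (fun x => (n < invw x.2)%N%:R)) (x_start k).1.
  rewrite (avg_Ex p0 q0 pq h0 hL' qE)// (_ : avg _ _ _ = fun=> ztail tau k n) ?Ex_cst//.
  apply/funext => e; rewrite /avg /ztail [RHS]big_mkcond; apply: eq_bigr => c _ /=.
  by case: ltnP; rewrite ?mulr1 ?mulr0.
rewrite /avg (big_rem _ (gsP k)) /= invw_gs expr0 mul1r -/(x_start k) lerDl.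
apply: sumr_ge0 => c _; apply: mulr_ge0; first exact: exprn_ge0.
exact: (Ex_ge0 p0 q0 pq h0 hL').
Qed.

Lemma not_good_Ex (R : realType) (p q h tau : R) (B k W a m1 m2 : nat) (rh ta : R) :
  0 <= p -> 0 <= q -> p + q = 1 -> 0 <= h -> h * (B + B)%:R <= 1 -> 0 <= tau < 1 -> q = tau * p ->
  (4 * a <= W)%N ->
  (forall J (z : int), (m1 <= J <= m1 + m2)%N -> `|z| <= W%:Z + 1 -> Ex p q h (box B) hmove J (occ z) (stepf (- k%:Z - 1)) <= rh) ->
  (forall J, (m1 <= J <= m1 + m2)%N -> Ex p q h (box B) hmove J (fun H => (a%:Z <= H (- W%:Z - 1)%R)%R%:R) (stepf (- k%:Z - 1)) <= ta) ->
  Ex p q h (box B) (fact k) m1 (fun xs => Ex p q h (box B) (fact k) m2 (fun xt => (~~ good k W xs xt)%:R) xs) (x_start k)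
  <= 4 * ((W + W).+1%:R * rh + ta) + 2 * (m2%:R * h * (2 * rh)) + 2 * ztail tau k (W %/ 4)%N.
Proof.
move=> p0 q0 pq h0 hL t01 qE aW Hr Ht; have hL' : h * (size (box B))%:R <= 1 by rewrite size_box.
pose nc (e : env) : R := (~~ calm k W e)%:R; pose ni (x : env * seq nat) : R := (W %/ 4 < invw x.2)%N%:R.
pose c1 (xs xt : env * seq nat) : R := (xt.1.1 (- W%:Z - 1) != xs.1.1 (- W%:Z - 1))%:R.
pose c2 (xs xt : env * seq nat) : R := (refl k xt.1.2 (- W%:Z - 1) != refl k xs.1.2 (- W%:Z - 1))%:R.
pose EE F := Ex p q h (box B) (fact k) m1 (fun xs => Ex p q h (box B) (fact k) m2 (F xs) xs) (x_start k).
have EED F G : EE (fun xs xt => F xs xt + G xs xt) = EE F + EE G.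
  rewrite /EE (_ : (fun xs => _) = (fun xs => Ex p q h (box B) (fact k) m2 (F xs) xs + Ex p q h (box B) (fact k) m2 (G xs) xs)).
    by rewrite Ex_addf.
  by apply/funext => xs; rewrite Ex_addf.
have EEs f : EE (fun xs _ => f xs) = Ex p q h (box B) (fact k) m1 f (x_start k).
  by rewrite /EE; congr (Ex _ _ _ _ _ _ _ _); apply/funext => xs; rewrite Ex_cst.
have EEt f : EE (fun _ xt => f xt) = Ex p q h (box B) (fact k) (m1 + m2) f (x_start k).
  by rewrite Ex_add.
have le0 : EE (fun xs xt => (~~ good k W xs xt)%:R) <=
    EE (fun xs xt => (nc xs.1 + nc xt.1) + (c1 xs xt + c2 xs xt) + (ni xs + ni xt)).
  apply: (Ex_le p0 q0 pq h0 hL') => xs; apply: (Ex_le p0 q0 pq h0 hL') => xt.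
  rewrite -[leLHS]/((~~ good k W xs xt)%:R) /nc /c1 /c2 /ni -!natrD ler_nat /good.
  rewrite (eq_sym (xs.1.1 _)) (eq_sym (refl k xs.1.2 _)) !ltnNge.
  have i1 x : (invw x <= W %/ 4)%N = (4 * invw x <= W)%N by rewrite leq_divRL// mulnC.
  rewrite !i1; move: (calm _ _ _) (calm _ _ _) (_ == _) (_ == _) (4 * invw xs.2 <= W)%N (4 * invw xt.2 <= W)%N.
  by do 6 case.
apply: le_trans le0 _; rewrite !EED !EEs !EEt.
have calmB J : (m1 <= J <= m1 + m2)%N -> Ex p q h (box B) (fact k) J (fun x => nc x.1) (x_start k) <= 2 * ((W + W).+1%:R * rh + ta).
  move=> mJ; rewrite (Ex_env p0 q0 pq h0 hL).
  apply: calm_Ex aW _ _ => // [z zW|]; last exact: Ht.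
  by apply: Hr => //; move: zW; clear; lia.
have invB J : Ex p q h (box B) (fact k) J ni (x_start k) <= ztail tau k (W %/ 4)%N by exact: inv_Ex.
have crossB : Ex p q h (box B) hmove m1 (fun H0 => Ex p q h (box B) hmove m2 (fun H => (H (- W%:Z - 1) != H0 (- W%:Z - 1))%:R) H0) (stepf (- k%:Z - 1))
     <= m2%:R * h * (2 * rh).
  apply: (cross_Ex2 p0 q0 pq h0 hL) => j jm; apply: Hr; rewrite ?leq_addr ?leq_add2l ?(ltnW jm)//.
    by clear; lia.
  by clear; lia.
have C1 : EE c1 <= m2%:R * h * (2 * rh).
  apply: le_trans crossB; rewrite le_eqVlt; apply/orP; left; apply/eqP.
  set f := (fun H0 : int -> int => _).
  rewrite -[RHS](Ex_pr1 p0 q0 pq h0 hL m1 f (x_start k).1) -(Ex_env p0 q0 pq h0 hL k m1 (fun e => f e.1)) /EE /c1 /f.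
  congr (Ex _ _ _ _ _ _ _ _); apply/funext => xs.
  rewrite -(Ex_pr1 p0 q0 pq h0 hL _ (fun H => (H (- W%:Z - 1) != xs.1.1 (- W%:Z - 1))%:R)).
  by rewrite -(Ex_env p0 q0 pq h0 hL k m2 (fun e : env => (e.1 (- W%:Z - 1) != xs.1.1 (- W%:Z - 1))%:R)).
have C2 : EE c2 <= m2%:R * h * (2 * rh).
  apply: le_trans crossB; rewrite le_eqVlt; apply/orP; left; apply/eqP.
  have -> : stepf (- k%:Z - 1) = refl k (x_start k).1.2.
    by apply/funext => z; rewrite /refl /x_start /stepf /=; clear; lia.
  set f := (fun H0 : int -> int => _).
  rewrite -[RHS](Ex_pr2 p0 q0 pq h0 hL k m1 f (x_start k).1) -(Ex_env p0 q0 pq h0 hL k m1 (fun e => f (refl k e.2))) /EE /c2 /f.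
  congr (Ex _ _ _ _ _ _ _ _); apply/funext => xs.
  rewrite -(Ex_pr2 p0 q0 pq h0 hL _ _ (fun H => (H (- W%:Z - 1) != refl k xs.1.2 (- W%:Z - 1))%:R)).
  by rewrite -(Ex_env p0 q0 pq h0 hL k m2 (fun e : env => (refl k e.2 (- W%:Z - 1) != refl k xs.1.2 (- W%:Z - 1))%:R)).
have B1 := calmB m1 ltac:(by rewrite leqnn leq_addr).
have B2 := calmB (m1 + m2)%N ltac:(by rewrite leq_addr leqnn).
have B3 := invB m1; have B4 := invB (m1 + m2)%N.
apply: (@le_trans _ _ (2 * ((W + W).+1%:R * rh + ta) + 2 * ((W + W).+1%:R * rh + ta) + (m2%:R * h * (2 * rh) + m2%:R * h * (2 * rh)) + (ztail tau k (W %/ 4)%N + ztail tau k (W %/ 4)%N))).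
  by do ! apply: lerD.
rewrite le_eqVlt; apply/orP; left; apply/eqP; ring.
Qed.

(** * The choice of all parameters of the chain *)

(** The largest integer strictly below [t ^ chi]; applied with [chi'], it turns the strict
    conditions of [calP] and [calH] into [- W <= x] and [h <= W]. *)
Definition window (R : realType) (chi t : R) : nat := absz (Num.ceil (t `^ chi) - 1).

Lemma windowE (R : realType) (chi t : R) : 0 < chi -> 1 <= t ->
  (window chi t)%:Z = Num.ceil (t `^ chi) - 1.
Proof.
move=> c0 t1; rewrite /window gez0_abs// subr_ge0 -gtz0_ge1.
by rewrite ceil_gt0 powR_gt0// (lt_le_trans ltr01).
Qed.

Lemma window_bounds (R : realType) (chi t : R) : 0 < chi -> 1 <= t ->
  t `^ chi - 1 <= (window chi t)%:R /\ (window chi t)%:R <= t `^ chi.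
Proof.
move=> c0 t1; rewrite -[(window chi t)%:R]/((window chi t)%:Z%:~R) windowE// rmorphB /=.
have := ceil_itv (t `^ chi) => /andP[]; rewrite rmorphB /=.
move: ((Num.ceil _)%:~R) => x; clear; split; lra.
Qed.

(** The error budget of [mixing]: eight times [e0] and four times [Zm * e0], whence the 12. *)
Lemma sum_le_eta (R : realType) (eta Zm Z hl W1 zt e0 : R) : 0 < eta -> 1 <= Zm -> Z <= Zm -> 1 <= Z ->
  e0 = eta / (12 * Zm) -> hl <= e0 -> Z * W1 <= 2 * e0 -> zt <= e0 ->
  2 * hl + 2 * (Z * W1 + zt + Z * (2 * e0)) <= eta.
Proof.
move=> eta0 Zm1 ZZm Z1 e0E h1 h2 h3.
have Zm0 : 0 < Zm := lt_le_trans ltr01 Zm1.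
have e00 : 0 < e0 by rewrite e0E divr_gt0// mulr_gt0.
have E1 : 12 * Zm * e0 = eta by rewrite e0E mulrC divfK// gt_eqF// mulr_gt0.
have E2 : Z * (2 * e0) <= Zm * (2 * e0) by rewrite ler_wpM2r// mulr_ge0// ltW.
have E3 : e0 <= Zm * e0 by rewrite ler_peMl// ltW.
move: E1 E2 E3 h1 h2 h3; move: (Z * W1) (Z * _) => a b; clear; lra.
Qed.

Theorem chain_main (R : realType) (p q chi chi' C eta : R) :
  2^-1 < p <= 1 -> q = 1 - p -> 0 < chi < 2^-1 -> chi < chi' < 2^-1 -> 0 <= C -> 0 < eta ->
  \forall t \near +oo, forall k : nat, (p - q) * (t - C * Num.sqrt t) <= k.+1%:R ->
  exists B0 : nat, forall B, (B0 <= B)%N -> exists2 h0 : R, 0 < h0 & forall h, 0 < h <= h0 ->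
  forall m1 m2 : nat, 9 / 10 * t <= m1%:R * h -> (m1 + m2)%:R * h <= t ->
  t `^ chi / 2 <= m2%:R * h <= t `^ chi ->
  Ex p q h (box B) (fact k) m1 (fun xs => Ex p q h (box B) (fact k) m2
    (fun xt => (~~ good k (window chi' t) xs xt)%:R) xs) (x_start k) <= eta /\
  forall phi, (forall c, 0 <= phi c <= 1) ->
  `|Ex p q h (box B) (fact k) (m1 + m2) (fun x => phi x.2) (x_start k) - stat (q / p) k phi| <= eta.
Proof.
move=> /andP[p2 p1] qE /andP[chi0 chi2] /andP[chi'1 chi'2] C0 eta0.
have pp : 0 < p by apply: lt_trans p2; rewrite invr_gt0.
have p0 := ltW pp.
have q0 : 0 <= q by rewrite qE subr_ge0.
have pq : p + q = 1 by rewrite qE addrC subrK.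
have qp : q < p by rewrite qE; move: p2; clear; lra.
pose tau := q / p.
have tau01 : 0 <= tau < 1 by rewrite /tau divr_ge0//= ltr_pdivrMr// mul1r.
have qtp : q = tau * p by rewrite /tau divfK// gt_eqF.
have chi'0 : 0 < chi' by apply: lt_trans chi'1.
(* [D * D], of order [t ^ (2 * dl)], must be small against the window, and the mean number
   [t ^ (chi' + 2 * dl - 1 / 2)] of environment particles in it must vanish. *)
pose dl := Num.min chi' (2^-1 - chi') / 4.
have mn0 : 0 < Num.min chi' (2^-1 - chi') by rewrite lt_min chi'0 subr_gt0.
have mn1 : Num.min chi' (2^-1 - chi') <= chi' by rewrite ge_min lexx.
have mn2 : Num.min chi' (2^-1 - chi') <= 2^-1 - chi' by rewrite ge_min lexx orbT.
have dl01 : 0 < dl < 1 by rewrite /dl; move: mn0 mn1 chi'2; clear; move: (Num.min _ _) => x *; apply/andP; split; lra.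
have dl0 : 0 < dl by case/andP: (dl01).
have d1 : dl + dl < chi' by rewrite /dl; move: mn0 mn1; clear; move: (Num.min _ _) => x *; lra.
have d2 : chi' + (dl + dl) < 2^-1 by rewrite /dl; move: mn0 mn2; clear; move: (Num.min _ _) => x *; lra.
pose Zm := Num.max 1 (Zmax tau); have Zm1 : 1 <= Zm by rewrite /Zm le_max lexx.
have Zm0 : 0 < Zm := lt_le_trans ltr01 Zm1.
pose e0 := eta / (12 * Zm); have e00 : 0 < e0 by rewrite /e0 divr_gt0// mulr_gt0.
have e0E : e0 = eta / (12 * Zm) by []; clearbody e0.
have [I HI] : exists I, Num.sqrt tau ^+ I * Zmax (Num.sqrt tau) <= e0.
  have eZ : 0 < e0 / (Zmax (Num.sqrt tau) + 1) by rewrite divr_gt0// ltr_wpDl// Zmax_ge0.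
  have [N HN] := small_pow (sqrt01 tau01) eZ.
  exists N; have Z0 := Zmax_ge0 tau01.
  apply: le_trans (ler_wpM2r Z0 (HN N (leqnn N))) _.
  by rewrite mulrAC ler_pdivrMr ?ltr_wpDl// ler_pM2l// lerDl.
have ztI k n : (I <= n)%N -> ztail tau k n <= e0.
  move=> In; apply: le_trans (ztail_le tau01 k n) _; apply: le_trans HI.
  rewrite ler_wpM2r ?Zmax_ge0//; have /andP[s0 s1] := sqrt01 tau01.
  by rewrite ler_wiXn2l// ltW.
(* The parameter [dl] of [mixing], chosen such that the undissipated part costs at most [e0]. The
   constant [ka] that it leaves in the other part is beaten by the length [t ^ chi / 2] of the time
   interval. *)
pose del := e0 / (Zm * I.+1%:R); have del0 : 0 < del by rewrite /del divr_gt0// mulr_gt0.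
pose ka := (del * (p * q * tau ^+ I))^-1.
have ka0 : 0 <= ka.
  rewrite /ka invr_ge0; apply: mulr_ge0; first exact: ltW.
  by apply: mulr_ge0; [exact: mulr_ge0 | apply: exprn_ge0; case/andP: (tau01)].
move: (density_H q0 qp pq dl01 C0); apply: filter_app; near=> t => DH k Hk.
have t1 : 1 <= t by near: t; exact: nbhs_pinfty_ge.
have t0 : 0 < t := lt_le_trans ltr01 t1.
pose W := window chi' t; have [W1 W2] := window_bounds chi'0 t1; rewrite -/W in W1 W2.
pose D := (Num.truncn (t `^ dl)).+1.
have D12 : t `^ dl <= D%:R <= 2 * t `^ dl.
  have /andP[a1 a2] := truncn_itv (powR_ge0 t dl); rewrite (ltW a2) /=.
  have -> : D%:R = (Num.truncn (t `^ dl))%:R + 1 :> R by rewrite /D -natr1.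
  have : 1 <= t `^ dl by near: t; exact: powR_ev.
  by move: a1; clear; lra.
have WD : (4 * (D * D) <= W)%N.
  rewrite -(ler_nat R) !natrM; apply: le_trans W1.
  have b1 : 32 * t `^ (dl + dl) <= t `^ chi' by near: t; exact: powR_ev2.
  have b2 : 2 <= t `^ chi' by near: t; exact: powR_ev.
  have b3 : D%:R * D%:R <= (2 * t `^ dl) * (2 * t `^ dl) by case/andP: D12 => _ h; apply: ler_pM.
  have b4 : t `^ (dl + dl) = t `^ dl * t `^ dl by rewrite powRD// (gt_eqF t0) implybT.
  by move: b1 b2 b3; rewrite b4; clear; lra.
have WI : (4 * I + 8 <= W)%N.
  rewrite -(ler_nat R); apply: le_trans W1; rewrite -lerBlDr opprK.
  by near: t; exact: powR_ev.
have sE : Num.sqrt t = t `^ 2^-1 by rewrite powR12_sqrt// ltW.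
have s0 : 0 < Num.sqrt t by rewrite sqrtr_gt0.
have Ws : (W%:Z + 1)%:~R <= Num.sqrt t.
  rewrite rmorphD /= -pmulrn; apply: le_trans (lerD W2 (lexx 1)) _.
  have : 2 * t `^ chi' <= t `^ 2^-1 by near: t; apply: powR_ev2.
  have : 1 <= t `^ chi' by near: t; exact: powR_ev.
  rewrite sE; clear; lra.
have rhoE : (W + W).+1%:R * rho dl t + t^-1 <= e0.
  have h1 : (60 / e0) * t `^ (chi' + (dl + dl)) <= t `^ 2^-1 by near: t; exact: powR_ev2.
  have h2 : 2 / e0 <= t `^ 1 by near: t; exact: powR_ev.
  have h3 : 1 <= t `^ chi' by near: t; exact: powR_ev.
  have h4 : (W + W).+1%:R <= 3 * t `^ chi' by rewrite -natr1 natrD; move: W2 h3; clear; lra.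
  have -> : e0 = e0 / 2 + e0 / 2 by field.
  apply: lerD; last first.
    move: h2; rewrite powRr1 ?(ltW t0)// ler_pdivrMr// => h2.
    rewrite -[leLHS]mul1r ler_pdivrMr//; move: h2; clear; lra.
  rewrite /rho mulrA ler_pdivrMr// sE.
  apply: (@le_trans _ _ (3 * t `^ chi' * (10 * (t `^ dl * t `^ dl)))).
    by apply: ler_wpM2r => //; rewrite !mulr_ge0 ?powR_ge0.
  have -> : 3 * t `^ chi' * (10 * (t `^ dl * t `^ dl)) = (e0 / 2) * (60 / e0 * (t `^ (chi' + (dl + dl)))).
    rewrite !powRD ?(gt_eqF t0) ?implybT//; field; exact: lt0r_neq0.
  by rewrite ler_pM2l ?divr_gt0.
have mixE : Zm * I%:R * (Zm * 2 * ka) <= e0 * t `^ chi.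
  rewrite [leRHS]mulrC -ler_pdivrMr//; near: t; exact: powR_ev.
have [B0 HB0] : exists B0 : nat, forall B, (B0 <= B)%N ->
    [/\ (D * D)%N%:Z <= - k%:Z - 1 + B%:Z, (W < B)%N, 2 * Num.sqrt t + 2 <= B%:R &
      2 * Num.sqrt t * expR (8 * t + 2 * Num.sqrt t + 2 - B%:R) <= t^-1].
  pose K := 8 * t + 2 * Num.sqrt t + 2 + t * (2 * Num.sqrt t).
  exists (D * D + k + 1 + W.+1 + (Num.truncn K).+1)%N => B HB.
  have KB : K <= B%:R.
    apply: le_trans (_ : (Num.truncn K).+1%:R <= _).
      apply: ltW; apply: truncnS_gt.
    by rewrite ler_nat; move: HB; clear; lia.
  have ts : 0 <= t * (2 * Num.sqrt t) by rewrite !mulr_ge0 ?(ltW t0) ?(ltW s0).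
  split; [by move: HB; clear; lia|by move: HB; clear; lia| |].
    by apply: le_trans KB; rewrite /K; move: ts t0; clear; lra.
  rewrite -[leRHS]mul1r ler_pdivlMr// mulrAC.
  apply: (@le_trans _ _ (t * (2 * Num.sqrt t) * expR (- (t * (2 * Num.sqrt t))))).
    rewrite (mulrC _ t) ler_wpM2l// ler_expR; move: KB; rewrite /K; clear; lra.
  rewrite expRN ler_pdivrMr ?expR_gt0// mul1r.
  by apply: le_trans (expR_ge1Dx _); rewrite lerDr.
exists B0 => B /HB0[HD WB tB eB].
(* Each summand enforces one smallness condition on [h <= M0^-1]. *)
pose M0 := 16 + (B + B)%:R + (B + B)%:R / e0 + (D * D)%:R * 10 / t.
have M1 : 0 < M0 by rewrite /M0 !ltr_wpDr ?divr_ge0 ?mulr_ge0 ?(ltW e00) ?(ltW t0).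
exists M0^-1 => [|h /andP[h0 hM] m1 m2 Hm1 Hm12 /andP[Hm2 Hm2']]; first by rewrite invr_gt0.
have hM' : h * M0 <= 1 by rewrite -ler_pdivlMr// mul1r.
have hb : 0 <= h * (B + B)%:R by rewrite mulr_ge0// ltW.
have hbe : 0 <= h * ((B + B)%:R / e0) by rewrite mulr_ge0 ?(ltW h0)// divr_ge0// ltW.
have hbd : 0 <= h * ((D * D)%:R * 10 / t) by rewrite mulr_ge0 ?(ltW h0)// divr_ge0 ?mulr_ge0// ltW.
have {}hM' : 16 * h + h * (B + B)%:R + h * ((B + B)%:R / e0) + h * ((D * D)%:R * 10 / t) <= 1.
  apply: le_trans hM'; rewrite le_eqVlt; apply/orP; left; apply/eqP; rewrite /M0; ring.
have h16 : h <= 16^-1 by move: hM' hb hbe hbd; clear; lra.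
have hB : h * (B + B)%:R <= 1 by move: hM' hbe hbd h0; clear; lra.
have he : h * (B + B)%:R <= e0.
  have : h * ((B + B)%:R / e0) <= 1 by move: hM' hb hbd h0; clear; lra.
  by rewrite mulrA ler_pdivrMr// mul1r.
have hD : (D * D)%:R * h <= t / 10.
  have : h * ((D * D)%:R * 10 / t) <= 1 by move: hM' hb hbe h0; clear; lra.
  rewrite !mulrA ler_pdivrMr// mul1r; move: t0; clear; lra.
have reg : regime p q dl C t D k B h.
  by split => //; exact: ltW.
have JJ J : (m1 <= J <= m1 + m2)%N -> 9 / 10 * t <= J%:R * h <= t.
  move=> /andP[J1 J2]; apply/andP; split.
    by apply: le_trans Hm1 _; rewrite ler_wpM2r ?(ltW h0)// ler_nat.
  by apply: le_trans Hm12; rewrite ler_wpM2r ?(ltW h0)// ler_nat.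
have Hr J (z : int) : (m1 <= J <= m1 + m2)%N -> `|z| <= W%:Z + 1 ->
    Ex p q h (box B) hmove J (occ z) (stepf (- k%:Z - 1)) <= rho dl t.
  move=> mJ zW; have [_ H] := DH D k B h reg J (JJ J mJ); apply: H.
  by apply: le_trans Ws; rewrite ler_int.
have Ht J : (m1 <= J <= m1 + m2)%N ->
    Ex p q h (box B) hmove J (fun H => ((D * D)%N%:Z <= H (- W%:Z - 1)%R)%R%:R) (stepf (- k%:Z - 1)) <= t^-1.
  move=> mJ; have [H _] := DH D k B h reg J (JJ J mJ); apply: H.
  have -> : `|- W%:Z - 1| = W%:Z + 1 by clear; lia.
  by apply: le_trans Ws _; rewrite ler_peMl// ?ltW// ltr1n.
have hL' : h * (size (box B))%:R <= 1 by rewrite size_box.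
have rho0 : 0 <= rho dl t by rewrite /rho divr_ge0 ?(ltW s0)// !mulr_ge0 ?powR_ge0.
have m2rho : m2%:R * h * (2 * rho dl t) <= e0.
  apply: le_trans rhoE; apply: (@le_trans _ _ ((W + W).+1%:R * rho dl t)); last by rewrite lerDl invr_ge0 ltW.
  rewrite mulrA ler_wpM2r//; apply: (@le_trans _ _ (2 * t `^ chi)); first by rewrite mulrC ler_wpM2l.
  have : t `^ chi <= t `^ chi' by rewrite ler_powR// ltW.
  have : 2 * t `^ chi <= t `^ chi' by near: t; exact: powR_ev2.
  have : 1 <= t `^ chi' by near: t; exact: powR_ev.
  have -> : (W + W).+1%:R = W%:R + W%:R + 1 :> R by rewrite -natr1 natrD.
  move: W1; clear; lra.
have e0eta : 8 * e0 <= eta.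
  rewrite e0E mulrA ler_pdivrMr ?mulr_gt0// mulrC ler_pM2l//; move: Zm1; clear; lra.
have W4 : (I <= W %/ 4)%N by rewrite leq_divRL//; move: WI; clear; lia.
split.
  apply: le_trans (not_good_Ex p0 q0 pq (ltW h0) hB tau01 qtp WD Hr Ht) _.
  have := ztI k _ W4; move: rhoE m2rho e0eta; clear.
  by move: (_ * rho _ _ + _) (_ * h * _) (ztail _ _ _) => a b c; lra.
move=> phi phi01.
have m20 : (0 < m2)%N.
  rewrite lt0n; apply/eqP => m0; move: Hm2; rewrite m0 mul0r leNgt divr_gt0// powR_gt0//.
have ie : einv k (x_start k).1 by have [] := xinv_start k.
have Hfree i : (i < m2)%N -> Ex p q h (box B) eact (m1 + i) (fun e => (~~ `[< free k (box B) I e >])%:R) (x_start k).1 <= 2 * e0.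
  move=> im; have mJ : (m1 <= m1 + i <= m1 + m2)%N by rewrite leq_addr leq_add2l ltnW.
  have cE : Ex p q h (box B) eact (m1 + i) (fun e => (~~ calm k W e)%:R) (x_start k).1 <= 2 * e0.
    apply: (le_trans (calm_Ex p0 q0 pq (ltW h0) hB WD _ (Ht _ mJ))) => [z zW|].
      by apply: Hr => //; move: zW; clear; lia.
    by rewrite ler_pM2l.
  apply: le_trans cE; apply: (Ex_le_in p0 q0 pq (ltW h0) hL' (inv := einv k)) => // [c e _|e ee]; first exact: einv_eact.
  case: (boolP (calm k W e)) => ce; last by case: asboolP.
  by rewrite (asboolT (calm_free ee ce WI WB)).
have := mixing p0 q0 pq (ltW h0) hL' tau01 qtp phi01 ie m20 h0 del0 Hfree.
rewrite size_box => MX; apply: le_trans MX _.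
have Zk1 := wsum_gs_ge1 tau01 k.
have ZkZm : wsum tau (gs k) <= Zm by rewrite /Zm le_max Zk_le ?orbT.
apply: (sum_le_eta eta0 Zm1 ZkZm Zk1 e0E he) => //; last exact: ztI.
rewrite -/ka mulrDr mulrDr (_ : 2 * e0 = e0 + e0); last by rewrite mulr2n mulrDl mul1r.
have Zk0 : 0 <= wsum tau (gs k) := le_trans ler01 Zk1.
apply: lerD.
  apply: (@le_trans _ _ (Zm * (I.+1%:R * del))).
    apply: ler_pM => //; first by rewrite mulr_ge0// ltW.
    by rewrite ler_wpM2r ?(ltW del0)// ler_nat.
  by rewrite mulrA /del mulrC divfK// gt_eqF// mulr_gt0.
have hm0 : 0 < h * m2%:R by rewrite mulr_gt0// ltr0n.
have tc0 : 0 < t `^ chi by rewrite powR_gt0.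
have q1 : wsum tau (gs k) / (h * m2%:R) <= Zm * 2 / t `^ chi.
  rewrite ler_pdivlMr// mulrAC ler_pdivrMr// -mulrA; apply: ler_pM => //; first exact: ltW.
  by move: Hm2; rewrite (mulrC h); clear; lra.
apply: (@le_trans _ _ (Zm * (I%:R * (Zm * 2 / t `^ chi * ka)))).
  apply: ler_pM => //; first by rewrite !mulr_ge0// invr_ge0 ltW.
  by rewrite ler_wpM2l// ler_wpM2r.
have -> : Zm * (I%:R * (Zm * 2 / t `^ chi * ka)) = (Zm * I%:R * (Zm * 2 * ka)) / t `^ chi.
  by field; exact: lt0r_neq0.
by rewrite ler_pdivrMr.
Unshelve. all: by end_near. Qed.

(** * Poisson clocks on a grid *)

Lemma poisson01 (R : realType) (r : R) (b : bool) : 0 <= r ->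
  poisson_prob r 0 [set (b : nat)] = ((if b then r else 1) * expR (- r))%:E.
Proof.
move=> r0; rewrite /poisson_prob; case: ltP => [rp|rn].
  rewrite esum_set1 ?lee_fin ?poisson_pmf_ge0// /poisson_pmf rp.
  by case: b => /=; rewrite ?expr1 ?expr0 ?factS ?fact0 ?invr1 ?mulr1 ?mul1r.
have -> : r = 0 by apply/eqP; rewrite eq_le rn r0.
rewrite oppr0 expR0 mulr1 /dirac indicE; case: b => /=.
  by rewrite memNset//= => -[].
by rewrite mem_set.
Qed.

Definition bonds (B : nat) : seq (int * bool) := [seq (b, d) | b <- box B, d <- [:: true; false]].

Lemma mem_bonds B c : (c \in bonds B) = (c.1 \in box B).
Proof.
apply/allpairsP/idP => [[[b d] [/= bB _ ->]]|cB] //.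
by exists (c.1, c.2); split=> //=; [case: c.2|case: c cB].
Qed.

Lemma uniq_bonds B : uniq (bonds B).
Proof. by apply: allpairs_uniq => //; [exact: uniq_box|by move=> [? ?] [? ?] _ _ [-> ->]]. Qed.

Lemma sum_bonds (R : realType) B (F : int * bool -> R) :
  \sum_(c <- bonds B) F c = \sum_(b <- box B) (F (b, true) + F (b, false)).
Proof.
rewrite /bonds big_allpairs_dep /=; apply: eq_bigr => b _.
by rewrite !big_cons big_nil addr0.
Qed.

Definition mark := option (int * bool).
Definition letters (B : nat) : seq mark := None :: [seq Some c | c <- bonds B].

Fixpoint words (B m : nat) : seq (seq mark) :=
  if m is m'.+1 then [seq o :: l | o <- letters B, l <- words B m'] else [:: [::]].

Lemma wordsS B m : words B m.+1 = [seq o :: l | o <- letters B, l <- words B m].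
Proof. by []. Qed.

Lemma mem_words B m l : (l \in words B m) = (size l == m) && all [in letters B] l.
Proof.
elim: m l => [|m IH] l; first by case: l.
rewrite wordsS.
apply/allpairsP/idP => [[[a l'] [/= oB lB ->]]|].
  by move: lB; rewrite IH => /andP[/eqP <- al]; rewrite eqxx /=; apply/andP; split; [exact: oB|exact: al].
case: l => // o l /andP[sl /andP[oB aB]]; exists (o, l); split => //=.
by rewrite IH; apply/andP; split; [rewrite -eqSS|exact: aB].
Qed.

Lemma uniq_letters B : uniq (letters B).
Proof.
rewrite /letters /= map_inj_uniq ?uniq_bonds ?andbT; last by move=> ? ? [].
by apply/mapP => -[].
Qed.

Lemma uniq_words B m : uniq (words B m).
Proof.
elim: m => // m IH; apply: (allpairs_uniq (uniq_letters B) IH).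
by move=> [? ?] [? ?] _ _ [-> ->].
Qed.

Section WordSums.
Context {R : realType}.
Variables (p q h : R) (B : nat).
Hypotheses (pq : p + q = 1) (h0 : 0 <= h).

Definition mrate (o : mark) : R := if o is Some c then h * (if c.2 then p else q) else 1.

Definition wrate (l : seq mark) : R := \prod_(o <- l) mrate o.

(** One arrival per cell has weight [h * rate], no arrival weight 1: normalizing
    turns [h] into a smaller step. *)
Definition hstep : R := h / (1 + h * (B + B)%:R).

Lemma den_gt0 : 0 < 1 + h * (B + B)%:R.
Proof. by rewrite ltr_wpDr// mulr_ge0. Qed.

Lemma sum_letters (T : Type) (act : int * bool -> T -> T) (F : T -> R) x :
  \sum_(o <- letters B) mrate o * F (if o is Some c then act c x else x) =
  (1 + h * (B + B)%:R) * stp p q hstep (box B) act F x.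
Proof.
have D0 := den_gt0; rewrite (stpE hstep (box B) pq) size_box /letters big_cons /= mul1r big_map.
rewrite (eq_bigr (fun c => h * ((if c.2 then p else q) * F (act c x)))); last by move=> c _; rewrite mulrA.
rewrite -big_distrr sum_bonds /= /hstep; set S := \sum_(b <- _) _.
by move: ((B + B)%:R) D0 => L D0; field; exact: lt0r_neq0.
Qed.

(** Summing a function of the states at two times over all patterns, by weight, is an expectation of
    the chain with the normalized step, up to the total mass. *)
Lemma sum_words (T : Type) (act : int * bool -> T -> T) m1 m2 (G : T -> T -> R) x :
  \sum_(l <- words B (m1 + m2)) wrate l * G (run act (take m1 l) x) (run act l x) =
  (1 + h * (B + B)%:R) ^+ (m1 + m2) * Ex p q hstep (box B) act m1 (fun xs => Ex p q hstep (box B) act m2 (G xs) xs) x.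
Proof.
elim: m1 x => [|m1 IH] x.
  rewrite add0n; under eq_bigr do rewrite take0 /=.
  rewrite (_ : Ex _ _ _ _ _ 0 _ _ = Ex p q hstep (box B) act m2 (G x) x)//; move: (G x) => F; elim: m2 x => [|m2 IH] x; first by rewrite /= big_seq1 /wrate big_nil expr0.
  rewrite wordsS big_allpairs_dep.
  rewrite (eq_bigr (fun o => mrate o * ((1 + h * (B + B)%:R) ^+ m2 * Ex p q hstep (box B) act m2 F (if o is Some c then act c x else x)))).
    under eq_bigr do rewrite mulrCA.
    by rewrite -big_distrr ExS exprSr -[RHS]mulrA -sum_letters.
  move=> o _; rewrite -IH big_distrr /=; apply: eq_bigr => l _.
  by rewrite /wrate big_cons mulrA.
rewrite addSn wordsS big_allpairs_dep.
rewrite (eq_bigr (fun o => mrate o * ((1 + h * (B + B)%:R) ^+ (m1 + m2) * Ex p q hstep (box B) act m1 (fun xs => Ex p q hstep (box B) act m2 (G xs) xs) (if o is Some c then act c x else x)))).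
  under eq_bigr do rewrite mulrCA.
  by rewrite -big_distrr ExS exprSr -[RHS]mulrA -sum_letters.
move=> o _; rewrite -IH big_distrr /=; apply: eq_bigr => l _.
by rewrite /wrate big_cons mulrA.
Qed.

End WordSums.

(** * The probability of a given pattern of rings *)

Section WordEvents.
Context {R : realType} d (Omega : measurableType d) (P : probability Omega R).
Variables (p q : R) (N : int * bool -> R -> Omega -> nat).
Hypotheses (p0 : 0 <= p) (q0 : 0 <= q) (pq : p + q = 1).
Hypothesis HN : independent_poisson_processes P (fun c : int * bool => if c.2 then p else q) N.

(** [m] cells of length [h] ending at time [t], after a first cell [0, t - m h]
    in which no clock rings. *)
Definition grid (t h : R) (m j : nat) : R := if j is j'.+1 then t - (m - j')%:R * h else 0.

(** Index 0 is the long initial cell, which is empty; cell [j.+1] contains the mark number [j]. *)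
Definition incr (l : seq mark) (c : int * bool) (j : nat) : nat :=
  if j is j'.+1 then nth None l j' == Some c else false.

Definition wordE (t h : R) (B : nat) (l : seq mark) : set Omega :=
  [set w | forall c j, c \in bonds B -> (j < (size l).+1)%N ->
     N c (grid t h (size l) j.+1) w = (N c (grid t h (size l) j) w + incr l c j)%N].

Lemma grid_step t h m j : (j < m)%N -> grid t h m j.+2 - grid t h m j.+1 = h.
Proof. by move=> jm /=; rewrite subnS -(@ltn_predK 0 (m - j)%N) ?subn_gt0//= -natr1; ring. Qed.

Lemma measurable_wordE t h B l : 0 <= h -> (size l)%:R * h <= t -> measurable (wordE t h B l).
Proof.
move=> h0 ht; have [m1 _ _ _] := HN.
have g0 j : (j <= (size l).+1)%N -> 0 <= grid t h (size l) j.
  case: j => //= j js; rewrite subr_ge0; apply: le_trans ht.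
  by rewrite ler_wpM2r// ler_nat leq_subr.
have -> : wordE t h B l = \bigcap_(i in [set i | (i < size (bonds B))%N]) \bigcap_(j in [set j | (j < (size l).+1)%N])
   [set w | N (nth (0%R, true) (bonds B) i) (grid t h (size l) j.+1) w
     = (N (nth (0%R, true) (bonds B) i) (grid t h (size l) j) w + incr l (nth (0%R, true) (bonds B) i) j)%N].
  apply/seteqP; split => [w H i /= ib j /= js|w H c j /(nthP (0%R, true))[i ib <-] js].
    by apply: H => //; exact: mem_nth.
  exact: H.
apply: bigcap_measurableType => i /= _; apply: bigcap_measurableType => j /= js.
set c := nth _ _ _.
have -> : [set w | N c (grid t h (size l) j.+1) w = (N c (grid t h (size l) j) w + incr l c j)%N] =
   \bigcup_k ([set w | N c (grid t h (size l) j) w = k] `&` [set w | N c (grid t h (size l) j.+1) w = (k + incr l c j)%N]).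
  apply/seteqP; split => [w /= H|w [k _ [/= <- <-]]//].
  by exists (N c (grid t h (size l) j) w).
apply: bigcupT_measurable => k; apply: measurableI; apply: m1; apply: g0 => //; exact: ltnW.
Qed.

(** The clocks of the box have total rate [B + B]; by independence each one contributes an
    exponential in every cell, and the rate only where its mark stands. *)
Lemma prob_wordE t h B l : 0 <= h -> (size l)%:R * h <= t -> l \in words B (size l) ->
  P (wordE t h B l) = (expR (- ((B + B)%:R * t)) * wrate p q h l)%:E.
Proof.
move=> h0 ht lw; have [_ _ P1 P2] := HN; set m := size l in lw *.
have g0 : grid t h m 1 = t - m%:R * h by rewrite /= subn0.
have lam0 (c : int * bool) : 0 <= (if c.2 then p else q) by case: c.2.
have dg j : (j < m.+1)%N -> grid t h m j <= grid t h m j.+1.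
  case: j => [_|j jm]; first by rewrite /= subn0 subr_ge0.
  by rewrite -subr_ge0 grid_step.
have gge0 j : (j <= m.+1)%N -> 0 <= grid t h m j.
  case: j => //= j js; rewrite subr_ge0; apply: le_trans ht.
  by rewrite ler_wpM2r// ler_nat leq_subr.
rewrite /wordE -/m (P2 (bonds B) m.+1 (grid t h m) (incr l) (uniq_bonds B) (lexx _) dg).
pose lam (c : int * bool) : R := if c.2 then p else q.
pose psi (c : int * bool) (j : nat) : R := (if incr l c j == 1%N then lam c * h else 1) * expR (- (lam c * (grid t h m j.+1 - grid t h m j))).
have E1 c (j : 'I_m.+1) : P [set w | N c (grid t h m j.+1) w = (N c (grid t h m j) w + incr l c j)%N] = (psi c j)%:E.
  rewrite P1 ?dg ?gge0//; last exact: ltnW.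
  have r0 : 0 <= lam c * (grid t h m j.+1 - grid t h m j) by rewrite mulr_ge0// ?lam0// subr_ge0 dg.
  rewrite /psi; case: j r0 => -[|j] jm r0.
    by rewrite -[incr l c 0]/(false : nat) (poisson01 false r0).
  have gs := grid_step t h (jm : (j < m)%N).
  rewrite /= in r0 gs *; rewrite gs in r0 *.
  by rewrite (poisson01 _ r0); case: (_ == Some c).
under eq_bigr do under eq_bigr do rewrite E1.
under eq_bigr do rewrite prodEFin.
rewrite prodEFin; congr (_%:E).
rewrite exchange_big /= big_ord_recl /=.
have slam : \sum_(c <- bonds B) lam c = (B + B)%:R.
  rewrite sum_bonds (eq_bigr (fun=> 1)) => [|b _]; last exact: pq.
  by rewrite big_const_seq count_predT size_box iter_addr_0.
have pe (x : R) : \prod_(c <- bonds B) expR (- (lam c * x)) = expR (- ((B + B)%:R * x)).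
  by rewrite -expR_sum sumrN -mulr_suml slam.
rewrite {1}/psi /= (eq_bigr (fun c => expR (- (lam c * (t - m%:R * h))))); last first.
  by move=> c _; rewrite mul1r subr0 subn0.
rewrite pe.
have -> : \prod_(i < m) \prod_(c <- bonds B) psi c (lift ord0 i) = \prod_(i < m) (expR (- ((B + B)%:R * h)) * mrate p q h (nth None l i)).
  apply: eq_bigr => i _; rewrite /psi big_split /= mulrC; congr (_ * _).
    rewrite -pe; apply: eq_bigr => c _; rewrite /bump leq0n add1n.
    by have /= -> := grid_step t h (ltn_ord i).
  rewrite ?add0n.
  have ll : nth None l i \in letters B.
    by move: lw; rewrite mem_words => /andP[_ /allP]; apply; exact: mem_nth.
  case: (nth None l i) ll => [c|] /=; last first.
    by move=> _; rewrite big1// => c _; case: eqP.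
  rewrite in_cons /= (mem_map (can_inj (g := fun o => odflt c o) _))// => cB.
  rewrite (bigD1_seq c cB (uniq_bonds B)) /= eqxx [X in _ * X]big1; first by rewrite mulr1 mulrC.
  by move=> c' /negPf cc'; rewrite (_ : (Some c == Some c') = false)// eq_sym; exact: cc'.
rewrite big_split /= prodr_const card_ord /wrate (big_nth None) big_mkord mulrA.
congr (_ * _); rewrite -expRM_natr -expRD; congr expR; ring.
Qed.

End WordEvents.

(** * Trajectories between arrivals *)

Section Paths.
Context {R : realType}.

Lemma jb_ex (A A' : Type) (f : R -> A) (g : R -> A') s a b : just_before f s a -> just_before g s b ->
  exists w, f w = a /\ g w = b.
Proof.
by move=> h1 h2; apply: (@filter_ex _ (at_left s)); apply: filterI; [exact: h1|exact: h2].
Qed.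

Lemma jb_uniq (A : Type) (f : R -> A) s a b : just_before f s a -> just_before f s b -> a = b.
Proof. by move=> h1 h2; have [u [<- <-]] := jb_ex h1 h2. Qed.

Lemma jb_left (A : Type) (f : R -> A) r s a : r < s -> (forall u, r < u -> u < s -> f u = a) -> just_before f s a.
Proof. by move=> rs H; rewrite /just_before; near=> u; apply: H. Unshelve. all: by end_near. Qed.

(** Continuous induction: the supremum of the times up to which the path is constant is attained by
    the condition on left limits, and can be passed by right continuity. *)
Lemma cst_path (A : Type) (f : R -> A) r r' : right_cont f -> 0 <= r ->
  (forall u, r < u -> u <= r' -> just_before f u (f r) -> f u = f r) ->
  forall u, r <= u -> u <= r' -> f u = f r.
Proof.
move=> rc r0 H u0 ru0 u0r'; apply: contrapT => ne.
pose S : set R := [set u : R | r <= u /\ forall v : R, r <= v -> v <= u -> f v = f r].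
have Sr : S r by split => // v v1 v2; congr f; apply/le_anti; rewrite v1 v2.
have ubS : ubound S u0.
  by move=> u [_ Su]; rewrite leNgt; apply/negP => uu; apply: ne; apply: Su => //; exact: ltW.
have hS : has_sup S by split; [exists r|exists u0].
pose s := sup S.
have supS u : S u -> u <= s by move=> Su; apply: (ub_le_sup hS.2).
have rs := supS r Sr.
have su : s <= u0 by apply: ge_sup => //; exact: hS.1.
have before v : r <= v -> v < s -> f v = f r.
  move=> rv vs; have sv0 : 0 < s - v by rewrite subr_gt0.
  have [u [_ Su] vu] := sup_adherent sv0 hS.
  by apply: Su => //; apply: ltW; move: vu; rewrite -/s opprB addrC subrK.
have fs : f s = f r.
  have [->//|rs'] := eqVneq s r.
  have rls : r < s by rewrite lt_neqAle eq_sym rs'.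
  apply: H => //; first exact: le_trans su u0r'.
  by apply: (jb_left rls) => u ru us; apply: before => //; exact: ltW.
have := rc s (le_trans r0 rs) => /nbhs_ballP[e /= e0 He].
have : S (s + e / 2).
  split=> [|v rv vs]; first by apply: le_trans rs _; rewrite lerDl divr_ge0// ltW.
  have [vs'|sv] := ltP v s; first exact: before.
  have [->//|vns] := eqVneq v s.
  rewrite -fs; apply: He; last by rewrite lt_neqAle eq_sym vns.
  rewrite /ball /= distrC ger0_norm ?subr_ge0//.
  by rewrite ltrBlDl; apply: le_lt_trans vs _; rewrite ltrD2l gtr_pMr// invf_lt1// ltr1n.
move=> /supS; rewrite gerDl leNgt divr_gt0//.
Qed.

Definition counting (N : R -> nat) := right_cont N /\ forall r s, 0 <= r -> r <= s -> (N r <= N s)%N.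

Lemma no_arrival N r r' u : counting N -> 0 <= r -> N r' = N r -> r < u -> u <= r' -> ~ arrival N u.
Proof.
move=> [_ mN] r0 e ru ur [_]; apply.
have Nc v : r <= v -> v <= r' -> N v = N r.
  by move=> rv vr; apply/eqP; rewrite eqn_leq -{1}e !mN// (le_trans r0 rv).
apply: (jb_left ru) => v rv vu; rewrite (Nc u) ?(ltW ru)//; apply: Nc; first exact: ltW.
exact: le_trans (ltW vu) ur.
Qed.

(** The arrival is the infimum of the times at which the count has increased. *)
Lemma one_arrival N r r' : counting N -> 0 <= r -> r <= r' -> N r' = (N r).+1 ->
  exists s, [/\ r < s, s <= r', arrival N s & forall u, r < u -> u <= r' -> u != s -> ~ arrival N u].
Proof.
move=> cN r0 rr e; have [rc mN] := cN.
pose S : set R := [set u : R | r <= u /\ u <= r' /\ N u = (N r).+1].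
have Sr : S r' by [].
have hS : has_inf S by split; [exists r'|exists r => u []].
pose s := inf S.
have infS u : S u -> s <= u by move=> Su; apply: (ge_inf hS.2).
have sr := infS r' Sr.
have rs : r <= s by apply: lb_le_inf; [exists r'|move=> u []].
have s0 := le_trans r0 rs.
have before u : r <= u -> u < s -> N u = N r.
  move=> ru us; have ur : u <= r' by apply: le_trans (ltW us) sr.
  have h1 : (N u <= (N r).+1)%N by rewrite -e mN// (le_trans r0).
  have h2 : N u != (N r).+1.
    by apply/eqP => eu; have /infS : S u by []; rewrite leNgt us.
  by apply/eqP; rewrite eqn_leq (mN r u r0 ru) andbT -ltnS ltn_neqAle h2.
have Ns : N s = (N r).+1.
  apply: contrapT => ns.
  have Nsr : N s = N r.
    have h1 : (N s <= (N r).+1)%N by rewrite -e mN.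
    by apply/eqP; rewrite eqn_leq (mN r s r0 rs) andbT -ltnS ltn_neqAle h1 andbT; apply/eqP.
  have := rc s s0 => /nbhs_ballP[d /= d0 Hd].
  have [u [ru [ur Nu]] us] := inf_adherent d0 hS.
  have su : s <= u by exact: infS.
  have [us'|us'] := eqVneq u s; first by apply: ns; rewrite -us'.
  have : N u = N s.
    apply: Hd; last by rewrite lt_neqAle eq_sym us'.
    by rewrite /ball /= distrC ger0_norm ?subr_ge0// ltrBlDl.
  by rewrite Nu Nsr => /eqP; rewrite gtn_eqF.
have rls : r < s.
  by rewrite lt_neqAle rs andbT; apply/eqP => rE; move: Ns; rewrite -rE => /eqP; rewrite ltn_eqF.
exists s; split => //.
  split; first exact: le_lt_trans r0 rls.
  rewrite Ns => jb; have jb' : just_before N s (N r).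
    by apply: (jb_left rls) => u ru us; apply: before => //; exact: ltW.
  by have /eqP := jb_uniq jb jb'; rewrite gtn_eqF.
move=> u ru ur us; have [lt|gt] := ltP u s.
  apply: (no_arrival cN r0 _ ru (lexx u)); exact: before (ltW ru) lt.
have su : s < u by rewrite lt_neqAle eq_sym us.
apply: (no_arrival cN s0 _ su ur); rewrite Ns e//.
Qed.

(** * The process across one cell of the grid *)

Definition fires (c : int * bool) (xi : int -> site) : bool :=
  if c.2 then (priority (xi (c.1 + 1)%R) < priority (xi c.1))%N
  else (priority (xi c.1) < priority (xi (c.1 + 1)%R))%N.

Definition exch (o : mark) (xi : int -> site) : int -> site :=
  if o is Some c then
    if fires c xi then fun z => if z == c.1 then xi (c.1 + 1) else if z == c.1 + 1 then xi c.1 else xi z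
    else xi
  else xi.

Definition texch (o : mark) (xi : int -> site) (y : int) : int :=
  if o is Some c then
    if fires c xi then if y == c.1 then c.1 + 1 else if y == c.1 + 1 then c.1 else y
    else y
  else y.

Variables (N : int * bool -> R -> nat) (eta : R -> int -> site).
Hypotheses (cN : forall c, counting (N c)) (Heta : asep_path N eta).

Lemma exchange_arrival s z : exchange N eta s z -> arrival (N (z, true)) s \/ arrival (N (z, false)) s.
Proof. by move=> [a [b [_ _ [[h _]|[h _]]]]]; [left|right]. Qed.

Section Segment.
Variables (zl zr : int).

Definition quiet (r r' : R) := forall u b d, r < u -> u <= r' -> zl <= b -> b <= zr -> ~ arrival (N (b, d)) u.

Lemma quiet_exchange r r' u b : quiet r r' -> r < u -> u <= r' -> zl <= b -> b <= zr -> ~ exchange N eta u b.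
Proof. by move=> q h1 h2 h3 h4 /exchange_arrival[]; exact: q. Qed.

Lemma quiet_site r r' z : quiet r r' -> 0 <= r -> zl < z -> z <= zr ->
  forall u, r <= u -> u <= r' -> eta u z = eta r z.
Proof.
move=> q r0 zl1 zr1 u ru ur'; have [rc _ E3] := Heta.
apply: (@cst_path _ (eta ^~ z) r r') => // v rv vr jb.
apply: (@jb_uniq _ (eta ^~ z) v) jb; apply: E3; first exact: le_lt_trans r0 rv.
  by apply: quiet_exchange q rv vr _ zr1; exact: ltW.
by apply: quiet_exchange q rv vr _ _; move: zl1 zr1; clear; lia.
Qed.

Lemma quiet_tag r r' x : quiet r r' -> 0 <= r -> tagged_path N eta x -> zl < x r -> x r <= zr ->
  forall u, r <= u -> u <= r' -> x u = x r.
Proof.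
move=> q r0 [rc tg] zl1 zr1 u ru ur'.
apply: (@cst_path _ x r r') => // v rv vr jb.
have [y [jy _ _]] := tg v (le_lt_trans r0 rv); rewrite -(jb_uniq jb jy); apply.
  by apply: quiet_exchange q rv vr _ zr1; exact: ltW.
by apply: quiet_exchange q rv vr _ _; move: zl1 zr1; clear; lia.
Qed.

(** The segment is constant before and after its only ring. As the end bonds are silent, nothing
    outside matters, and the infinite system is never analysed globally. *)
Lemma quiet_cell r r' (o : mark) : 0 <= r -> r <= r' ->
  (forall b d, zl <= b -> b <= zr -> N (b, d) r' = (N (b, d) r + (o == Some (b, d)))%N) ->
  (forall b d, o = Some (b, d) -> b <> zl /\ b <> zr) ->
  (forall z, zl < z -> z <= zr -> eta r' z = exch o (eta r) z) /\
  (forall x, tagged_path N eta x -> zl < x r -> x r <= zr -> x r' = texch o (eta r) (x r)).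
Proof.
move=> r0 rr HN Ho; have [rc E2 E3] := Heta.
have [[b [d [oE [zlb bzr]]]]|nob] := pselect (exists b d, o = Some (b, d) /\ zl < b /\ b < zr); last first.
  have q : quiet r r'.
    move=> u b d ru ur zb bz; apply: (no_arrival (cN (b, d)) r0 _ ru ur); rewrite HN//.
    case: eqP => [oE|_]; last by rewrite addn0.
    have [n1 n2] := Ho b d oE; exfalso; apply: nob; exists b, d; split => //.
    by move: n1 n2 zb bz; clear; lia.
  have out z c : o = Some c -> zl < z -> z <= zr -> (z == c.1) = false /\ (z == c.1 + 1) = false.
    case: c => b d oE zl1 zr1; have [n1 n2] := Ho b d oE.
    have nb : ~ (zl < b /\ b < zr) by move=> h; apply: nob; exists b, d.
    by split; apply/eqP; move: n1 n2 nb zl1 zr1; rewrite /=; clear; lia.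
  split=> [z zl1 zr1|x tx zl1 zr1].
    rewrite (quiet_site q r0 zl1 zr1 rr (lexx _)) /exch; case E : o => [c|] //; case: ifP => // _.
    by have [-> ->] := out z c E zl1 zr1.
  rewrite (quiet_tag q r0 tx zl1 zr1 rr (lexx _)) /texch; case E : o => [c|] //; case: ifP => // _.
  by have [-> ->] := out _ c E zl1 zr1.
have [s [rs sr arr narr]] : exists s, [/\ r < s, s <= r', arrival (N (b, d)) s &
    forall u, r < u -> u <= r' -> u != s -> ~ arrival (N (b, d)) u].
  by apply: one_arrival => //; rewrite HN ?ltW// oE eqxx addn1.
have s0 : 0 < s := le_lt_trans r0 rs.
have other u b' d' : r < u -> u <= r' -> zl <= b' -> b' <= zr -> (b', d') != (b, d) -> ~ arrival (N (b', d')) u.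
  move=> ru ur zb bz ne; apply: (no_arrival (cN _) r0 _ ru ur); rewrite HN// oE.
  by case: eqP => [[e1 e2]|_]; [rewrite e1 e2 eqxx in ne|rewrite addn0].
have q1 u : u < s -> quiet r u.
  move=> us v b' d' rv vu zb bz; have vr : v <= r' by rewrite (le_trans vu)// (le_trans (ltW us)).
  have [[-> ->]|ne] := eqVneq (b', d') (b, d); last exact: other.
  by apply: narr => //; rewrite lt_eqF// (le_lt_trans vu).
have q2 : quiet s r'.
  move=> v b' d' sv vr zb bz; have rv : r < v := lt_trans rs sv.
  have [[-> ->]|ne] := eqVneq (b', d') (b, d); last exact: other.
  by apply: narr => //; rewrite gt_eqF.
have jbs z : zl < z -> z <= zr -> just_before (eta ^~ z) s (eta r z).
  move=> zl1 zr1; apply: (jb_left rs) => u ru us.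
  by apply: (quiet_site (q1 u us) r0 zl1 zr1) => //; exact: ltW.
have b1z : zl < b + 1 /\ b + 1 <= zr by move: zlb bzr; clear; lia.
have jb0 := jbs b zlb (ltW bzr); have jb1 := jbs (b + 1) b1z.1 b1z.2.
have exf : exchange N eta s b <-> fires (b, d) (eta r).
  split=> [[a1 [a2 [j1 j2 H]]]|f].
    have e1 := jb_uniq j1 jb0; have e2 := jb_uniq j2 jb1; subst a1 a2.
    have nd : ~ arrival (N (b, ~~ d)) s.
      apply: other => //; [exact: ltW|exact: ltW|]; apply/eqP => -[]; by case: (d).
    by case: H => -[ar pr]; move: nd ar; rewrite /fires /=; case: (d) => /=.
  exists (eta r b), (eta r (b + 1)); split => //.
  by move: arr f; rewrite /fires /=; case: (d) => ? ?; [left|right].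
have nex z : zl <= z -> z <= zr -> z <> b -> ~ exchange N eta s z.
  move=> zl1 zr1 zb /exchange_arrival[]; apply: other => //; by apply/eqP => -[].
have ets z : zl < z -> z <= zr -> eta s z = exch o (eta r) z.
  move=> zl1 zr1; rewrite oE /exch /=; case: ifP => [/exf ex|nf].
    have [j1 j2] := E2 s b s0 ex.
    have [->|/eqP zb] := eqVneq z b; first exact: jb_uniq j1 jb1.
    have [->|/eqP zb1] := eqVneq z (b + 1); first exact: jb_uniq j2 jb0.
    apply: (@jb_uniq _ (eta ^~ z) s) (jbs z zl1 zr1); apply: E3 => //; apply: nex => //; move: zl1 zr1 zb zb1; clear; lia.
  have nx : ~ exchange N eta s b by move=> /exf; rewrite nf.
  apply: (@jb_uniq _ (eta ^~ z) s) (jbs z zl1 zr1); apply: E3 => //.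
    have [->//|/eqP zb] := eqVneq z b; apply: nex => //; exact: ltW.
  have [->//|/eqP zb] := eqVneq (z - 1) b; apply: nex => //; move: zl1 zr1; clear; lia.
split=> [z zl1 zr1|x tx zl1 zr1].
  by rewrite (quiet_site q2 (ltW s0) zl1 zr1 sr (lexx _)) ets.
have xs : x s = texch o (eta r) (x r).
  have jx : just_before x s (x r).
    apply: (jb_left rs) => u ru us; apply: (quiet_tag (q1 u us) r0 tx zl1 zr1) => //; exact: ltW.
  have [_ tg] := tx; have [y [jy X1 X2 X3]] := tg s s0; have ey := jb_uniq jx jy; subst y.
  rewrite oE /texch /=; case: ifP => [/exf ex|nf].
    have [e|/eqP ne] := eqVneq (x r) b; first by rewrite X1 e.
    have [e|/eqP ne1] := eqVneq (x r) (b + 1).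
      by rewrite X2 e addrK.
    apply: X3; apply: nex => //; try exact: ltW; move: zl1 zr1 ne1; clear; lia.
  have nx : ~ exchange N eta s b by move=> /exf; rewrite nf.
  apply: X3.
    have [->//|/eqP ne] := eqVneq (x r) b; apply: nex => //; exact: ltW.
  have [->//|/eqP ne] := eqVneq (x r - 1) b; apply: nex => //; move: zl1 zr1; clear; lia.
rewrite -xs; apply: (quiet_tag q2 (ltW s0) tx) => //.
  by rewrite xs /texch oE /=; case: ifP => // _; case: eqP => [_|_]; [|case: eqP]; move: b1z zlb zl1; clear; lia.
by rewrite xs /texch oE /=; case: ifP => // _; case: eqP => [_|_]; [|case: eqP]; move: b1z bzr zr1; clear; lia.
Qed.

End Segment.

Lemma barrier_left r r' b x : 0 <= r -> tagged_path N eta x ->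
  (forall u d, r < u -> u <= r' -> ~ arrival (N (b, d)) u) -> x r <= b -> forall u, r <= u -> u <= r' -> x u <= b.
Proof.
move=> r0 [rc tg] na xb u ru ur.
suff : (x u <= b) = (x r <= b) by move=> ->.
apply: (@cst_path _ (fun u => x u <= b) r r') => //.
  by move=> s s0; apply: filterS (rc s s0) => v ->.
move=> v rv vr jb; rewrite xb in jb *.
have [y [jy X1 X2 X3]] := tg v (le_lt_trans r0 rv).
have yb : y <= b by have [w [h <-]] := jb_ex jb jy.
have [e1|e1] := pselect (exchange N eta v y).
  rewrite X1//; have [yE|ne] := eqVneq y b; last by move: yb ne; clear; lia.
  by move: e1; rewrite yE => /exchange_arrival[] /na; case.
have [e2|e2] := pselect (exchange N eta v (y - 1)); first by rewrite X2//; move: yb; clear; lia.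
by rewrite X3.
Qed.

Lemma barrier_right r r' b x : 0 <= r -> tagged_path N eta x ->
  (forall u d, r < u -> u <= r' -> ~ arrival (N (b, d)) u) -> b < x r -> forall u, r <= u -> u <= r' -> b < x u.
Proof.
move=> r0 [rc tg] na xb u ru ur.
suff : (b < x u) = (b < x r) by move=> ->.
apply: (@cst_path _ (fun u => b < x u) r r') => //.
  by move=> s s0; apply: filterS (rc s s0) => v ->.
move=> v rv vr jb; rewrite xb in jb *.
have [y [jy X1 X2 X3]] := tg v (le_lt_trans r0 rv).
have yb : b < y by have [w [h <-]] := jb_ex jb jy.
have [e2|e2] := pselect (exchange N eta v (y - 1)).
  rewrite X2//; have [yE|ne] := eqVneq (y - 1) b; last by move: yb ne; clear; lia.
  by move: e2; rewrite yE => /exchange_arrival[] /na; case.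
have [e1|e1] := pselect (exchange N eta v y); first by rewrite X1//; move: yb; clear; lia.
by rewrite X3.
Qed.

End Paths.

(** * Heights and labels of the process on a segment *)

Definition isF (a : site) : int := if a is First then 1 else 0.
Definition isP (a : site) : int := if a is Hole then 0 else 1.

Definition hact (o : mark) (H : int -> int) : int -> int := if o is Some c then hmove c H else H.

Definition srel (zl zr : int) (A G : int -> int) (xi : int -> site) :=
  forall z, zl < z -> z <= zr -> A (z - 1) - A z = isF (xi z) /\ G (z - 1) - G z = isP (xi z).

Definition avoids (zl zr : int) (o : mark) := forall b d, o = Some (b, d) -> b <> zl /\ b <> zr.

Lemma hact_at o b H : (forall b' d, o = Some (b', d) -> b' <> b) -> hact o H b = H b.
Proof. by case: o => //= -[b' d] h; rewrite /hmove /=; case: eqP => // e; case: (h b' d). Qed.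

Lemma site_step (a0 a1 : site) (A0 A1 A2 G0 G1 G2 : int) (d : bool) :
  A0 - A1 = isF a0 -> A1 - A2 = isF a1 -> G0 - G1 = isP a0 -> G1 - G2 = isP a1 ->
  let f := if d then (priority a1 < priority a0)%N else (priority a0 < priority a1)%N in
  let A' := if d then Num.min A0 (A2 + 1) else Num.max A2 (A0 - 1) in
  let G' := if d then Num.min G0 (G2 + 1) else Num.max G2 (G0 - 1) in
  [/\ A0 - A' = isF (if f then a1 else a0), A' - A2 = isF (if f then a0 else a1),
      G0 - G' = isP (if f then a1 else a0) & G' - G2 = isP (if f then a0 else a1)].
Proof. by case: d; case: a0; case: a1 => /= *; split; lia. Qed.

Lemma srel_step zl zr o A G xi : avoids zl zr o -> srel zl zr A G xi ->
  srel zl zr (hact o A) (hact o G) (exch o xi).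
Proof.
move=> av sr; case: o av => [[b d] /(_ b d erefl) [b1 b2]|_]; last exact: sr.
move=> z z1 z2; rewrite /hact.
have [/andP[bl br]|bo] := boolP ((zl < b) && (b < zr)); last first.
  have -> : exch (Some (b, d)) xi z = xi z.
    rewrite /exch /=; case: ifP => // _; have -> : (z == b) = false by move: b1 b2 bo z1 z2; clear; lia.
    by have -> : (z == b + 1) = false by move: b1 b2 bo z1 z2; clear; lia.
  have := sr z z1 z2; rewrite /hmove /=.
  have -> : (z == b) = false by move: b1 b2 bo z1 z2; clear; lia.
  by have -> : (z - 1 == b) = false by move: b1 b2 bo z1 z2; clear; lia.
have [|| A0 G0] := sr b; [by []|exact: ltW|].
have [|| A1 G1] := sr (b + 1); [move: bl; clear; lia|move: br; clear; lia|].
rewrite addrK in A1 G1.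
have [S1 S2 S3 S4] := site_step d A0 A1 G0 G1.
rewrite /exch /fires /=; set f := (if d then (_ < _)%N else _) in S1 S2 S3 S4 *; clearbody f.
have [zE|zb] := eqVneq z b.
  rewrite zE /hmove /= eqxx (_ : (b - 1 == b) = false); last by clear; lia.
  by clear S2 S4; case: f S1 S3; rewrite ?eqxx.
have [zE|zb1] := eqVneq z (b + 1).
  rewrite zE /hmove /= addrK eqxx (_ : (b + 1 == b) = false); last by clear; lia.
  have b1b : (b + 1 == b) = false by clear; lia.
  by clear S1 S3; case: f S2 S4; rewrite ?eqxx ?b1b.
have := sr z z1 z2; rewrite /hmove /= (negPf zb) (_ : (z - 1 == b) = false); last by move: zb1; clear; lia.
by clear S1 S2 S3 S4; case: f; rewrite ?(negPf zb) ?(negPf zb1).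
Qed.

(** The particle at [y] is number [a] from the right. *)
Definition ftag (a : int) (A : int -> int) (y : int) := A y = a - 1 /\ A (y - 1) = a.
(** A hole at [y] with [G y + y = a]; the sum is conserved when the hole changes places with a
    particle. *)
Definition htag (a : int) (G : int -> int) (y : int) := G y = a - y /\ G (y - 1) = a - y.

Lemma texch_seg zl zr o xi y : avoids zl zr o -> zl < y -> y <= zr -> zl < texch o xi y /\ texch o xi y <= zr.
Proof.
move=> av y1 y2; case: o av => [[b d] /(_ b d erefl) [b1 b2]|_] //=.
case: ifP => // _; case: eqP => [yb|_]; first by move: yb b1 b2 y1 y2; clear; lia.
by case: eqP => [yb|_] //; move: yb b1 b2 y1 y2; clear; lia.
Qed.

Lemma tag_site (a0 a1 : site) (A0 A1 A2 G0 G1 G2 a b : int) (d : bool) :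
  A0 - A1 = isF a0 -> A1 - A2 = isF a1 -> G0 - G1 = isP a0 -> G1 - G2 = isP a1 ->
  let f := if d then (priority a1 < priority a0)%N else (priority a0 < priority a1)%N in
  let A' := if d then Num.min A0 (A2 + 1) else Num.max A2 (A0 - 1) in
  let G' := if d then Num.min G0 (G2 + 1) else Num.max G2 (G0 - 1) in
  [/\ A1 = a - 1 -> A0 = a -> if f then A2 = a - 1 /\ A' = a else A' = a - 1 /\ A0 = a,
      A2 = a - 1 -> A1 = a -> if f then A' = a - 1 /\ A0 = a else A2 = a - 1 /\ A' = a,
      G1 = a - b -> G0 = a - b -> if f then G2 = a - (b + 1) /\ G' = a - (b + 1) else G' = a - b /\ G0 = a - b &
      G2 = a - (b + 1) -> G1 = a - (b + 1) -> if f then G' = a - b /\ G0 = a - b else G2 = a - (b + 1) /\ G' = a - (b + 1)].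
Proof. by case: d; case: a0; case: a1 => /= *; split=> *; split; lia. Qed.

Lemma tag_step zl zr o A G xi y a : avoids zl zr o -> srel zl zr A G xi -> zl < y -> y <= zr ->
  (ftag a A y -> ftag a (hact o A) (texch o xi y)) /\ (htag a G y -> htag a (hact o G) (texch o xi y)).
Proof.
move=> av sr y1 y2; case: o av => [[b d] /(_ b d erefl) [b1 b2]|_] //=.
have keep (H : int -> int) : y <> b -> y <> b + 1 -> hmove (b, d) H y = H y /\ hmove (b, d) H (y - 1) = H (y - 1).
  move=> yb yb1; rewrite /hmove /= (_ : (y == b) = false); last by move: yb; clear; lia.
  by rewrite (_ : (y - 1 == b) = false)//; move: yb1; clear; lia.
have [/andP[bl br]|bo] := boolP ((zl < b) && (b < zr)); last first.
  have yb : y <> b by move: b1 b2 bo y1 y2; clear; lia.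
  have yb1 : y <> b + 1 by move: b1 b2 bo y1 y2; clear; lia.
  have -> : (if fires (b, d) xi then if y == b then b + 1 else if y == b + 1 then b else y else y) = y.
    by case: ifP => // _; case: eqP => // _; case: eqP.
  by rewrite /ftag /htag; have [-> ->] := keep A yb yb1; have [-> ->] := keep G yb yb1.
have [|| A0 G0] := sr b; [by []|exact: ltW|].
have [|| A1 G1] := sr (b + 1); [move: bl; clear; lia|move: br; clear; lia|].
rewrite addrK in A1 G1.
have [S1 S2 S3 S4] := tag_site a b d A0 A1 G0 G1.
rewrite /fires /=; set f := (if d then (_ < _)%N else _) in S1 S2 S3 S4 *; clearbody f.
have hb (H : int -> int) : hmove (b, d) H b = if d then Num.min (H (b - 1)) (H (b + 1) + 1) else Num.max (H (b + 1)) (H (b - 1) - 1).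
  by rewrite /hmove /= eqxx.
have hb1 (H : int -> int) : hmove (b, d) H (b + 1) = H (b + 1).
  by rewrite /hmove /= (_ : (b + 1 == b) = false)//; clear; lia.
have hb0 (H : int -> int) : hmove (b, d) H (b - 1) = H (b - 1).
  by rewrite /hmove /= (_ : (b - 1 == b) = false)//; clear; lia.
have [yE|/eqP yb] := eqVneq y b.
  rewrite yE /ftag /htag; clear S2 S4; case: f S1 S3 => S1 S3; rewrite ?addrK ?hb ?hb1 ?hb0; split=> -[u1 u2].
  - exact: S1.
  - exact: S3.
  - exact: S1.
  - exact: S3.
have [yE|/eqP yb1] := eqVneq y (b + 1).
  rewrite yE /ftag /htag addrK; clear S1 S3; case: f S2 S4 => S2 S4; rewrite ?addrK ?hb ?hb1 ?hb0; split=> -[u1 u2].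
  - exact: S2.
  - exact: S4.
  - exact: S2.
  - exact: S4.
have -> : (if f then y else y) = y by case: (f).
by rewrite /ftag /htag; have [-> ->] := keep A yb yb1; have [-> ->] := keep G yb yb1.
Qed.

Section SegmentPath.
Context {R : realType}.
Variables (N : int * bool -> R -> nat) (eta : R -> int -> site).
Hypotheses (cN : forall c, counting (N c)) (Heta : asep_path N eta).
Variables (t h : R) (B : nat) (l : seq mark) (zl zr : int).
Hypotheses (h0 : 0 <= h) (ht : (size l)%:R * h <= t).
Hypothesis (HE : forall c j, c \in bonds B -> (j < (size l).+1)%N ->
     N c (grid t h (size l) j.+1) = (N c (grid t h (size l) j) + incr l c j)%N).
Hypotheses (lB : forall z, zl <= z -> z <= zr -> z \in box B)
  (sil : forall o, o \in l -> avoids zl zr o).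
Variables (A0 G0 : int -> int).
Hypothesis S0 : srel zl zr A0 G0 (eta 0).

Notation T j := (grid t h (size l) j).

Let T0 j : (j <= (size l).+1)%N -> 0 <= T j.
Proof.
case: j => //= j js; rewrite subr_ge0; apply: le_trans ht.
by rewrite ler_wpM2r// ler_nat leq_subr.
Qed.

Let TS j : (j < (size l).+1)%N -> T j <= T j.+1.
Proof.
case: j => [_|j js]; first by rewrite /= subn0 subr_ge0.
by rewrite -subr_ge0 grid_step.
Qed.

Let cell0 : (forall z, zl < z -> z <= zr -> eta (T 1) z = exch None (eta 0) z) /\
  (forall x, tagged_path N eta x -> zl < x 0 -> x 0 <= zr -> x (T 1) = texch None (eta 0) (x 0)).
Proof.
apply: (quiet_cell cN Heta (lexx 0) (TS (ltn0Sn _))) => // b d bl br.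
by rewrite (HE (j := 0))// mem_bonds; exact: lB.
Qed.

Let cellS j : (j < size l)%N -> avoids zl zr (nth None l j) /\
 ((forall z, zl < z -> z <= zr -> eta (T j.+2) z = exch (nth None l j) (eta (T j.+1)) z) /\
  (forall x, tagged_path N eta x -> zl < x (T j.+1) -> x (T j.+1) <= zr ->
     x (T j.+2) = texch (nth None l j) (eta (T j.+1)) (x (T j.+1)))).
Proof.
move=> jl; have av := sil (mem_nth None jl); split => //.
apply: (quiet_cell cN Heta (@T0 j.+1 (ltnW jl)) (@TS j.+1 jl)) => // b d bl br.
by rewrite (HE (j := j.+1))// mem_bonds; exact: lB.
Qed.

(** The silent end bonds decouple the segment: marks outside act on the heights in [run] but never
    reach the values between [zl] and [zr]. *)
Lemma seg_path j : (j <= size l)%N ->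
  [/\ srel zl zr (run hmove (take j l) A0) (run hmove (take j l) G0) (eta (T j.+1)),
      run hmove (take j l) A0 zl = A0 zl, run hmove (take j l) G0 zr = G0 zr &
      forall x a, tagged_path N eta x -> zl < x 0 -> x 0 <= zr ->
       [/\ zl < x (T j.+1), x (T j.+1) <= zr,
         ftag a A0 (x 0) -> ftag a (run hmove (take j l) A0) (x (T j.+1)) &
         htag a G0 (x 0) -> htag a (run hmove (take j l) G0) (x (T j.+1))]].
Proof.
elim: j => [|j IH] jl.
  rewrite take0 /=; have [c1 c2] := cell0; split => //.
    by move=> z z1 z2; rewrite c1// ; exact: S0.
  by move=> x a tx x1 x2; rewrite c2.
have [sr el er tg] := IH (ltnW jl); have [av [c1 c2]] := cellS jl.
have rS H : run hmove (take j.+1 l) H = hact (nth None l j) (run hmove (take j l) H).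
  by rewrite (take_nth None jl) -cats1 run_cat.
rewrite !rS; split.
- move=> z z1 z2; rewrite c1//; exact: (srel_step av sr).
- by rewrite hact_at// => b d e; have [] := av b d e.
- by rewrite hact_at// => b d e; have [] := av b d e.
move=> x a tx x1 x2; have [y1 y2 F1 F2] := tg x a tx x1 x2.
rewrite c2//; have [w1 w2] := texch_seg (eta (T j.+1)) av y1 y2.
have [U1 U2] := tag_step a av sr y1 y2.
by split => // h1; [apply: U1; exact: F1|apply: U2; exact: F2].
Qed.

Lemma silent_bond b d : (b = zl \/ b = zr) -> zl <= zr -> forall u, 0 < u -> u <= t -> ~ arrival (N (b, d)) u.
Proof.
move=> bz zz u u0 ut.
have bB : (b, d) \in bonds B by rewrite mem_bonds; apply: lB; case: bz => ->.
have key j : (j <= (size l).+1)%N -> N (b, d) (T j) = N (b, d) 0.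
  elim: j => // j IH js; rewrite HE// IH; last exact: ltnW.
  case: j {IH} js => [|j] js; rewrite /= ?addn0//.
  case: eqP => [e|_]; last by rewrite addn0.
  have := sil (mem_nth None (js : (j < size l)%N)); rewrite e => /(_ b d erefl).
  by case: bz => ->; case.
have tE : T (size l).+1 = t by rewrite /= subnn mul0r subr0.
apply: (no_arrival (cN (b, d)) (lexx 0) (r' := t)) => //.
by rewrite -tE key.
Qed.

End SegmentPath.

Lemma sup_labels (R : realType) (a m : int) (S : set int) : a <= m -> (forall n, S n <-> a <= n /\ n <= m) ->
  ereal_sup [set (n%:~R : R)%:E | n in S] = (m%:~R)%:E.
Proof.
move=> am HS; apply/eqP; rewrite eq_le; apply/andP; split.
  by apply: ge_ereal_sup => _ [n /HS[_ nm] <-]; rewrite lee_fin ler_int.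
by apply: ereal_sup_ubound; exists m => //; apply/HS.
Qed.

Lemma x_init_tag k n : - k%:Z + 1 <= n -> ftag (n + k%:Z) (first_height k) (x_init k%:Z n).
Proof.
move=> nk; rewrite /ftag /first_height /stepf /x_init; case: ifP => n1; split; move: nk n1; clear; lia.
Qed.

Lemma h_init_tag k n : - k%:Z + 1 <= n -> htag (n + k%:Z) (second_height k) (h_init k%:Z n).
Proof.
move=> nk; rewrite /htag /second_height /stepf /h_init; case: ifP => n1; split; move: nk n1; clear; lia.
Qed.

Lemma eta_init_rel k zl zr : srel zl zr (first_height k) (second_height k) (eta_init k%:Z).
Proof.
move=> z _ _; rewrite /eta_init; have [->|z0] := eqVneq z 0.
  by rewrite /first_height /second_height /stepf /=; split; clear; lia.
have E : (exists2 n : int, - k%:Z + 1 <= n & z = x_init k%:Z n) <-> (z <= - k%:Z - 1 \/ 1 <= z <= k%:Z).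
  split=> [[n nk ->]|H].
    by rewrite /x_init; case: ifP; move: nk; clear; lia.
  have [zn|zp] := lerP z 0.
    by exists (- z - k%:Z); rewrite /x_init; [|case: ifP]; move: H zn z0; clear; lia.
  by exists (1 - z); rewrite /x_init; [|case: ifP]; move: H zp z0; clear; lia.
case: asboolP => [/E H|nE] /=; rewrite /first_height /second_height /stepf; first by split; move: H z0; clear; lia.
have {}nE : ~ (z <= - k%:Z - 1 \/ 1 <= z <= k%:Z) by move=> /E.
by split; move: nE z0; clear; lia.
Qed.

Lemma run_adm l H : adm H -> adm (run hmove l H).
Proof. by move=> aH; apply: (run_ind (inv := adm)) => // c x; exact: hmove_adm. Qed.

Lemma first_height_adm k : adm (first_height k).
Proof. by move=> z; rewrite /first_height /stepf; apply/andP; split; lia. Qed.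

Lemma second_height_adm k : adm (second_height k).
Proof. by move=> z; rewrite /second_height /stepf; apply/andP; split; lia. Qed.

(** * Reading the labels and the position on a good pattern *)

Section OmegaWord.
Context {R : realType}.
Variables (N : int * bool -> R -> nat) (eta : R -> int -> site) (X : int).
Variables (x hh : int -> R -> int).
Hypotheses (cN : forall c, counting (N c)) (Heta : asep_path N eta).
Variables (t h chi chi' : R) (B k m1 m2 : nat) (l : seq mark) (zl zr : int).
Hypotheses (h0 : 0 <= h) (ht : (size l)%:R * h <= t) (sl : size l = (m1 + m2)%N) (m2h : m2%:R * h = t `^ chi).
Hypotheses (chi'0 : 0 < chi') (t1 : 1 <= t) (k0 : (0 < k)%N).
Hypothesis (HE : forall c j, c \in bonds B -> (j < (size l).+1)%N ->
     N c (grid t h (size l) j.+1) = (N c (grid t h (size l) j) + incr l c j)%N).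
Hypotheses (lB : forall z, zl <= z -> z <= zr -> z \in box B)
  (sil : forall o, o \in l -> avoids zl zr o).
Hypotheses (e0 : eta 0 = eta_init k%:Z) (eX : eta t X = Second).
Hypothesis tags : forall n, - k%:Z + 1 <= n ->
  [/\ x n 0 = x_init k%:Z n, tagged_path N eta (x n), hh n 0 = h_init k%:Z n & tagged_path N eta (hh n)].
Let W := window chi' t.
Hypotheses (zlW : zl < - W%:Z - 1) (zrW : W%:Z < zr) (zlk : zl <= - k%:Z - 1) (zrk : k%:Z <= zr)
  (zlX : zl < X) (zrX : X <= zr).
Let xs := run (fact k) (take m1 l) (x_start k).
Let xt := run (fact k) l (x_start k).
Hypothesis gd : good k W xs xt.

Let sT : grid t h (size l) m1.+1 = t - t `^ chi.
Proof. by rewrite /= sl addKn m2h. Qed.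
Let tT : grid t h (size l) (size l).+1 = t.
Proof. by rewrite /= subnn mul0r subr0. Qed.
Let S0 : srel zl zr (first_height k) (second_height k) (eta 0).
Proof. by rewrite e0; exact: eta_init_rel. Qed.
Let A := run hmove (take m1 l) (first_height k).
Let G := run hmove (take m1 l) (second_height k).
Let AE : hgt 3 k xs = A. Proof. by rewrite /xs hgt_run hgt_start3. Qed.
Let GE : hgt 2 k xs = G. Proof. by rewrite /xs hgt_run hgt_start2. Qed.
Let r := xs.1.1 (- W%:Z - 1).
Let E := refl k xs.1.2 (- W%:Z - 1).
Let ixs : xinv k xs. Proof. by apply: xinv_run; exact: xinv_start. Qed.
Let ixt : xinv k xt. Proof. by apply: xinv_run; exact: xinv_start. Qed.
Let m1l : (m1 <= size l)%N. Proof. by rewrite sl leq_addr. Qed.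
Let s0 : 0 <= t - t `^ chi.
Proof.
rewrite subr_ge0 -m2h; apply: le_trans ht; rewrite ler_wpM2r// ler_nat sl leq_addl//.
Qed.
Let st : t - t `^ chi <= t. Proof. by rewrite gerBl powR_ge0. Qed.
Let zlr : zl <= zr. Proof. by move: zlX zrX; clear; lia. Qed.
Let WE : W%:Z = Num.ceil (t `^ chi') - 1. Proof. exact: windowE. Qed.

(** The particle of label [n] is number [n + k] from the right, and [r + k] particles are to the
    right of [- W - 1]. Labels starting at or to the left of the silent bond [zl] stay there. *)
Lemma calP_eq : calP k%:Z chi chi' t x = (r%:~R)%:E.
Proof.
have [sr el er tg] := seg_path cN Heta h0 ht HE lB sil S0 m1l; rewrite -/A -/G sT in sr el er tg.
have AW : A (- W%:Z - 1) = r + k%:Z by rewrite -AE (good_first ixs gd).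
have [r0 _] := good_ge0 gd; rewrite -/r in r0.
have aA : adm A by apply: run_adm; exact: first_height_adm.
apply: (@sup_labels R (- k%:Z + 1) r); first by move: r0 k0; clear; lia.
move=> n; rewrite /=.
have -> : (- t `^ chi' < (x n (t - t `^ chi))%:~R) = (- W%:Z <= x n (t - t `^ chi)).
  rewrite ltrNl -rmorphN -ceil_gt_int.
  by have := WE; move: (Num.ceil _) (x n _) => c y; generalize (W%:Z) => w; clear => ->; apply/idP/idP; lia.
suff H : - k%:Z + 1 <= n -> (- W%:Z <= x n (t - t `^ chi)) = (n <= r).
  by split=> [[n1]|[n1 n2]]; [rewrite H|rewrite H].
move=> n1; have [x0 tx _ _] := tags n1.
have [f1 f2] := x_init_tag n1; rewrite -x0 in f1 f2.
have [xl|xl] := lerP (x n 0) zl.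
  have := barrier_left (lexx 0) tx (r' := t) (b := zl) (fun u d u0 ut => silent_bond cN HE lB sil (or_introl erefl) zlr u0 ut) xl s0 st.
  have h1 := adm_le (@first_height_adm k) xl; rewrite f1 -el in h1.
  have h2 := adm_le aA (ltW zlW); rewrite AW in h2.
  by move: h1 h2 zlW; move: (A zl) (x n (t - _)) => u v; clear; lia.
have xr : x n 0 <= zr by rewrite x0 /x_init; case: ifP; move: n1 zrk; clear; lia.
have [y1 y2 F _] := tg (x n) (n + k%:Z) tx xl xr.
have [g1 g2] := F (conj f1 f2).
move: y1 y2 g1 g2; move: (x n (t - _)) => y y1 y2 g1 g2.
apply/idP/idP => Hy.
  have := adm_le aA (_ : - W%:Z - 1 <= y - 1); rewrite g2 AW => /(_ ltac:(move: Hy; clear; lia)); clear; lia.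
rewrite leNgt; apply/negP => yW.
have := adm_le aA (_ : y <= - W%:Z - 1); rewrite g1 AW => /(_ ltac:(move: yW; clear; lia)); move: Hy; clear; lia.
Qed.

(** The counterpart of [calP_eq] for holes: the conserved sum [n + k] is compared with
    [G W + W = E + k]. *)
Lemma calH_eq : calH k%:Z chi chi' t hh = (E%:~R)%:E.
Proof.
have [sr el er tg] := seg_path cN Heta h0 ht HE lB sil S0 m1l; rewrite -/A -/G sT in sr el er tg.
have GW : G W%:Z = E - W%:Z + k%:Z by rewrite -GE (good_second ixs gd).
have [_ E0] := good_ge0 gd; rewrite -/E in E0.
have aG : adm G by apply: run_adm; exact: second_height_adm.
apply: (@sup_labels R (- k%:Z + 1) E); first by move: E0 k0; clear; lia.
move=> n; rewrite /=.
have -> : ((hh n (t - t `^ chi))%:~R < t `^ chi') = (hh n (t - t `^ chi) <= W%:Z).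
  rewrite -ceil_gt_int.
  by have := WE; move: (Num.ceil _) (hh n _) => c y; generalize (W%:Z) => w; clear => ->; apply/idP/idP; lia.
suff H : - k%:Z + 1 <= n -> (hh n (t - t `^ chi) <= W%:Z) = (n <= E).
  by split=> [[n1]|[n1 n2]]; [rewrite H|rewrite H].
move=> n1; have [_ _ x0 tx] := tags n1.
have [f1 f2] := h_init_tag n1; rewrite -x0 in f1 f2.
have [xr|xr] := ltrP zr (hh n 0).
  have := barrier_right (lexx 0) tx (r' := t) (b := zr) (fun u d u0 ut => silent_bond cN HE lB sil (or_intror erefl) zlr u0 ut) xr s0 st.
  have h1 := adm_lip (@second_height_adm k) (_ : zr <= hh n 0 - 1); rewrite f2 -er in h1.
  have h2 := adm_lip aG (ltW zrW); rewrite GW in h2.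
  move: (h1 ltac:(move: xr; clear; lia)) h2 zrW; move: (G zr) (hh n (t - _)) (hh n 0) => u v w; clear; lia.
have xl : zl < hh n 0 by rewrite x0 /h_init; case: ifP; move: n1 zlk; clear; lia.
have [y1 y2 _ F] := tg (hh n) (n + k%:Z) tx xl xr.
have [g1 g2] := F (conj f1 f2).
move: y1 y2 g1 g2; move: (hh n (t - _)) => y y1 y2 g1 g2.
apply/idP/idP => Hy.
  have := adm_lip aG Hy; rewrite g1 GW; clear; lia.
rewrite leNgt; apply/negP => yW.
have := adm_lip aG (_ : W%:Z <= y - 1); rewrite g2 GW => /(_ ltac:(move: yW; clear; lia)); move: Hy; clear; lia.
Qed.

Lemma omega_word : ((X%:~R : R)%:E - calH k%:Z chi chi' t hh + calP k%:Z chi chi' t x)%E =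
  ((index 2%N xt.2)%:R - k%:R)%:E.
Proof.
rewrite calP_eq calH_eq -EFinB -EFinD; congr (_%:E).
have [sr _ _ _] := seg_path cN Heta h0 ht HE lB sil S0 (leqnn _); rewrite take_size tT in sr.
have [s1 s2] := sr X zlX zrX; rewrite eX /= in s1 s2.
have := good_position ixt gd (X := X).
rewrite /xt !hgt_run hgt_start2 hgt_start3 -/xt => /(_ s2 ltac:(by apply/eqP; rewrite -subr_eq0 s1)) XE.
rewrite {1}XE -/E -/r !rmorphD !rmorphN /= -!pmulrn; ring.
Qed.

End OmegaWord.

(** * Silent bonds and measurability *)

Section Silent.
Context {R : realType}.
Variables (p q h : R) (B : nat).
Hypotheses (p0 : 0 <= p) (q0 : 0 <= q) (pq : p + q = 1) (h0 : 0 <= h) (h1 : h <= 1)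
  (hL : h * (B + B)%:R <= 1).

Definition hit (c : int * bool) (f : int -> bool) : int -> bool := fun b => (b == c.1) || f b.

(** With [g = 0] the indicator that all the bonds of [s] have been hit; the family
    over [g] is what one step of the chain maps into itself. *)
Definition hitw (g : R) (s : seq int) (f : int -> bool) : R := \prod_(b <- s) (if f b then 1 else g).

Lemma hitw_ge0 g s f : 0 <= g -> 0 <= hitw g s f.
Proof. by move=> g0; apply: prodr_ge0 => b _; case: ifP. Qed.

Lemma hitw_notin g s f c : c.1 \notin s -> hitw g s (hit c f) = hitw g s f.
Proof.
move=> cs; rewrite /hitw big_seq [RHS]big_seq; apply: eq_bigr => b bs.
by rewrite /hit; case: eqP => // e; rewrite -e bs in cs.
Qed.

(** A step hits at most one bond, so hits are negatively correlated: the product with parameter [g]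
    stays below the one with [g + h * (1 - g)]. Iterated from 0 this parameter is
    [1 - (1 - h) ^+ j]. *)
Lemma hitw_sum g s f : 0 <= g -> g <= 1 -> uniq s ->
  hitw g s f + h * \sum_(b <- s) (hitw g s (hit (b, true) f) - hitw g s f) <= hitw (g + h * (1 - g)) s f.
Proof.
move=> g0 g1; elim: s => [|b s IH] /=; first by rewrite /hitw !big_nil mulr0 addr0.
move=> /andP[bs us]; rewrite big_cons; have {}IH := IH us.
have E (g' : R) f' : hitw g' (b :: s) f' = (if f' b then 1 else g') * hitw g' s f' by rewrite /hitw big_cons.
rewrite !E hitw_notin// {1}/hit /= eqxx /= mul1r.
rewrite (eq_big_seq (fun b' => (if f b then 1 else g) * (hitw g s (hit (b', true) f) - hitw g s f))); last first.
  move=> b' b's; rewrite !E {1}/hit /= (_ : (b == b') = false) ?mulrBr//.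
  by apply/eqP => e; rewrite e b's in bs.
rewrite -big_distrr /=; set a := (if f b then 1 else g); set a' := (if f b then 1 else _).
set S := \sum_(b' <- s) _ in IH *; set F := hitw g s f in IH *; set F' := hitw _ s f in IH *.
have a'E : a' = a + h * (1 - a) by rewrite /a' /a; case: (f b) => //; ring.
have a0 : 0 <= a by rewrite /a; case: (f b).
have a1 : a <= 1 by rewrite /a; case: (f b).
have S0 : 0 <= S.
  rewrite /S; apply: sumr_ge0 => b' _; rewrite subr_ge0 /F /hitw; apply: ler_prod => z _.
  by rewrite /hit; case: (z == _) => /=; case: (f z); rewrite ?g0 ?g1 ?ler01 ?lexx.
have aa' : a <= a' by rewrite a'E lerDl mulr_ge0// subr_ge0.
have a'0 := le_trans a0 aa'.
apply: le_trans (ler_wpM2l a'0 IH); rewrite (mulrDr a').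
rewrite (_ : a * F + _ = (a + h * (1 - a)) * F + h * (a * S)); last by ring.
by rewrite -a'E lerD2l mulrCA ler_wpM2r// mulr_ge0.
Qed.

Lemma silent_Ex j s f : uniq s -> {subset s <= box B} ->
  Ex p q h (box B) hit j (hitw 0 s) f <= hitw (1 - (1 - h) ^+ j) s f.
Proof.
move=> us sB; have hL' : h * (size (box B))%:R <= 1 by rewrite size_box.
suff H i g : 0 <= g <= 1 -> Ex p q h (box B) hit i (hitw g s) f <= hitw (1 - (1 - g) * (1 - h) ^+ i) s f.
  by have := H j 0 ltac:(by rewrite lexx ler01); rewrite subr0 mul1r.
elim: i g => [|i IH] g /andP[g0 g1]; first by rewrite expr0 mulr1 subKr.
rewrite ExSr; apply: (@le_trans _ _ (Ex p q h (box B) hit i (hitw (g + h * (1 - g)) s) f)).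
  apply: (Ex_le p0 q0 pq h0 hL') => f'; apply: le_trans (hitw_sum f' g0 g1 us).
  rewrite /stp lerD2l ler_wpM2l// /gen.
  rewrite (eq_bigr (fun b => hitw g s (hit (b, true) f') - hitw g s f')); last first.
    move=> b _; have -> : hit (b, false) f' = hit (b, true) f' by [].
    by rewrite -mulrDl pq mul1r.
  rewrite (bigID (mem s)) /= [X in _ + X]big1 ?addr0; last first.
    by move=> b bs; rewrite hitw_notin// subrr.
  rewrite -big_filter le_eqVlt; apply/orP; left; apply/eqP; apply: perm_big; apply: uniq_perm => //.
    by rewrite filter_uniq// uniq_box.
  by move=> b; rewrite mem_filter; apply/andP/idP => [[]//|bs]; split => //; exact: sB.
have -> : 1 - (1 - g) * (1 - h) ^+ i.+1 = 1 - (1 - (g + h * (1 - g))) * (1 - h) ^+ i by rewrite exprS; ring.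
have hg : 0 <= h * (1 - g) by rewrite mulr_ge0 ?subr_ge0.
have hg1 : h * (1 - g) <= 1 - g by rewrite ler_piMl ?subr_ge0.
by apply: IH; rewrite addr_ge0//= addrC -lerBrDr.
Qed.

Lemma hitwE g s : hitw g s (fun=> false) = g ^+ size s.
Proof. by rewrite /hitw big_const_seq count_predT; elim: (size s) => [|n IH] /=; rewrite ?expr0// IH exprS. Qed.

Lemma run_hit (l : seq mark) f b : run hit l f b = f b || has (fun o => if o is Some c then c.1 == b else false) l.
Proof.
elim: l f => [|a l IH] f /=; first by rewrite orbF.
rewrite IH; case: a => [c|] //=; rewrite /hit orbA [f b || _]orbC; congr (_ || _ || _).
by rewrite eq_sym.
Qed.

Lemma hitw_silent (l : seq mark) s : ~ (exists2 b, b \in s & forall b' d, Some (b', d) \in l -> b' <> b) ->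
  hitw 0 s (run hit l (fun=> false)) = 1 :> R.
Proof.
move=> nx; rewrite /hitw big_seq big1// => b bs; rewrite run_hit /=; case: hasP => // nh.
exfalso; apply: nx; exists b => // b' d bl e; apply: nh; exists (Some (b', d)) => //=.
by rewrite e.
Qed.

End Silent.

Lemma squeeze_alg (R : realType) (u1 u0 b x : R) : u1 <= x + b -> u0 <= 1 - x + b ->
  u1 - b <= x /\ x <= 1 - u0 + b.
Proof. by split; lra. Qed.

(** * Measurability and two-sided bounds for events *)

Section Measure.
Context {R : realType} d (Omega : measurableType d) (P : probability Omega R).

Lemma measurable_int (f : Omega -> int) (Q : int -> Prop) :
  (forall y, measurable [set w | f w = y]) -> measurable [set w | Q (f w)].
Proof.
move=> mf; have -> : [set w | Q (f w)] = \bigcup_(y : int) [set w | f w = y /\ Q y].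
  by apply/seteqP; split => [w Qw|w [y _ [/= <-]]//]; exists (f w).
apply: countable_bigcupT_measurable; first exact: countableP.
move=> y; have [Qy|nQ] := pselect (Q y).
  by rewrite (_ : [set w | _] = [set w | f w = y])//; apply/seteqP; split => w /=; [case|].
by rewrite (_ : [set w | _] = set0)//; apply/seteqP; split => w //= [].
Qed.

(** The supremum exceeds [x] exactly when some integer label above [x] qualifies, a countable
    union. *)
Lemma measurable_label_sup (f : int -> Omega -> int) (a : int) (Q : int -> Prop) :
  (forall n y, a <= n -> measurable [set w | f n w = y]) ->
  measurable_fun setT ((fun w => ereal_sup [set (n%:~R : R)%:E | n in [set n : int | a <= n /\ Q (f n w)]]) : Omega -> \bar R).
Proof.
move=> mf; apply: (measurability _ (ErealGenOInfty.measurableE R)) => // _ [_ [x ->] <-].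
rewrite setTI.
rewrite (_ : _ @^-1` _ = \bigcup_(n : int) [set w | (a <= n /\ (x%:E < (n%:~R : R)%:E)%E) /\ Q (f n w)]).
  apply: countable_bigcupT_measurable; first exact: countableP.
  move=> n; have [[an xn]|nn] := pselect (a <= n /\ (x%:E < (n%:~R : R)%:E)%E).
    rewrite (_ : [set w | _] = [set w | Q (f n w)]); first by apply: measurable_int => y; exact: mf.
    by apply/seteqP; split => w /=; [case|].
  by rewrite (_ : [set w | _] = set0)//; apply/seteqP; split => w //= [].
apply/seteqP; split => w /=.
  rewrite in_itv /= andbT => /ereal_sup_gt[_ [n [an Qn] <-] xn].
  by exists n.
move=> [n _ [[an xn] Qn]]; rewrite in_itv /= andbT; apply: lt_le_trans xn _.
by apply: ereal_sup_ubound; exists n.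
Qed.

Lemma measurable_int_fun (f : Omega -> int) : (forall y, measurable [set w | f w = y]) ->
  measurable_fun setT ((fun w => ((f w)%:~R : R)%:E) : Omega -> \bar R).
Proof.
move=> mf; apply: (measurability _ (ErealGenOInfty.measurableE R)) => // _ [_ [x ->] <-].
rewrite setTI (_ : _ @^-1` _ = [set w | (x%:E < ((f w)%:~R : R)%:E)%E]).
  exact: (measurable_int (fun y => (x%:E < (y%:~R : R)%:E)%E : Prop)).
by apply/seteqP; split => w /=; rewrite in_itv /= andbT.
Qed.

(** Patterns only bound probabilities from below; used for the event and for its complement they
    give both bounds, without any control of the patterns left out. *)
Lemma squeeze_prob (A U1 U0 bad : set Omega) (u1 u0 b : R) :
  measurable A -> measurable U1 -> measurable U0 -> measurable bad ->
  P U1 = u1%:E -> P U0 = u0%:E -> (P bad <= b%:E)%E ->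
  U1 `<=` A `|` bad -> U0 `<=` (~` A) `|` bad ->
  u1 - b <= fine (P A) /\ fine (P A) <= 1 - u0 + b.
Proof.
move=> mA m1 m0 mb e1 e0 eb s1 s0.
have fA : P A = (fine (P A))%:E by rewrite fineK// fin_num_measure.
have h1 : (P U1 <= P A + b%:E)%E.
  apply: (@le_trans _ _ (P (A `|` bad))); first by apply: le_measure; rewrite ?inE//; exact: measurableU.
  by apply: (@le_trans _ _ (P A + P bad)%E); [exact: measureU2|rewrite leeD2l].
have h0 : (P U0 <= P (~` A) + b%:E)%E.
  apply: (@le_trans _ _ (P (~` A `|` bad))).
    by apply: le_measure; rewrite ?inE//; apply: measurableU => //; exact: measurableC.
  by apply: (@le_trans _ _ (P (~` A) + P bad)%E); [apply: measureU2 => //; exact: measurableC|rewrite leeD2l].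
move: h1 h0; rewrite e1 e0 probability_setC// fA /= -EFinB -!EFinD !lee_fin.
exact: squeeze_alg.
Qed.

Lemma bounded_ev (f : Omega -> int) (e : R) : (forall y, measurable [set w | f w = y]) -> 0 < e ->
  exists n : nat, (P [set w | (n%:Z < `|f w|)%R] <= e%:E)%E.
Proof.
move=> mf e0; pose F (n : nat) := [set w | n%:Z < `|f w|].
have mF n : measurable (F n) by exact: (measurable_int (fun y => n%:Z < `|y| : Prop)).
have F0 : \bigcap_n F n = set0.
  apply/seteqP; split => // w /(_ (absz (f w)) I) /=; rewrite /F /=; lia.
have : P \o F @ \oo --> P (\bigcap_n F n).
  apply: nonincreasing_cvg_mu => //.
  - by rewrite (le_lt_trans (probability_le1 _ (mF 0%N)))// ltry.
  - by rewrite F0.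
  move=> n m nm; apply/subsetPset => w; rewrite /F /=; apply: le_lt_trans; rewrite lez_nat; exact: nm.
rewrite F0 measure0 => /fine_cvgP[_ /cvgrPdist_le /(_ e e0) [n _ /(_ n (leqnn n))]].
rewrite /= sub0r normrN => He; exists n.
rewrite -[P _]fineK ?lee_fin; last by rewrite fin_num_measure//; exact: mF.
exact: le_trans (ler_norm _) He.
Qed.

End Measure.

Lemma bernoulli_le (R : realType) (y : R) m : 0 <= y -> y <= 1 -> 1 - m%:R * y <= (1 - y) ^+ m.
Proof.
move=> y0 y1; elim: m => [|m IH]; first by rewrite mul0r subr0 expr0.
rewrite exprSr; have y1' : 0 <= 1 - y by rewrite subr_ge0.
apply: le_trans (ler_wpM2r y1' IH); rewrite -natr1.
have : 0 <= m%:R * (y * y) by rewrite !mulr_ge0.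
move: (m%:R) => u; clear; lra.
Qed.

(** The total mass of the patterns: two rings in a cell cost [(L * h) ^ 2] for about [t / h] cells,
    and a ring in the initial cell, of length at most [h], costs [L * h]. *)
Lemma nu_bound (R : realType) (L h t eta : R) m : 0 <= L -> 0 <= h -> L * h <= 1 -> m%:R * h <= t -> t <= m%:R * h + h ->
  L * h * (1 + L * t) <= eta ->
  1 - eta <= expR (- (L * t)) * (1 + h * L) ^+ m /\ expR (- (L * t)) * (1 + h * L) ^+ m <= 1.
Proof.
move=> L0 h0 x1 mt tm he; set x := L * h in x1 he.
have x0 : 0 <= x by rewrite mulr_ge0.
have -> : h * L = x by rewrite mulrC.
split; last first.
  have : (1 + x) ^+ m <= expR (L * t).
    apply: (@le_trans _ _ (expR x ^+ m)).
      by apply: lerXn2r; rewrite ?nnegrE ?expR_ge0 ?expR_ge1Dx// addr_ge0.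
    by rewrite -expRM_natr ler_expR /x -mulrA ler_wpM2l// mulrC.
  by move=> H; rewrite expRN [leLHS]mulrC ler_pdivrMr ?expR_gt0// mul1r.
have k1 : expR x * (1 - x * x) <= 1 + x.
  have : 1 - x <= expR (- x) by exact: expR_ge1Dx.
  rewrite expRN -[leRHS]mul1r ler_pdivlMr ?expR_gt0// => k.
  have -> : expR x * (1 - x * x) = ((1 - x) * expR x) * (1 + x) by ring.
  by rewrite ler_piMl// addr_ge0.
have xx1 : x * x <= 1 by rewrite -[leRHS]mulr1; apply: ler_pM.
have k2 : expR (x * m%:R) * (1 - m%:R * (x * x)) <= (1 + x) ^+ m.
  apply: (@le_trans _ _ ((expR x * (1 - x * x)) ^+ m)).
    rewrite exprMn -expRM_natr ler_wpM2l ?expR_ge0//.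
    by apply: bernoulli_le => //; rewrite mulr_ge0.
  by apply: lerXn2r; rewrite ?nnegrE ?mulr_ge0 ?expR_ge0 ?subr_ge0// addr_ge0.
apply: le_trans (ler_wpM2l (expR_ge0 _) k2); rewrite [leRHS]mulrA -expRD.
have mx : m%:R * (x * x) <= x * (L * t).
  rewrite (_ : m%:R * (x * x) = x * (L * (m%:R * h))); last by rewrite /x; ring.
  by rewrite ler_wpM2l// ler_wpM2l.
have e1 : 1 - x <= expR (- (L * t) + x * m%:R).
  apply: le_trans (expR_ge1Dx _); rewrite lerD2l /x.
  have := ler_wpM2l L0 tm; rewrite mulrDr; move: (m%:R) => u; clear; lra.
have [neg|pos] := lerP (1 - m%:R * (x * x)) 0; last first.
  apply: le_trans (ler_wpM2r (ltW pos) e1).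
  have : 0 <= x * (m%:R * (x * x)) by rewrite !mulr_ge0.
  move: he mx; move: (m%:R * (x * x)) (L * t) => u v; clear; lra.
have le1 : 1 - eta <= 1 - m%:R * (x * x).
  move: he mx x0; move: (m%:R * (x * x)) (L * t) => u v; clear; lra.
apply: le_trans le1 _.
have e2 : expR (- (L * t) + x * m%:R) <= 1.
  by rewrite -[leRHS]expR0 ler_expR addrC subr_le0 /x -mulrA ler_wpM2l// mulrC.
by rewrite -[leLHS]mul1r; apply: ler_wnM2r.
Qed.

Section UnionWords.
Context {R : realType} d (Omega : measurableType d) (P : probability Omega R).
Variables (p q : R) (N : int * bool -> R -> Omega -> nat).
Hypotheses (p0 : 0 <= p) (q0 : 0 <= q) (pq : p + q = 1).
Hypothesis HN : independent_poisson_processes P (fun c : int * bool => if c.2 then p else q) N.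
Variables (t h : R) (B m : nat).
Hypotheses (h0 : 0 <= h) (ht : m%:R * h <= t).

Lemma words_disj l l' : l \in words B m -> l' \in words B m -> l != l' ->
  wordE N t h B l `&` wordE N t h B l' = set0.
Proof.
rewrite !mem_words => /andP[/eqP sl al] /andP[/eqP sl' al'] ne.
apply/seteqP; split => // w [H H']; case/eqP: ne.
apply: (@eq_from_nth _ None); first by rewrite sl sl'.
move=> j jl; rewrite /wordE /= sl in H; rewrite /wordE /= sl' in H'; rewrite sl in jl.
have key c : c \in bonds B -> (nth None l j == Some c) = (nth None l' j == Some c).
  move=> cB; have := H c j.+1 cB jl; rewrite (H' c j.+1 cB jl) => /eqP; rewrite eqn_add2l /=.
  by case: (nth None l j == Some c); case: (nth None l' j == Some c).
have inl : nth None l j \in letters B by apply: (allP al); apply: mem_nth; rewrite sl.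
have inl' : nth None l' j \in letters B by apply: (allP al'); apply: mem_nth; rewrite sl'.
have inb c : Some c \in letters B -> c \in bonds B.
  by rewrite in_cons /= => /mapP[c' c'B [->]].
case E : (nth None l j) => [c|].
  by have := key c (inb c _); rewrite E eqxx => /(_ _)/esym/eqP; rewrite -E => ->.
case E' : (nth None l' j) => [c|] //.
have cB : c \in bonds B by apply: inb; rewrite -E'.
by have := key c cB; rewrite E' eqxx E.
Qed.

Lemma union_words (s : seq (seq mark)) : uniq s -> {subset s <= words B m} ->
  measurable (\big[setU/set0]_(l <- s) wordE N t h B l) /\
  P (\big[setU/set0]_(l <- s) wordE N t h B l) = (\sum_(l <- s) expR (- ((B + B)%:R * t)) * wrate p q h l)%:E.
Proof.
elim: s => [|l s IH] /=; first by rewrite !big_nil measure0.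
move=> /andP[ls us] sw; have [mI PI] := IH us (fun l' l's => sw l' (mem_behead (s := l :: s) l's)).
have lw := sw l (mem_head _ _).
have sl : size l = m by move: lw; rewrite mem_words => /andP[/eqP].
have ml : measurable (wordE N t h B l) by apply: (measurable_wordE HN B h0); rewrite sl.
rewrite !big_cons; split; first exact: measurableU.
rewrite measureU//; last first.
  rewrite big_distrr /=; rewrite big_seq big1// => l' l's; apply: words_disj => //.
    by apply: sw; rewrite in_cons l's orbT.
  by apply: contraNneq ls => ->.
rewrite EFinD; congr (_ + _)%E; last exact: PI.
by apply: (prob_wordE p0 q0 pq HN) => //; rewrite sl.
Qed.

End UnionWords.

(** * Transfer to the process *)

Definition event {R : realType} {Omega : Type} (chi chi' t r : R) (k : nat)
    (X : R -> Omega -> int) (x hh : int -> R -> Omega -> int) : set Omega :=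
  [set w | (r%:E < `| ((X t w)%:~R)%:E - calH k%:Z chi chi' t (fun n s => hh n s w)
                      + calP k%:Z chi chi' t (fun n s => x n s w) |)%E].

Lemma event_measurable (R : realType) d (Omega : measurableType d) (chi chi' t r : R) (k : nat)
    (X : R -> Omega -> int) (x hh : int -> R -> Omega -> int) :
  0 <= t -> 0 <= t - t `^ chi ->
  (forall n s y, - k%:Z + 1 <= n -> 0 <= s ->
    measurable [set w | x n s w = y] /\ measurable [set w | hh n s w = y]) ->
  (forall s y, 0 <= s -> measurable [set w | X s w = y]) ->
  measurable (event chi chi' t r k X x hh).
Proof.
move=> t0 s0 mxh mX.
have mP : measurable_fun setT ((fun w => calP k%:Z chi chi' t (fun n s => x n s w)) : Omega -> \bar R).
  apply: (measurable_label_sup (f := fun n w => x n (t - t `^ chi) w) (fun y => (- t `^ chi' < y%:~R) : Prop)) => n y nk.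
  by have [] := mxh n _ y nk s0.
have mH : measurable_fun setT ((fun w => calH k%:Z chi chi' t (fun n s => hh n s w)) : Omega -> \bar R).
  apply: (measurable_label_sup (f := fun n w => hh n (t - t `^ chi) w) (fun y => (y%:~R < t `^ chi') : Prop)) => n y nk.
  by have [] := mxh n _ y nk s0.
have mXX : measurable_fun setT ((fun w => ((X t w)%:~R : R)%:E) : Omega -> \bar R).
  by apply: measurable_int_fun => y; exact: mX.
have mF : measurable_fun setT ((fun w => `| ((X t w)%:~R)%:E - calH k%:Z chi chi' t (fun n s => hh n s w)
     + calP k%:Z chi chi' t (fun n s => x n s w) |%E) : Omega -> \bar R).
  apply: (measurableT_comp (f := @abse R)); first exact: abse_measurable.
  by apply: emeasurable_funD => //; exact: emeasurable_funB.
have := emeasurable_fun_o_infty measurableT mF r%:E; rewrite setTI; exact.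
Qed.

(** [h] divides [tc] exactly, so that [t - tc] is a point of the grid; what is left of [t] goes to
    the initial cell. Under [h * L <= 1 / 20] the normalized step is at least [20 / 21 * h], which
    keeps the chain in its regime. *)
Lemma step_sizes (R : realType) (t tc h0 L : R) : 0 < t -> 0 < tc -> tc <= t / 100 -> 0 < h0 -> 0 <= L ->
  exists (h : R) (m1 m2 : nat),
  [/\ 0 < h <= h0, m2%:R * h = tc, (m1 + m2)%:R * h <= t, t <= (m1 + m2)%:R * h + h &
  h * L <= 1 / 20 -> [/\ 0 < h / (1 + h * L), h / (1 + h * L) <= h, 9 / 10 * t <= m1%:R * (h / (1 + h * L)),
   (m1 + m2)%:R * (h / (1 + h * L)) <= t & tc / 2 <= m2%:R * (h / (1 + h * L)) <= tc]].
Proof.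
move=> t0 tc0 tct h00 L0.
pose h1 := Num.min h0 (t / 100).
have h10 : 0 < h1 by rewrite /h1 lt_min h00 divr_gt0.
pose m2 := (Num.truncn (tc / h1)).+1; pose h := tc / m2%:R.
have m20 : 0 < m2%:R :> R by rewrite ltr0n.
have hp : 0 < h by rewrite /h divr_gt0.
have hh1 : h <= h1.
  rewrite /h ler_pdivrMr// mulrC -ler_pdivrMr//; apply: ltW; exact: truncnS_gt.
have hh0 : h <= h0 by apply: le_trans hh1 _; rewrite ge_min lexx.
have ht : h <= t / 100 by apply: le_trans hh1 _; rewrite ge_min lexx orbT.
have m2h : m2%:R * h = tc by rewrite /h mulrC divfK// gt_eqF.
have tt : 0 <= t - tc by move: tct t0; clear; lra.
pose m1 := Num.truncn ((t - tc) / h).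
have /andP[a1 a2] := truncn_itv (divr_ge0 tt (ltW hp)); rewrite -/m1 in a1 a2.
rewrite ler_pdivlMr// in a1; rewrite ltr_pdivrMr// -natr1 mulrDl mul1r in a2.
exists h, m1, m2; split => //; rewrite ?hp ?(natrD R m1) ?(mulrDl m1%:R) ?m2h//; [move: a1; clear; lra|move: a2; clear; lra|].
move=> hL; have hL0 : 0 <= h * L by rewrite mulr_ge0// ltW.
have D0 : 0 < 1 + h * L by rewrite ltr_wpDr.
have q0 : 0 < h / (1 + h * L) by rewrite divr_gt0.
have q1 : h / (1 + h * L) <= h by rewrite ler_pdivrMr// ler_peMr ?(ltW hp)// lerDl.
have q2 : 20 / 21 * h <= h / (1 + h * L).
  rewrite ler_pdivlMr//; have : 20 / 21 * (1 + h * L) <= 1 by move: hL; clear; lra.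
  move=> u; rewrite mulrAC -[leRHS]mul1r; apply: ler_wpM2r => //; exact: ltW.
have m1q : m1%:R * (20 / 21 * h) <= m1%:R * (h / (1 + h * L)) by rewrite ler_wpM2l.
have m1q' : m1%:R * (h / (1 + h * L)) <= m1%:R * h by rewrite ler_wpM2l.
have m2q : m2%:R * (20 / 21 * h) <= m2%:R * (h / (1 + h * L)) by rewrite ler_wpM2l ?(ltW m20).
have m2q' : m2%:R * (h / (1 + h * L)) <= m2%:R * h by rewrite ler_wpM2l ?(ltW m20).
rewrite mulrCA m2h in m2q; rewrite m2h in m2q'; rewrite mulrCA in m1q.
move: (m1%:R * (h / _)) (m2%:R * (h / _)) (m1%:R * h) m1q m1q' m2q m2q' a1 a2 => u w z m1q m1q' m2q m2q' a1 a2.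
split => //; [move: m1q a2 ht tct t0|move: m1q' m2q' a1|apply/andP; split; move: m2q m2q' tc0]; clear; lra.
Qed.

(** On a good pattern with a silent bond on either side, [omega_word] makes the event a function of
    the word. Three of the six [eta] pay for goodness and the two silent bonds, one for the
    exceptional set [bad], one for the mass of the patterns and one for the relaxation. *)
Lemma prob_far (R : realType) d (Omega : measurableType d) (P : probability Omega R)
    (p q chi chi' t r eta : R) (k : nat)
    (et : R -> Omega -> int -> site) (x hh : int -> R -> Omega -> int) (X : R -> Omega -> int) :
  0 <= p -> 0 <= q -> p + q = 1 -> (0 < k)%N -> 0 < eta -> 0 < chi' -> 1 <= t -> t `^ chi <= t / 100 ->
  second_class_asep p q k%:Z P et x hh X ->
  (exists B0 : nat, forall B, (B0 <= B)%N -> exists2 h0 : R, 0 < h0 & forall h, 0 < h <= h0 ->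
  forall m1 m2 : nat, 9 / 10 * t <= m1%:R * h -> (m1 + m2)%:R * h <= t ->
  t `^ chi / 2 <= m2%:R * h <= t `^ chi ->
  Ex p q h (box B) (fact k) m1 (fun xs => Ex p q h (box B) (fact k) m2
    (fun xt => (~~ good k (window chi' t) xs xt)%:R) xs) (x_start k) <= eta /\
  forall phi, (forall c, 0 <= phi c <= 1) ->
  `|Ex p q h (box B) (fact k) (m1 + m2) (fun x => phi x.2) (x_start k) - stat (q / p) k phi| <= eta) ->
  `|fine (P (event chi chi' t r k X x hh)) - stat (q / p) k (far r k)| <= 6 * eta.
Proof.
move=> p0 q0 pq k0 eta0 chi'0 t1 tct HA CH.
have [_ mxh mX [N [HN path]]] := HA.
have t0 : 0 < t := lt_le_trans ltr01 t1.
have tc0 : 0 < t `^ chi by rewrite powR_gt0.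
have s0 : 0 <= t - t `^ chi by move: tct t0; clear; lra.
have mE := event_measurable chi' r (ltW t0) s0 mxh mX.
have [B0 HB0] := CH.
(* The local rules give no bound on the position at time [t]; up to probability [eta] it is confined
   to an interval fixed before the box. *)
have [n0 Hn0] := bounded_ev P (fun y => mX t y (ltW t0)) eta0.
have e2t : 0 <= 1 - expR (- (2 * t)) < 1.
  rewrite subr_ge0 -[X in expR _ <= X]expR0 ler_expR oppr_le0 mulr_ge0 ?(ltW t0)//=.
  by rewrite gtrBl expR_gt0.
(* Each candidate bond rings before [t] with probability at most [1 - exp (- 2 t)], so among [n] of
   them all do so with probability at most [eta]. *)
have [n Hn] := small_pow e2t eta0.
pose W := window chi' t.
(* The box leaves room for [n] candidate bonds on each side, outside the window, the word and the
   range of [X]. *)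
pose B := (B0 + n0 + W + k + n + 5)%N.
have [hc hc0 Hc] := HB0 B ltac:(by rewrite /B; clear; lia).
pose L : R := (B + B)%:R; have L0 : 0 <= L by [].
pose hm := Num.min (Num.min hc 2^-1) (Num.min (1 / 20 / (L + 1)) (eta / ((L + 1) * (1 + L * t)))).
have Lt0 : 0 <= L * t by rewrite mulr_ge0// ltW.
have hm0 : 0 < hm.
  rewrite /hm !lt_min hc0 /= invr_gt0 ltr0n /=; apply/andP; split; apply: divr_gt0 => //.
  - exact: ltr_wpDl.
  - by apply: mulr_gt0; [exact: ltr_wpDl|exact: ltr_wpDr].
have [h [m1 [m2 [/andP[h0 hhm] m2h mt tm Hh]]]] := step_sizes t0 tc0 tct hm0 L0.
have [hhc h12 h20 heta] : [/\ h <= hc, h <= 2^-1, h * L <= 1 / 20 & L * h * (1 + L * t) <= eta].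
  move: hhm; rewrite /hm !le_min => /andP[/andP[-> ->] /andP[u1 u2]]; split => //.
    rewrite ler_pdivlMr in u1; last exact: ltr_wpDl.
    by apply: le_trans u1; rewrite ler_wpM2l ?(ltW h0)// lerDl.
  rewrite ler_pdivlMr in u2; last by apply: mulr_gt0; [exact: ltr_wpDl|exact: ltr_wpDr].
  apply: le_trans u2; rewrite mulrA; apply: ler_wpM2r; first by rewrite addr_ge0.
  by rewrite mulrC ler_wpM2l ?(ltW h0)// lerDl.
have [h'0 h'h c1 c2 c3] := Hh h20.
set h' := h / (1 + h * L) in h'0 h'h c1 c2 c3.
have h'E : hstep h B = h' by [].
have hL1 : L * h <= 1 by rewrite mulrC; apply: le_trans h20 _; clear; lra.
have hL' : h' * (B + B)%:R <= 1.
  by apply: le_trans hL1; rewrite mulrC ler_wpM2l.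
have h'1 : h' <= 1 by apply: le_trans h'h (le_trans h12 _); clear; lra.
have [G1 G2] := Hc h' ltac:(by rewrite h'0 (le_trans h'h)) m1 m2 c1 c2 c3.
pose m := (m1 + m2)%N; pose nu := expR (- (L * t)) * (1 + h * L) ^+ m.
have [nu1 nu2] := nu_bound L0 (ltW h0) hL1 mt tm heta; rewrite -/m -/nu in nu1 nu2.
pose wt (l : seq mark) := expR (- (L * t)) * wrate p q h l.
have wt0 l : 0 <= wt l.
  apply: mulr_ge0; first exact: expR_ge0.
  by apply: prodr_ge0 => -[[b1 d1]|] _ //=; apply: mulr_ge0; [exact: ltW|case: d1].
have wsumE (T : Type) (act : int * bool -> T -> T) (G : T -> T -> R) z :
    \sum_(l <- words B m) wt l * G (run act (take m1 l) z) (run act l z) =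
    nu * Ex p q h' (box B) act m1 (fun zs => Ex p q h' (box B) act m2 (G zs) zs) z.
  under eq_bigr do rewrite /wt -mulrA.
  by rewrite -big_distrr /= (sum_words B pq (ltW h0)) mulrA.
pose xs l := run (fact k) (take m1 l) (x_start k); pose xt l := run (fact k) l (x_start k).
pose V l : bool := r < `|(index 2%N (xt l).2)%:R - k%:R|.
(* The [n] outermost bonds at either end of the box are the candidates for silence. *)
pose sL : seq int := [seq i%:Z - B%:Z | i <- iota 0 n]; pose sR : seq int := [seq B%:Z - 1 - i%:Z | i <- iota 0 n].
pose sil (s : seq int) (l : seq mark) := `[< exists2 b, b \in s & forall b' d, Some (b', d) \in l -> b' <> b >].
pose gw l := [&& good k W (xs l) (xt l), sil sL l & sil sR l].
have uL : uniq sL by rewrite map_inj_uniq ?iota_uniq// => i j; clear; lia.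
have uR : uniq sR by rewrite map_inj_uniq ?iota_uniq// => i j; clear; lia.
have bL : {subset sL <= box B}.
  by move=> b /mapP[i]; rewrite mem_iota mem_box => ib ->; move: ib; rewrite /B; clear; lia.
have bR : {subset sR <= box B}.
  by move=> b /mapP[i]; rewrite mem_iota mem_box => ib ->; move: ib; rewrite /B; clear; lia.
have nu0 : 0 <= nu by rewrite /nu mulr_ge0 ?expR_ge0// exprn_ge0// addr_ge0// mulr_ge0// ltW.
have silB s : uniq s -> {subset s <= box B} -> size s = n -> \sum_(l <- words B m) wt l * (~~ sil s l)%:R <= eta.
  move=> us bs ss.
  apply: (@le_trans _ _ (\sum_(l <- words B m) wt l * (fun _ f => hitw 0 s f) (run hit (take m1 l) (fun=> false)) (run hit l (fun=> false)))).
    apply: ler_sum => l _; apply: ler_wpM2l => //; rewrite /sil; case: asboolP => nx /=.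
      exact: hitw_ge0.
    by rewrite hitw_silent.
  rewrite (wsumE _ hit (fun _ f => hitw 0 s f)) -Ex_add -[leRHS]mul1r; apply: ler_pM => //.
    by apply: (Ex_ge0 p0 q0 pq (ltW h'0)); [rewrite size_box|move=> f; exact: hitw_ge0].
  apply: le_trans (silent_Ex p0 q0 pq (ltW h'0) h'1 hL' _ _ us bs) _.
  rewrite hitwE ss; apply: le_trans (Hn n (leqnn n)).
  have hp1 : (1 - h') ^+ (m1 + m2) <= 1 by rewrite exprn_ile1 ?subr_ge0// gerBl ltW.
  apply: lerXn2r; rewrite ?nnegrE ?subr_ge0//; first by case/andP: e2t; rewrite subr_ge0.
  rewrite lerD2l lerN2; apply: (@le_trans _ _ (expR (- (2 * h')) ^+ (m1 + m2))).
    rewrite -expRM_natr ler_expR mulNr lerN2 -mulrA ler_wpM2l// mulrC; exact: c2.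
  apply: lerXn2r; rewrite ?nnegrE ?expR_ge0 ?subr_ge0//.
  rewrite expRN -[leLHS]mul1r ler_pdivrMr ?expR_gt0//.
  have : 1 + 2 * h' <= expR (2 * h') by exact: expR_ge1Dx.
  move=> u; apply: le_trans (ler_wpM2l _ u); last by rewrite subr_ge0.
  move: h'0 h'h h12; move: (h') (h) => a b; clear; nra.
have goodB : \sum_(l <- words B m) wt l * (~~ good k W (xs l) (xt l))%:R <= eta.
  rewrite (wsumE _ (fact k) (fun a b => (~~ good k W a b)%:R)) -[leRHS]mul1r; apply: ler_pM => //.
  apply: (Ex_ge0 p0 q0 pq (ltW h'0)); [by rewrite size_box|move=> a].
  by apply: (Ex_ge0 p0 q0 pq (ltW h'0)); [rewrite size_box|].
pose EV := Ex p q h' (box B) (fact k) (m1 + m2) (fun z => far r k z.2) (x_start k).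
have far01 c : 0 <= far r k c <= 1 by rewrite /far; case: (_ < _)%R; rewrite ?lexx ler01.
have /andP[EV0 EV1] : 0 <= EV <= 1.
  by apply: (Ex_01 p0 q0 pq (ltW h'0)); [rewrite size_box|move=> z; exact: far01].
have sumV : \sum_(l <- words B m) wt l * (V l)%:R = nu * EV.
  by rewrite (wsumE _ (fact k) (fun _ b => far r k b.2)) -Ex_add.
have sum1 : \sum_(l <- words B m) wt l = nu.
  have := wsumE _ (fact k) (fun _ _ => 1) (x_start k); under eq_bigr do rewrite mulr1.
  by move=> ->; rewrite -Ex_add Ex_cst mulr1.
have low (Q : pred (seq mark)) : \sum_(l <- words B m) wt l * (Q l)%:R - 3 * eta <= \sum_(l <- words B m | gw l && Q l) wt l.
  rewrite lerBlDr [X in _ <= X + _]big_mkcond.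
  apply: (@le_trans _ _ (\sum_(l <- words B m) ((if gw l && Q l then wt l else 0) +
     (wt l * (~~ good k W (xs l) (xt l))%:R + wt l * (~~ sil sL l)%:R + wt l * (~~ sil sR l)%:R)))).
    apply: ler_sum => l _; rewrite /gw; have w0 := wt0 l; move: (wt l) w0 => a a0.
    by case: (good _ _ _ _); case: (sil sL l); case: (sil sR l); case: (Q l) => /=;
      rewrite ?mulr1 ?mulr0 ?addr0 ?add0r ?addr_ge0// ?lerDl ?lerDr ?addr_ge0.
  rewrite big_split /= lerD2l !big_split /=.
  rewrite (_ : 3 * eta = eta + eta + eta); last by clear; ring.
  by apply: lerD; [apply: lerD|]; rewrite ?silB// ?size_map ?size_iota.
have szw l : l \in words B m -> size l = m by rewrite mem_words => /andP[/eqP].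
pose s1 := [seq l <- words B m | gw l && V l]; pose s2 := [seq l <- words B m | gw l && ~~ V l].
have sub1 : {subset s1 <= words B m} by move=> l; rewrite mem_filter => /andP[].
have sub2 : {subset s2 <= words B m} by move=> l; rewrite mem_filter => /andP[].
have [mU1 PU1] := union_words p0 q0 pq HN (ltW h0) mt (filter_uniq _ (uniq_words B m)) sub1.
have [mU2 PU2] := union_words p0 q0 pq HN (ltW h0) mt (filter_uniq _ (uniq_words B m)) sub2.
have [_ cnt _ _] := HN; have [Z1 [mZ1 PZ1 HZ1]] := cnt; have [Z2 [mZ2 PZ2 HZ2]] := path.
pose far0 := [set w | (n0%:Z < `|X t w|)%R].
have mfar0 : measurable far0 by apply: (measurable_int (fun y => (n0%:Z < `|y|)%R : Prop)) => y; exact: mX (ltW t0).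
pose bad := Z1 `|` Z2 `|` far0.
have mbad : measurable bad by do 2 ? apply: measurableU.
have Pbad : (P bad <= eta%:E)%E.
  apply: (@le_trans _ _ (P (Z1 `|` Z2) + P far0)%E); first by apply: measureU2 => //; exact: measurableU.
  rewrite -[leRHS]add0e; apply: leeD => //.
  apply: (@le_trans _ _ (P Z1 + P Z2)%E); first exact: measureU2.
  by rewrite PZ1 PZ2 adde0.
have key l w : l \in words B m -> gw l -> wordE N t h B l w -> ~ bad w ->
   (event chi chi' t r k X x hh w <-> V l).
  move=> lw /and3P[gd /asboolP[zl zlL silL] /asboolP[zr zrR silR]] wE nb.
  have [nZ nF] : ~ (Z1 w \/ Z2 w) /\ ~ far0 w by split => h1; apply: nb; [left; exact: h1|right].
  have C1 : forall c, [/\ N c 0 w = 0%N, right_cont (N c ^~ w) & forall r s, 0 <= r -> r <= s -> (N c r w <= N c s w)%N].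
    by apply: contrapT => h1; apply: nZ; left; apply: HZ1.
  have C2 := contrapT (fun h1 => nZ (or_intror (HZ2 w h1))).
  have [e0 pth eX tg] := C2.
  have cN c : counting (fun s => N c s w) by have [_ rc mo] := C1 c.
  have [i iL zlE] := mapP zlL; have [j jR zrE] := mapP zrR; rewrite !mem_iota in iL jR.
  have Xb : `|X t w| <= n0%:Z by rewrite leNgt; apply/negP.
  have ow := @omega_word R (fun c s => N c s w) (fun s => et s w) (X t w) (fun n s => x n s w) (fun n s => hh n s w)
    cN pth t h chi chi' B k m1 m2 l zl zr (ltW h0).
  have bnd : [/\ - B%:Z <= zl, zl < - W%:Z - 1, W%:Z < zr & zr < B%:Z] /\ [/\ zl <= - k%:Z - 1, k%:Z <= zr, zl < X t w & X t w <= zr].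
    by move: Xb iL jR; rewrite zlE zrE /B; clear; move: (X t w) => y *; split; split; lia.
  have [[b1 b2 b3 b4] [b5 b6 b7 b8]] := bnd.
  rewrite /event /= ow //.
  - by rewrite (szw l lw).
  - exact: szw.
  - by move=> z z1 z2; rewrite mem_box; move: z1 z2 b1 b4; clear; lia.
  - move=> [[b d']|] // ol b' d'' [e1 _]; rewrite -e1; split; [exact: silL ol|exact: silR ol].
  - exact: eX (ltW t0).
have [lo hi] := squeeze_prob mE mU1 mU2 mbad PU1 PU2 Pbad
  ltac:(move=> w; rewrite -bigcup_seq => -[l /= ls lE]; have [bw|nb] := pselect (bad w); [by right|left];
    move: ls; rewrite mem_filter => /andP[/andP[gl vl] lw]; exact/(key l w lw gl lE nb))
  ltac:(move=> w; rewrite -bigcup_seq => -[l /= ls lE]; have [bw|nb] := pselect (bad w); [by right|left];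
    move: ls; rewrite mem_filter => /andP[/andP[gl vl] lw]; move/(key l w lw gl lE nb); exact/negP).
rewrite !big_filter in lo hi.
have L1 := low V; have L2 := low (fun l => ~~ V l).
have sumnV : \sum_(l <- words B m) wt l * (~~ V l)%:R = nu - nu * EV.
  rewrite -sumV -sum1 -sumrB; apply: eq_bigr => l _.
  by case: (V l); rewrite ?mulr1 ?mulr0 ?subrr ?subr0.
rewrite sumV in L1; rewrite sumnV in L2; rewrite -/(wt _) in lo hi.
have SE := G2 (far r k) far01; rewrite -/EV in SE.
have nE1 : EV - eta <= nu * EV.
  have : (1 - nu) * EV <= eta * 1 by apply: ler_pM => //; [rewrite subr_ge0|move: nu1; clear; lra].
  by rewrite mulr1 mulrBl mul1r; clear; lra.
have nE2 : nu * EV <= EV by rewrite ler_piMl.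
move: SE lo hi L1 L2 nu1; rewrite -/L => SE lo hi L1 L2 nu1.
rewrite ler_norml in SE; case/andP: SE => S1 S2.
rewrite ler_norml; apply/andP; split.
  move: S1 S2 lo L1 nE1; rewrite /wt; set pr := fine _; set sm := \sum_(l <- _ | _) _; set st := stat _ _ _.
  by move: pr sm (nu * EV); clear => pr sm u; lra.
move: S1 S2 hi L2 nE2 nu1; rewrite /wt; set pr := fine _; set sm := \sum_(l <- _ | _) _; set st := stat _ _ _.
by move: pr sm (nu * EV); clear => pr sm u; lra.
Qed.

Lemma kappa_large (R : realType) (p q C : R) (K : nat) : q < p ->
  \forall t \near +oo, exists k : nat, [/\ kappa_of p q C t = k%:Z, (K < k)%N &
    (p - q) * (t - C * Num.sqrt t) <= k.+1%:R].
Proof.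
move=> qp; have v0 : 0 < p - q by rewrite subr_gt0.
near=> t; have t0 : 0 < t by near: t; exact: nbhs_pinfty_gt.
have sE : t `^ 2^-1 = Num.sqrt t by rewrite powR12_sqrt// ltW.
have h1 : 2 * C * t `^ 2^-1 <= t `^ 1 by near: t; apply: powR_ev2; rewrite invf_lt1// ltr1n.
have h2 : 2 * K.+1%:R / (p - q) <= t by near: t; apply: nbhs_pinfty_ge; exact: num_real.
rewrite powRr1 ?(ltW t0)// in h1; rewrite ler_pdivrMr// in h2.
have big : K.+1%:R <= (p - q) * (t - C * t `^ 2^-1).
  have : (p - q) * (t / 2) <= (p - q) * (t - C * t `^ 2^-1).
    by rewrite ler_wpM2l ?(ltW v0)//; move: h1; clear; lra.
  by apply: le_trans; move: h2; clear; lra.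
have kK : K.+1%:Z <= kappa_of p q C t by rewrite /kappa_of floor_ge_int.
have k0 : 0 <= kappa_of p q C t by apply: le_trans kK.
exists (absz (kappa_of p q C t)); rewrite gez0_abs//; split => //.
  by rewrite -ltz_nat gez0_abs//; apply: lt_le_trans kK.
have e : (absz (kappa_of p q C t))%:R = (kappa_of p q C t)%:~R :> R by rewrite -{2}(gez0_abs k0).
have -> : (absz (kappa_of p q C t)).+1%:R = (kappa_of p q C t)%:~R + 1 :> R by rewrite -e -natr1.
by rewrite -sE; apply: ltW; have := floorD1_gt ((p - q) * (t - C * t `^ 2^-1)); rewrite rmorphD.
Unshelve. all: by end_near. Qed.

Theorem theorem2 (R : realType) (p q chi chi' : R)
  (hp : 2^-1 < p <= 1) (hq : q = 1 - p)
  (hchi : 0 < chi < 2^-1) (hchi' : chi < chi' < 2^-1)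
  (d : nat -> R -> measure_display)
  (Omega : forall (M : nat) (t : R), measurableType (d M t))
  (Pr : forall (M : nat) (t : R), probability (Omega M t) R)
  (eta : forall (M : nat) (t : R), R -> Omega M t -> int -> site)
  (x h : forall (M : nat) (t : R), int -> R -> Omega M t -> int)
  (X : forall (M : nat) (t : R), R -> Omega M t -> int)
  (hasep : forall (M : nat) (t : R), (1 <= M)%N -> 0 < t ->
     0 <= kappa_of p q (C_of p q M) t ->
     second_class_asep p q (kappa_of p q (C_of p q M) t) (Pr M t)
       (eta M t) (x M t) (h M t) (X M t))
  (eps : R) (heps : 0 < eps) :
  exists L : nat -> \bar R,
    (forall M : nat, (1 <= M)%N ->
       Pr M t [set w : Omega M t |
         ((M%:R `^ eps)%:E <
            `| ((X M t t w)%:~R)%:E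
               - calH (kappa_of p q (C_of p q M) t) chi chi' t
                   (fun n s => h M t n s w)
               + calP (kappa_of p q (C_of p q M) t) chi chi' t
                   (fun n s => x M t n s w) |)%E ]
         @[t --> +oo] --> L M) /\
    L M @[M --> \oo] --> 0%E.
Proof.
have [/andP[p2 p1] /andP[chi0 chi2] /andP[chi'1 chi'2]] := And3 hp hchi hchi'.
have p0 : 0 <= p by apply: ltW; apply: lt_trans p2; rewrite invr_gt0.
have q0 : 0 <= q by rewrite hq subr_ge0.
have pq : p + q = 1 by rewrite hq addrC subrK.
have qp : q < p by rewrite hq; move: p2; clear; lra.
have chi'0 : 0 < chi' by apply: lt_trans chi'1.
have tau01 : 0 <= q / p < 1.
  have pp : 0 < p by apply: le_lt_trans qp.
  by rewrite divr_ge0//= ltr_pdivrMr// mul1r.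
(* For fixed [M] the limit in [t] is that of the stationary probability as the length of the word
   grows with [kappa]. *)
exists (fun M => (limn (fun k => stat (q / p) k (far (M%:R `^ eps) k)))%:E); split; last first.
  apply: cvg_EFin; first by near=> M.
  apply: (stat_far_lim0 tau01 (u := fun M => M%:R `^ eps)).
  apply/cvgryPge => A; exact: (cvgr_idn (R := R) (powR_ev A heps)).
move=> M M1; set r := M%:R `^ eps; set lim := limn _.
pose C := C_of p q M.
have C0 : 0 <= C by rewrite /C /C_of mulr_ge0// sqrtr_ge0.
have main e : 0 < e -> \forall t \near +oo,
   measurable [set w : Omega M t | (r%:E < `| ((X M t t w)%:~R)%:E
               - calH (kappa_of p q C t) chi chi' t (fun n s => h M t n s w)
               + calP (kappa_of p q C t) chi chi' t (fun n s => x M t n s w) |)%E ] /\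
   `|lim - fine (Pr M t [set w : Omega M t | (r%:E < `| ((X M t t w)%:~R)%:E
               - calH (kappa_of p q C t) chi chi' t (fun n s => h M t n s w)
               + calP (kappa_of p q C t) chi chi' t (fun n s => x M t n s w) |)%E ])| <= e.
  (* One seventh for the convergence of the stationary probabilities, six for [prob_far]. *)
  move=> e0; have e7 : 0 < e / 7 by rewrite divr_gt0.
  have := @stat_far_cvg R (q / p) tau01 r => /cvgrPdist_le /(_ _ e7) [K _ HK].
  move: (chain_main hp hq hchi hchi' C0 e7); apply: filter_app.
  move: (kappa_large C K qp); apply: filter_app; near=> t => -[k [kE kK kt]] CH.
  have t1 : 1 <= t by near: t; exact: nbhs_pinfty_ge.
  have t0 : 0 < t := lt_le_trans ltr01 t1.
  have tct : t `^ chi <= t / 100.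
    rewrite ler_pdivlMr// mulrC -[leRHS](powRr1 (ltW t0)); near: t; apply: powR_ev2.
    by apply: lt_trans chi2 _; rewrite invf_lt1// ltr1n.
  have s0 : 0 <= t - t `^ chi by move: tct t0; clear; lra.
  have HA := hasep M t M1 t0 ltac:(by rewrite kE); rewrite kE in HA *.
  have [_ mxh mX _] := HA; split; first exact: event_measurable (ltW t0) s0 mxh mX.
  have k0 : (0 < k)%N by apply: leq_ltn_trans kK.
  have H1 := prob_far r p0 q0 pq k0 e7 chi'0 t1 tct HA (CH k kt).
  have H2 := HK k (ltnW kK); rewrite -/lim /= in H2.
  rewrite distrC in H1; apply: le_trans (ler_distD (stat (q / p) k (far r k)) _ _) (le_trans (lerD H2 H1) _).
  by rewrite (_ : e / 7 + 6 * (e / 7) = e)//; field.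
apply/fine_cvgP; split.
  move: (main 1 ltr01); apply: filterS => t [mA _]; exact: fin_num_measure.
apply/cvgrPdist_le => e e0; move: (main e e0); apply: filterS => t [_ H]; exact: H.
Unshelve. all: by end_near. Qed.
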